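(* Let $\epsilon>0$ be sufficiently small (in particular $\epsilon<\pi/2$), let $U\in(0,\frac{\pi}{2}-\epsilon]$, let $k_0\in\mathbb{N}$ be arbitrary and fixed, and let $1\le k_1,k_2,k_3,k_4\le k_0$. Let $f_1(t)=\cos^3 t$, $f_2(t)=\cos t$, $f_3(t)=\cos^2 t$, $f_4(t)=\sin^2 t$ on $[2\pi L,2\pi L+U]$, $L\in\mathbb{N}$, and let $\alpha_r^{j,k_j}=\alpha_r(U,L,k_j;f_j)$ ($r=0,1,\dots,k_j$) and $\beta_r^{k_j}=\beta_r(U,L,k_j)$ ($r=1,\dots,k_j$), $j=1,2,3,4$, be the functions defined in the context. Put $$P_j=\prod_{r=1}^{k_j}\left|\frac{\zeta\left(\frac12+i\alpha_r^{j,k_j}\right)}{\zeta\left(\frac12+i\beta_r^{k_j}\right)}\right|^2,\qquad j=1,2,3,4.$$ Then, as $L\to\infty$, $$P_1\sim \frac{\cos(\alpha_0^{2,k_2})}{\cos^3(\alpha_0^{1,k_1})}\,P_2-\frac{U^2}{3}\,\frac{1}{\cos^3(\alpha_0^{1,k_1})\cos^3U}\left\{\cos^2(\alpha_0^{3,k_3})\,P_3-\sin^2(\alpha_0^{4,k_4})\,P_4\right\}^3 .$$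
   Context: $\zeta$ is the Riemann zeta-function. The notation $A\sim B$ as $L\to\infty$ means $A/B\to1$ as $L\to\infty$ through positive integers, the remaining parameters ($U$ and the $k_j$) being fixed. Jacob's ladder. Let $Z$ be Hardy's function, so $Z^2(t)=|\zeta(\frac12+it)|^2$ for real $t$, and let $\mu(y)=7y\ln y$. For all sufficiently large $T$ let $\varphi(T)$ be the (unique large) solution $x=\varphi(T)$ of the equation $$\int_0^{\mu(x)}Z^2(t)e^{-2t/x}\,dt=\int_0^TZ^2(t)\,dt ,$$ and put $\varphi_1(T)=\frac12\varphi(T)$. For large arguments $\varphi_1$ is continuously differentiable, strictly increasing and unbounded. Write $\varphi_1^0(t)=t$, $\varphi_1^r=\varphi_1\circ\varphi_1^{r-1}$, and let $\varphi_1^{-k}$ be the inverse of $\varphi_1^k$ (defined for large arguments). The functions $\alpha_r,\beta_r$. Let $L$ be a sufficiently large positive integer, $T=2\pi L$, $k\in\{1,\dots,k_0\}$, and let $f\ge0$ be a continuous function, not identically zero, on $[T,T+U]$. Put $a=\varphi_1^{-k}(T)$, $b=\varphi_1^{-k}(T+U)$. By change of variables and the mean value theorem there is $d=d(U,L,k;f)\in(a,b)$ with $$\int_T^{T+U}f(t)\,dt=f(\varphi_1^k(d))\prod_{r=0}^{k-1}\varphi_1'(\varphi_1^r(d))\,(b-a),$$ and (case $f\equiv1$) there is $e=e(U,L,k)\in(a,b)$ with $$U=\prod_{r=0}^{k-1}\varphi_1'(\varphi_1^r(e))\,(b-a).$$ Fix any choice of such $d$ and $e$ and define $\alpha_r(U,L,k;f)=\varphi_1^{k-r}(d)$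 for $r=0,1,\dots,k$ and $\beta_r(U,L,k)=\varphi_1^{k-r}(e)$ for $r=1,\dots,k$. In particular $2\pi L<\alpha_0(U,L,k;f)<2\pi L+U$, and the $\beta_r$ do not depend on $f$. *)

(* Defs.v *)
From Stdlib Require Import Reals List.
From Coquelicot Require Import Coquelicot.
Open Scope R_scope.

(* * The Riemann zeta-function *)

Definition Cexp (z : C) : C :=
  (exp (Re z) * cos (Im z), exp (Re z) * sin (Im z)).

(* [m ^ (- s)] for a positive integer [m], with the real logarithm of [m]. *)
Definition nat_Cpow_opp (m : nat) (s : C) : C :=
  Cexp (- s * RtoC (ln (INR m)))%C.

Definition analytic_at (f : C -> C) (s0 : C) : Prop :=
  exists (a : nat -> C) (r : R), 0 < r /\
    forall s : C, Cmod (s - s0)%C < r ->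
      @is_pseries C_AbsRing C_NormedModule a (s - s0)%C (f s).

(* The analytic continuation of the Dirichlet series to the complex plane
   without the point 1; it is determined by these two clauses except for its
   (irrelevant) value at 1. *)
Definition is_riemann_zeta (zeta : C -> C) : Prop :=
  (forall s : C, 1 < Re s ->
     @is_series C_AbsRing C_NormedModule
       (fun n => nat_Cpow_opp (S n) s) (zeta s)) /\
  (forall s : C, s <> RtoC 1 -> analytic_at zeta s).

Definition zeta_half (zeta : C -> C) (t : R) : C := zeta (1 / 2, t).

(* The square of Hardy's function. *)
Definition hardyZ2 (zeta : C -> C) (t : R) : R := Cmod (zeta_half zeta t) ^ 2.

(* * Jacob's ladder *)

Definition mu (y : R) : R := 7 * y * ln y.

Definition ladder_eq (zeta : C -> C) (x T : R) : Prop :=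
  RInt (fun t => hardyZ2 zeta t * exp (- (2 * t) / x)) 0 (mu x)
  = RInt (hardyZ2 zeta) 0 T.

(* For all large [T], [phi T] is the only solution beyond some fixed [X0].
   Values of [phi] at small arguments are arbitrary.  Since [X0 > 1], the
   left-hand side of [ladder_eq] is bounded for [x] in any bounded part of
   [[X0, +oo)], so the choice of [X0] does not affect [phi T] for large [T]. *)
Definition is_jacob_ladder (zeta : C -> C) (phi : R -> R) : Prop :=
  exists X0 : R, 1 < X0 /\
    Rbar_locally p_infty (fun T =>
      X0 <= phi T /\ ladder_eq zeta (phi T) T /\
      forall x, X0 <= x -> ladder_eq zeta x T -> x = phi T).

Definition ladder1 (phi : R -> R) (T : R) : R := phi T / 2.

(* [g] and [h] are mutually inverse at all large arguments. *)
Definition inverse_at_infty (g h : R -> R) : Prop :=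
  Rbar_locally p_infty (fun x => h (g x) = x) /\
  Rbar_locally p_infty (fun y => g (h y) = y).

(* * Mean-value points and the functions alpha_r, beta_r *)

(* The product of [F r] for [m <= r < m + n]. *)
Definition prodR (F : nat -> R) (m n : nat) : R :=
  fold_right Rmult 1 (map F (seq m n)).

Definition TL (L : nat) : R := 2 * PI * INR L.

(* [x] lies strictly between [a = phi1^(-k) T] and [b = phi1^(-k) (T + U)] and
   satisfies the mean value formula for [f]; [inv k] stands for [phi1^(-k)]. *)
Definition mean_value_point (phi1 : R -> R) (inv : nat -> R -> R)
    (U : R) (L k : nat) (f : R -> R) (x : R) : Prop :=
  let T := TL L in
  let a := inv k T in
  let b := inv k (T + U) in
  a < x < b /\
  RInt f T (T + U)
  = f (Nat.iter k phi1 x)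
    * prodR (fun r => Derive phi1 (Nat.iter r phi1 x)) 0 k
    * (b - a).

Definition admissible (T U : R) (f : R -> R) : Prop :=
  continuous_on (fun t => T <= t <= T + U) f /\
  (forall t, T <= t <= T + U -> 0 <= f t) /\
  (exists t, T <= t <= T + U /\ f t <> 0).

(* [d L k f] is a choice of the point d(U, L, k; f). *)
Definition is_choice_d (phi1 : R -> R) (inv : nat -> R -> R) (U : R) (k0 : nat)
    (d : nat -> nat -> (R -> R) -> R) : Prop :=
  eventually (fun L => forall (k : nat) (f : R -> R),
    (1 <= k <= k0)%nat -> admissible (TL L) U f ->
    mean_value_point phi1 inv U L k f (d L k f)).

(* [e L k] is a choice of the point e(U, L, k), the case f = 1. *)
Definition is_choice_e (phi1 : R -> R) (inv : nat -> R -> R) (U : R) (k0 : nat)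
    (e : nat -> nat -> R) : Prop :=
  eventually (fun L => forall k : nat,
    (1 <= k <= k0)%nat ->
    mean_value_point phi1 inv U L k (fun _ => 1) (e L k)).

Definition alpha (phi1 : R -> R) (d : nat -> nat -> (R -> R) -> R)
    (L k : nat) (f : R -> R) (r : nat) : R :=
  Nat.iter (k - r) phi1 (d L k f).

Definition beta (phi1 : R -> R) (e : nat -> nat -> R) (L k r : nat) : R :=
  Nat.iter (k - r) phi1 (e L k).

Definition zeta_ratio_prod (zeta : C -> C) (phi1 : R -> R)
    (d : nat -> nat -> (R -> R) -> R) (e : nat -> nat -> R)
    (L k : nat) (f : R -> R) : R :=
  prodR (fun r =>
      Cmod (zeta_half zeta (alpha phi1 d L k f r)
            / zeta_half zeta (beta phi1 e L k r))%C ^ 2) 1 k.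

Definition f1 (t : R) : R := cos t ^ 3.
Definition f2 (t : R) : R := cos t.
Definition f3 (t : R) : R := cos t ^ 2.
Definition f4 (t : R) : R := sin t ^ 2.

Definition asymp_equiv (A B : nat -> R) : Prop :=
  is_lim_seq (fun L => A L / B L) 1.

(* Main.v *)
Require Import Defs.
From Stdlib Require Import Reals Lra Lia Arith.
From Coquelicot Require Import Coquelicot.
Open Scope R_scope.

(** Differentiating the ladder equation gives
    [phi1' (T) = Z^2 (T) / (2 Phi' (2 phi1 (T)))], where [Phi x] is the left-hand
    side of the equation.  In the quotient of the mean value formulas for [f] and
    for the constant [1] the factors [Z^2] form the zeta-quotients, so the product
    [f (alpha_0) P] tends to the mean value of [f] over [[0, U]] as soon as the
    factors [Phi'] cancel asymptotically; the theorem is then the identity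
    [int cos^3 = sin U - sin^3 U / 3] combined with
    [int (cos^2 - sin^2) = sin U cos U].

    [Phi'] varies slowly: [Phi' y / Phi' x -> 1] whenever
    [(y - x) ln x / x -> 0].  So the intervals [[phi1^(-j) T, phi1^(-j) (T + U)]]
    have to be short compared with [T / ln T].  Their lengths are compared
    recursively, through [Phi (2 phi1 (T)) = int_0^T Z^2], by means of
    [int_0^T Z^2 = O (T ln T)] and [int_a^b Z^2 >= (b - a) / 48] for
    [b - a >= 128 sqrt (b + 2)].  The asymptotic formula for the mean square is
    not needed.

    Both bounds are read off an approximation of
    [eta (s) = (1 - 2^(1-s)) zeta (s)] on the critical line by the partial sum of
    [sum (-1)^(n-1) n^(-s)] of length [4 M], [0 < Im s <= M]: [M] steps of Euler's
    transformation make the error [O (M^(-1/2))].  The identity between [eta] and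
    the alternating series for [Re s > 1] is continued along the horizontal line
    through [s], where both sides are real-analytic functions of [Re s]. *)

(** * Real-analytic functions on an interval *)

(** The points [d] and [e] are unrelated except that they lie in the same interval, so their factors
    [Phi'] can be compared only through slow variation, and this forces the length of the
    pulled-back intervals to be controlled. The control may be very crude: one application of
    [phi1^(-1)] costs an additive [O (sqrt T)] and a fixed power of [ln T]. For fixed [k] the length
    therefore stays below every power [T^(1/2 + eps)], far less than [T / ln T]. Hence no constant
    has to be sharp, and losing logarithms in the mean square is harmless.

    The passage to [eta] costs only constants, because [2^(1-s)] has modulus [sqrt 2] on the
    critical line: [1 - 2^(1-s)] is bounded there and bounded away from [0], so [Z^2] and [|eta|^2]
    are comparable. The alternating signs are what Euler's transformation exploits: each difference
    of [n^(-s)] gains a factor of order [|s| / n], which is at most [1/2] once [n] exceeds a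
    multiple of [|s|], so a number of steps proportional to the length suffices. The lower bound for
    the mean square needs no second moment: the mean of [Re eta] is already close to [1]. *)

Definition real_analytic_at (f : R -> R) (x0 : R) : Prop :=
  exists (a : nat -> R) (r : R), 0 < r /\
    forall u, Rabs u < r -> is_pseries a u (f (x0 + u)).

(** The inequality is strict because convergence is tested at the midpoint of [Rabs u] and [r];
    outside the disk of convergence the terms would not tend to [0]. *)
Lemma CV_radius_ge (a : nat -> R) (r : R) :
  (forall u, Rabs u < r -> ex_pseries a u) ->
  forall u, Rabs u < r -> Rbar_lt (Rabs u) (CV_radius a).
Proof.
  intros H u Hu.
  set (x := (Rabs u + r) / 2).
  assert (Hx : Rabs u < x < r) by (unfold x; lra).
  assert (Hx0 : Rabs x = x) by (apply Rabs_pos_eq; pose proof (Rabs_pos u); lra).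
  apply Rbar_lt_le_trans with (Finite x); [exact (proj1 Hx) |].
  apply Rbar_not_lt_le. intros C. rewrite <- Hx0 in C.
  apply (CV_disk_outside a x C).
  assert (E : ex_pseries a x) by (apply H; lra).
  apply (proj1 (ex_pseries_R a x)) in E. exact (ex_series_lim_0 _ E).
Qed.

Lemma real_analytic_at_plus (f g : R -> R) (x0 : R) :
  real_analytic_at f x0 -> real_analytic_at g x0 ->
  real_analytic_at (fun x => f x + g x) x0.
Proof.
  intros (a & r & Hr & Ha) (b & q & Hq & Hb).
  exists (PS_plus a b), (Rmin r q). split; [now apply Rmin_pos |].
  intros u Hu. apply (is_pseries_plus a b u (f (x0 + u)) (g (x0 + u))).
  - apply Ha. pose proof (Rmin_l r q). lra.
  - apply Hb. pose proof (Rmin_r r q). lra.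
Qed.

Lemma real_analytic_at_mult (f g : R -> R) (x0 : R) :
  real_analytic_at f x0 -> real_analytic_at g x0 ->
  real_analytic_at (fun x => f x * g x) x0.
Proof.
  intros (a & r & Hr & Ha) (b & q & Hq & Hb).
  exists (PS_mult a b), (Rmin r q). split; [now apply Rmin_pos |].
  intros u Hu. pose proof (Rmin_l r q). pose proof (Rmin_r r q).
  apply (is_pseries_mult a b u (f (x0 + u)) (g (x0 + u))).
  - apply Ha; lra.
  - apply Hb; lra.
  - apply CV_radius_ge with r; [| lra]. intros v Hv. eexists; now apply Ha.
  - apply CV_radius_ge with q; [| lra]. intros v Hv. eexists; now apply Hb.
Qed.

Lemma real_analytic_at_ext (f g : R -> R) (x0 : R) :
  (forall x, f x = g x) -> real_analytic_at f x0 -> real_analytic_at g x0.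
Proof.
  intros E (a & r & Hr & Ha). exists a, r. split; auto.
  intros u Hu. rewrite <- E. auto.
Qed.

Lemma real_analytic_at_const (c x0 : R) : real_analytic_at (fun _ => c) x0.
Proof.
  exists (fun n => match n with O => c | S _ => 0 end), 1. split; [lra |].
  intros u _. apply is_pseries_R.
  change (is_lim_seq (sum_n (fun n => match n with O => c | S _ => 0 end * u ^ n)) c).
  apply is_lim_seq_ext with (fun _ => c); [| apply is_lim_seq_const].
  intros n. induction n.
  - rewrite sum_O. simpl. ring.
  - rewrite sum_Sn, <- IHn. unfold plus; simpl. ring.
Qed.

Lemma real_analytic_at_opp (f : R -> R) (x0 : R) :
  real_analytic_at f x0 -> real_analytic_at (fun x => - f x) x0.
Proof.
  intros H. apply real_analytic_at_ext with (fun x => (-1) * f x).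
  - intros; ring.
  - apply real_analytic_at_mult; auto. apply real_analytic_at_const.
Qed.

Lemma real_analytic_at_minus (f g : R -> R) (x0 : R) :
  real_analytic_at f x0 -> real_analytic_at g x0 ->
  real_analytic_at (fun x => f x - g x) x0.
Proof.
  intros Hf Hg. apply real_analytic_at_plus; auto. now apply real_analytic_at_opp.
Qed.

(* Zeros on one side only are enough: the first nonzero coefficient would be
   the limit of [f (x0 + u) / u ^ n] as [u] decreases to [0]. *)
Lemma real_analytic_at_zero_right (f : R -> R) (x0 delta : R) :
  real_analytic_at f x0 -> 0 < delta ->
  (forall u, 0 < u < delta -> f (x0 + u) = 0) ->
  exists r, 0 < r /\ forall u, Rabs u < r -> f (x0 + u) = 0.
Proof.
  intros (a & r & Hr & Ha) Hd H0.
  assert (Hex : forall u, Rabs u < r -> ex_pseries a u)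
    by (intros u Hu; eexists; now apply Ha).
  assert (Hz : forall n, a n = 0).
  { intros n. induction n as [n IH] using (well_founded_induction lt_wf).
    set (b := PS_decr_n a n).
    assert (Hb0 : b O = a n) by (unfold b, PS_decr_n; f_equal; lia).
    assert (Hcv : Rbar_lt (Rabs 0) (CV_radius b)).
    { apply CV_radius_ge with r; [| rewrite Rabs_R0; lra].
      intros u Hu. apply ex_pseries_decr_n; [| now apply Hex].
      destruct (Req_dec u 0) as [-> | Hu0]; [now left |].
      right. exists (/ u). apply Rinv_l. exact Hu0. }
    pose proof (PSeries_continuity b 0 Hcv) as Hc.
    apply continuity_pt_filterlim in Hc. rewrite PSeries_0, Hb0 in Hc.
    destruct (Req_dec (a n) 0) as [|Hne]; auto. exfalso.
    assert (He : 0 < Rabs (a n)) by now apply Rabs_pos_lt.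
    destruct (proj1 (filterlim_locally _ _) Hc (mkposreal _ He)) as [e Hloc].
    set (u := Rmin (e / 2) (Rmin (r / 2) (delta / 2))).
    assert (Hu : 0 < u /\ u < e /\ u < r /\ u < delta).
    { destruct e as [e Hep]; simpl in *; unfold u.
      pose proof (Rmin_l (e/2) (Rmin (r / 2) (delta / 2))).
      pose proof (Rmin_r (e/2) (Rmin (r / 2) (delta / 2))).
      pose proof (Rmin_l (r / 2) (delta / 2)). pose proof (Rmin_r (r / 2) (delta / 2)).
      repeat split; try lra. repeat apply Rmin_pos; lra. }
    assert (Hau : Rabs u = u) by (apply Rabs_pos_eq; lra).
    assert (Hb : Rabs (PSeries b u - a n) < Rabs (a n)).
    { apply (Hloc u). change (Rabs (u - 0) < e). rewrite Rminus_0_r, Hau. lra. }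
    (* The lower coefficients vanish by induction, so [u ^ n] splits off. As [f] vanishes at this
       [u], so does [PSeries b], whereas continuity keeps it closer to [a n] than [Rabs (a n)]. *)
    assert (Hs : PSeries a u = u ^ n * PSeries b u) by (apply PSeries_decr_n_aux; exact IH).
    assert (HP : PSeries a u = 0).
    { rewrite <- (H0 u) by lra. apply is_pseries_unique, Ha. lra. }
    rewrite HP in Hs. symmetry in Hs. apply Rmult_integral in Hs.
    destruct Hs as [Hs | Hs].
    - apply pow_nonzero in Hs; lra.
    - rewrite Hs in Hb. replace (0 - a n) with (- a n) in Hb by ring.
      rewrite Rabs_Ropp in Hb. lra. }
  exists r. split; auto. intros u Hu.
  rewrite <- (is_pseries_unique _ _ _ (Ha u Hu)).
  rewrite (PSeries_ext a (fun _ => 0)) by exact Hz. apply PSeries_const_0.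
Qed.

(** Connectedness argument: [m] is the supremum of the lengths [z] for which [f] vanishes on
    [(hi - z, hi]]. Zeros to the right of [hi - m] force zeros on both sides of it, which
    contradicts maximality unless [hi - m = lo]. *)
Lemma real_analytic_identity (f : R -> R) (lo mid hi : R) :
  lo <= mid < hi ->
  (forall x, lo <= x <= hi -> real_analytic_at f x) ->
  (forall x, mid < x <= hi -> f x = 0) ->
  forall x, lo <= x <= hi -> f x = 0.
Proof.
  intros Hm Han H0.
  set (E := fun z => 0 <= z <= hi - lo /\ forall x, hi - z < x <= hi -> f x = 0).
  destruct (completeness E) as [m [Hub Hlub]].
  - exists (hi - lo). intros z [Hz _]. lra.
  - exists (hi - mid). split; [lra |]. intros x Hx. apply H0; lra.
  - assert (Hmm : hi - mid <= m).
    { apply Hub. split; [lra |]. intros x Hx; apply H0; lra. }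
    assert (Hml : m <= hi - lo) by (apply Hlub; intros z [Hz _]; lra).
    assert (Hz : forall x, hi - m < x <= hi -> f x = 0).
    { intros x Hx. destruct (Req_dec (f x) 0) as [|Hne]; auto. exfalso.
      assert (m <= hi - x); [| lra].
      apply Hlub. intros z [Hz1 Hz2].
      destruct (Rle_dec z (hi - x)) as [|Hn]; auto. exfalso. apply Hne, Hz2. lra. }
    destruct (real_analytic_at_zero_right f (hi - m) m) as (r & Hr & Hr0).
    + apply Han. lra.
    + lra.
    + intros u Hu. apply Hz. lra.
    + assert (Hme : m = hi - lo).
      { destruct (Req_dec m (hi - lo)) as [|Hne]; auto. exfalso.
        set (s := Rmin (r / 2) (hi - lo - m)).
        assert (Hs : 0 < s) by (apply Rmin_pos; lra).
        pose proof (Rmin_l (r / 2) (hi - lo - m)). pose proof (Rmin_r (r / 2) (hi - lo - m)).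
        fold s in H, H1.
        assert (m + s <= m); [| lra]. apply Hub. split; [lra |].
        intros x Hx. destruct (Rlt_dec (hi - m) x) as [Hc | Hc]; [apply Hz; lra |].
        replace x with (hi - m + (x - (hi - m))) by ring. apply Hr0.
        rewrite Rabs_left1; lra. }
      (* The half-open intervals in [E] never contain [lo]; there the two-sided neighbourhood of
         zeros is used. *)
      intros x Hx. destruct (Req_dec x lo) as [-> | Hne].
      * replace lo with (hi - m + 0) by lra. apply Hr0. rewrite Rabs_R0; lra.
      * apply Hz. lra.
Qed.

(* A remainder that decays geometrically, uniformly in the number of terms, is
   what survives summation over a further parameter. *)
Lemma real_analytic_at_of_remainder (f : R -> R) (x0 rho C : R) (a : nat -> R) :
  0 < rho ->
  (forall u M, Rabs u < rho ->
     Rabs (f (x0 + u) - sum_n (fun m => a m * u ^ m) M) <= C * (Rabs u / rho) ^ M) ->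
  real_analytic_at f x0.
Proof.
  intros Hrho H. exists a, rho. split; auto. intros u Hu.
  apply is_pseries_R.
  assert (L : is_lim_seq (fun M => C * (Rabs u / rho) ^ M) 0).
  { replace (Finite 0) with (Rbar_mult C 0) by (simpl; f_equal; ring).
    apply is_lim_seq_scal_l. apply is_lim_seq_geom.
    rewrite Rabs_pos_eq.
    - apply Rmult_lt_reg_r with rho; auto. unfold Rdiv.
      rewrite Rmult_assoc, Rinv_l; lra.
    - apply Rmult_le_pos; [apply Rabs_pos |]. apply Rlt_le, Rinv_0_lt_compat; auto. }
  assert (L2 : is_lim_seq (fun M => f (x0 + u) - sum_n (fun m => a m * u ^ m) M) 0).
  { apply is_lim_seq_abs_0. apply is_lim_seq_le_le with (fun _ => 0) (fun M => C * (Rabs u / rho) ^ M); auto.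
    - intros n; split; [apply Rabs_pos | now apply H].
    - apply is_lim_seq_const. }
  change (is_lim_seq (sum_n (fun m => a m * u ^ m)) (f (x0 + u))).
  apply (is_lim_seq_ext (fun M => f (x0 + u) - (f (x0 + u) - sum_n (fun m => a m * u ^ m) M))).
  { intros n. ring. }
  replace (Finite (f (x0 + u))) with (Finite (f (x0 + u) - 0)) by (f_equal; ring).
  apply is_lim_seq_minus'; auto. apply is_lim_seq_const.
Qed.

(** * Series of real-analytic functions *)

Ltac real_eq := match goal with |- @eq _ ?x ?y => change (@eq R x y) end.

Lemma sum_f_R0_nonneg (b : nat -> R) (n : nat) :
  (forall m, 0 <= b m) -> 0 <= sum_f_R0 b n.
Proof.
  intros H. induction n; simpl; [apply H |]. specialize (H (S n)). lra.
Qed.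

Lemma ex_series_Rabs_le (a b : nat -> R) :
  (forall n, Rabs (a n) <= b n) -> ex_series b -> ex_series (fun n => Rabs (a n)).
Proof.
  intros H Hb.
  apply (@ex_series_le R_AbsRing R_CompleteNormedModule (fun n => Rabs (a n)) b); auto.
  intros n. change (Rabs (Rabs (a n)) <= b n). now rewrite Rabs_Rabsolu.
Qed.

(** Every index of the tail exceeds [M], so [q ^ M] can be taken out and the rest is at most the
    full sum of [b]. In the application [q] is [Rabs u / rho], and [b] majorises the coefficients
    weighted by [rho ^ m]. *)
Lemma series_tail_bound (a b : nat -> R) (l s q : R) (M : nat) :
  0 <= q <= 1 -> (forall m, 0 <= b m) ->
  is_series a l -> is_series b s -> (forall m, Rabs (a m) <= b m * q ^ m) ->
  Rabs (l - sum_n a M) <= s * q ^ M.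
Proof.
  intros Hq Hb0 Ha Hb Hab.
  assert (Hqm : 0 <= q ^ M) by (intros; apply pow_le; lra).
  assert (Hexa : ex_series a) by (eexists; eauto).
  assert (Hexb : ex_series b) by (eexists; eauto).
  rewrite <- (is_series_unique _ _ Ha), <- (is_series_unique _ _ Hb).
  assert (Hexb' : ex_series (fun k => b (S M + k)%nat))
    by (apply (ex_series_incr_n b (S M)); auto).
  assert (Hle : forall k, Rabs (a (S M + k)%nat) <= q ^ M * b (S M + k)%nat).
  { intros k. eapply Rle_trans; [apply Hab |]. rewrite Rmult_comm.
    apply Rmult_le_compat_r; auto.
    replace (S M + k)%nat with (M + S k)%nat by lia. rewrite pow_add.
    rewrite <- (Rmult_1_r (q ^ M)) at 2. apply Rmult_le_compat_l; auto.
    rewrite <- (pow1 (S k)). apply pow_incr; lra. }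
  assert (Hexq : ex_series (fun k => q ^ M * b (S M + k)%nat))
    by (apply (ex_series_scal_l (q ^ M) (fun k => b (S M + k)%nat)); auto).
  assert (Hexr : ex_series (fun k => Rabs (a (S M + k)%nat))).
  { now apply ex_series_Rabs_le with (2 := Hexq). }
  rewrite sum_n_Reals, (Series_incr_n a (S M)), (Series_incr_n b (S M)) by (auto; lia).
  change (pred (S M)) with M.
  replace (sum_f_R0 a M + Series (fun k => a (S M + k)%nat) - sum_f_R0 a M)
    with (Series (fun k => a (S M + k)%nat)) by ring.
  eapply Rle_trans; [apply Series_Rabs; exact Hexr |].
  eapply Rle_trans.
  { apply (Series_le _ (fun k => q ^ M * b (S M + k)%nat)); auto.
    intros k; split; [apply Rabs_pos | apply Hle]. }
  rewrite Series_scal_l, Rmult_comm. apply Rmult_le_compat_r; auto.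
  pose proof (sum_f_R0_nonneg b M Hb0). lra.
Qed.

Lemma Series_sum_n (a : nat -> nat -> R) (M : nat) :
  (forall m, ex_series (fun n => a n m)) ->
  ex_series (fun n => sum_n (a n) M) /\
  Series (fun n => sum_n (a n) M) = sum_n (fun m => Series (fun n => a n m)) M.
Proof.
  intros H. induction M as [|M [IH1 IH2]].
  - split.
    + apply ex_series_ext with (fun n => a n O); auto. intros n; now rewrite sum_O.
    + rewrite sum_O. apply Series_ext. intros n; now rewrite sum_O.
  - split.
    + apply ex_series_ext with (fun n => plus (sum_n (a n) M) (a n (S M))).
      { intros n. now rewrite sum_Sn. }
      now apply (ex_series_plus (fun n => sum_n (a n) M) (fun n => a n (S M))).
    + rewrite sum_Sn, <- IH2.
      rewrite (Series_ext _ (fun n => sum_n (a n) M + a n (S M))) by (intros n; now rewrite sum_Sn).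
      now rewrite Series_plus.
Qed.

(** A Weierstrass theorem without rearranging a double series: the sum over [n] is exchanged only
    with finite Taylor polynomials, and the Taylor remainders, at most [q ^ M * B n], are summed
    over [n]. *)
Lemma real_analytic_at_Series (g : nat -> R -> R) (x0 rho : R)
    (a b : nat -> nat -> R) (B : nat -> R) :
  0 < rho ->
  (forall n u, Rabs u < rho -> is_series (fun m => a n m * u ^ m) (g n (x0 + u))) ->
  (forall n m, Rabs (a n m) * rho ^ m <= b n m) ->
  (forall n, exists s, is_series (b n) s /\ s <= B n) ->
  ex_series B ->
  real_analytic_at (fun x => Series (fun n => g n x)) x0.
Proof.
  intros Hrho Hg Hab Hb HB.
  assert (Hrm : forall m, 0 < rho ^ m) by (intros; now apply pow_lt).
  assert (Hb0 : forall n m, 0 <= b n m).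
  { intros n m. eapply Rle_trans; [| apply Hab].
    apply Rmult_le_pos; [apply Rabs_pos | apply Rlt_le, Hrm]. }
  (* A single term is at most the whole sum; this makes every column [a n m], with [m] fixed,
     summable over [n]. *)
  assert (HbB : forall n m, b n m <= B n).
  { intros n m. destruct (Hb n) as (s & Hs & Hle). eapply Rle_trans; [| apply Hle].
    assert (Hex : ex_series (b n)) by (eexists; eauto).
    rewrite <- (is_series_unique _ _ Hs), (Series_incr_n (b n) (S m)) by (auto; lia).
    change (pred (S m)) with m.
    assert (0 <= Series (fun k => b n (S m + k)%nat)).
    { rewrite <- (Rmult_0_l (Series (fun k => b n (S m + k)%nat))).
      rewrite <- Series_scal_l. apply Series_le.
      - intros k. specialize (Hb0 n (S m + k)%nat). lra.
      - now apply (ex_series_incr_n (b n) (S m)). }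
    assert (b n m <= sum_f_R0 (b n) m).
    { destruct m; simpl; [lra |]. pose proof (sum_f_R0_nonneg (b n) m (Hb0 n)). lra. }
    lra. }
  assert (Hcol : forall m, ex_series (fun n => a n m)).
  { intros m. apply ex_series_Rabs, (ex_series_Rabs_le _ (fun n => / rho ^ m * B n)).
    - intros n.
      apply Rmult_le_reg_l with (rho ^ m); auto.
      rewrite <- Rmult_assoc, Rinv_r, Rmult_1_l by (apply Rgt_not_eq, Hrm).
      rewrite Rmult_comm. eapply Rle_trans; [apply Hab | apply HbB].
    - now apply (ex_series_scal_l (/ rho ^ m) B). }
  apply real_analytic_at_of_remainder with rho (Series B) (fun m => Series (fun n => a n m)); auto.
  intros u M Hu.
  set (q := Rabs u / rho).
  assert (Hq : 0 <= q <= 1).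
  { split.
    - apply Rmult_le_pos; [apply Rabs_pos | apply Rlt_le, Rinv_0_lt_compat, Hrho].
    - apply Rmult_le_reg_r with rho; auto. unfold q, Rdiv.
      rewrite Rmult_assoc, Rinv_l; lra. }
  assert (Htail : forall n,
    Rabs (g n (x0 + u) - sum_n (fun m => a n m * u ^ m) M) <= q ^ M * B n).
  { intros n. destruct (Hb n) as (s & Hs & Hle).
    eapply Rle_trans.
    - apply (series_tail_bound _ (b n) _ s q M Hq (Hb0 n) (Hg n u Hu) Hs).
      intros m. rewrite Rabs_mult, <- RPow_abs.
      replace (Rabs (a n m) * Rabs u ^ m) with (Rabs (a n m) * rho ^ m * q ^ m).
      + apply Rmult_le_compat_r; [apply pow_le; lra | apply Hab].
      + rewrite Rmult_assoc, <- Rpow_mult_distr. do 2 f_equal. unfold q. field; lra.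
    - rewrite Rmult_comm. apply Rmult_le_compat_l; auto. apply pow_le; lra. }
  assert (Hexu : forall m, ex_series (fun n => a n m * u ^ m))
    by (intros m; apply (ex_series_scal_r (u ^ m) (fun n => a n m)); auto).
  destruct (Series_sum_n (fun n m => a n m * u ^ m) M Hexu) as [E1 E2].
  assert (Hexq : ex_series (fun n => q ^ M * B n)) by now apply (ex_series_scal_l (q ^ M) B).
  assert (Hexr : ex_series (fun n => Rabs (g n (x0 + u) - sum_n (fun m => a n m * u ^ m) M))).
  { now apply ex_series_Rabs_le with (2 := Hexq). }
  assert (Hexd := ex_series_Rabs _ Hexr).
  replace (sum_n (fun m => Series (fun n => a n m) * u ^ m) M)
    with (Series (fun n => sum_n (fun m => a n m * u ^ m) M))
    by (rewrite E2; apply sum_n_ext; intros m; now rewrite Series_scal_r).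
  rewrite (Series_ext (fun n => g n (x0 + u))
    (fun n => (g n (x0 + u) - sum_n (fun m => a n m * u ^ m) M)
              + sum_n (fun m => a n m * u ^ m) M)) by (intros; ring).
  rewrite Series_plus by auto.
  match goal with |- Rabs (?x + ?y - ?y) <= _ => replace (x + y - y) with x by ring end.
  eapply Rle_trans; [apply Series_Rabs; exact Hexr |].
  rewrite Rmult_comm, <- Series_scal_l.
  apply Series_le; auto. intros n; split; [apply Rabs_pos | apply Htail].
Qed.

Lemma is_series_exp (y : R) : is_series (fun m => y ^ m / INR (fact m)) (exp y).
Proof.
  apply is_series_ext with (fun m => / INR (fact m) * y ^ m).
  - intros m. apply Rmult_comm.
  - apply (proj1 (is_pseries_R _ y (exp y))). apply is_exp_Reals.
Qed.

Lemma is_series_exp_shift (y c : R) :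
  is_series (fun m => match m with O => 0 | S k => c * (y ^ k / INR (fact k)) end) (c * exp y).
Proof.
  apply is_series_decr_1.
  match goal with |- is_series _ ?x => replace x with (c * exp y) end.
  - apply (is_series_scal_l c (fun k => y ^ k / INR (fact k))). apply is_series_exp.
  - unfold plus, opp; simpl; ring.
Qed.

Lemma is_series_expmul (c x0 l u : R) :
  is_series (fun m => (c * exp (- x0 * l) * (- l) ^ m / INR (fact m)) * u ^ m)
    (c * exp (- (x0 + u) * l)).
Proof.
  replace (- (x0 + u) * l) with (- x0 * l + - l * u) by ring. rewrite exp_plus, <- Rmult_assoc.
  apply is_series_ext with (fun m => (c * exp (- x0 * l)) * ((- l * u) ^ m / INR (fact m))).
  - intros m. rewrite Rpow_mult_distr. real_eq. unfold Rdiv. ring.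
  - apply (is_series_scal_l (c * exp (- x0 * l)) (fun m => (- l * u) ^ m / INR (fact m))).
    apply is_series_exp.
Qed.

Lemma real_analytic_at_exp (c l x0 : R) :
  real_analytic_at (fun x => c * exp (- x * l)) x0.
Proof.
  exists (fun m => c * exp (- x0 * l) * (- l) ^ m / INR (fact m)), 1. split; [lra |].
  intros u _. apply is_pseries_R. apply is_series_expmul.
Qed.

Lemma is_series_Rscal (c : R) (a : nat -> R) (l : R) :
  is_series a l -> is_series (fun n => c * a n) (c * l).
Proof. exact (is_series_scal_l c a l). Qed.

Lemma is_series_Rplus (a b : nat -> R) (la lb : R) :
  is_series a la -> is_series b lb -> is_series (fun n => a n + b n) (la + lb).
Proof. exact (is_series_plus a b la lb). Qed.

Lemma is_series_telescope (f : nat -> R) :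
  is_lim_seq f 0 -> is_series (fun n => f n - f (S n)) (f O).
Proof.
  intros H. change (is_lim_seq (sum_n (fun n => f n - f (S n))) (f O)).
  apply is_lim_seq_ext with (fun n => f O - f (S n)).
  - intros n. induction n.
    + rewrite sum_O. reflexivity.
    + rewrite sum_Sn, <- IHn. unfold plus; simpl. ring.
  - replace (Finite (f O)) with (Finite (f O - 0)) by (f_equal; ring).
    apply is_lim_seq_minus'; [apply is_lim_seq_const |].
    now apply (is_lim_seq_incr_1 f).
Qed.

(** * The alternating Dirichlet series as a real-analytic function *)

Definition lnS (n : nat) : R := ln (INR (S n)).

Lemma lnS_0 : lnS 0 = 0.
Proof. unfold lnS. simpl. apply ln_1. Qed.

Lemma INR_S_pos (n : nat) : 0 < INR (S n).
Proof. apply lt_0_INR; lia. Qed.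

Lemma lnS_step (n : nat) : 0 <= lnS (S n) - lnS n <= 1.
Proof.
  pose proof (INR_S_pos n). unfold lnS.
  assert (Hs : INR (S (S n)) = INR (S n) + 1) by apply S_INR.
  split.
  - assert (ln (INR (S n)) <= ln (INR (S (S n)))) by (apply ln_le; lra). lra.
  - rewrite <- ln_div by lra.
    replace (INR (S (S n)) / INR (S n)) with (1 + / INR (S n)) by (rewrite Hs; field; lra).
    assert (1 <= INR (S n)) by (apply (le_INR 1); lia).
    assert (0 < / INR (S n) <= 1).
    { split; [now apply Rinv_0_lt_compat |]. rewrite <- Rinv_1. apply Rinv_le_contravar; lra. }
    apply Rle_trans with (/ INR (S n)); [| lra].
    rewrite <- (ln_exp (/ INR (S n))) at 2. apply ln_le; [lra |]. apply exp_ineq1_le.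
Qed.

Lemma lnS_nonneg (n : nat) : 0 <= lnS n.
Proof.
  induction n; [rewrite lnS_0; lra |]. pose proof (lnS_step n). lra.
Qed.

Lemma is_lim_exp_lnS (x : R) : 0 < x -> is_lim_seq (fun n => exp (- x * lnS n)) 0.
Proof.
  intros Hx.
  apply (is_lim_comp_seq exp (fun n => - x * lnS n) m_infty 0).
  - exact is_lim_exp_m.
  - exists O. intros n _. discriminate.
  - replace m_infty with (Rbar_mult (- x) p_infty).
    + apply is_lim_seq_scal_l. unfold lnS.
      apply (is_lim_comp_seq ln (fun n => INR (S n)) p_infty p_infty).
      * exact is_lim_ln_p.
      * exists O. intros n _. discriminate.
      * apply (is_lim_seq_incr_1 INR). apply is_lim_seq_INR.
    + simpl. destruct (Rle_dec 0 (- x)) as [H|H]; [exfalso; lra |]. reflexivity.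
Qed.

Lemma exp_mono (x y : R) : x <= y -> exp x <= exp y.
Proof.
  intros [H | ->]; [apply Rlt_le, exp_increasing, H | lra].
Qed.

Lemma exp_diff_le (x v d : R) : 0 <= x -> 0 <= d ->
  0 <= exp (- x * v) - exp (- x * (v + d)) <= exp (- x * v) * (x * d).
Proof.
  intros Hx Hd. replace (- x * (v + d)) with (- x * v + - (x * d)) by ring.
  rewrite exp_plus. pose proof (exp_pos (- x * v)).
  pose proof (exp_ineq1_le (- (x * d))).
  assert (exp (- (x * d)) <= 1).
  { rewrite <- exp_0. apply exp_mono. assert (0 <= x * d) by now apply Rmult_le_pos. lra. }
  split; nra.
Qed.

(** Converts a majorant that contains the increment [d] into a difference of exponentials, which
    telescopes when [v] runs through the logarithms. *)
Lemma exp_diff_ge (x v d : R) :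
  exp (- x * (v + d)) * (x * d) <= exp (- x * v) - exp (- x * (v + d)).
Proof.
  replace (- x * v) with (- x * (v + d) + x * d) by ring.
  rewrite exp_plus. pose proof (exp_pos (- x * (v + d))).
  pose proof (exp_ineq1_le (x * d)). nra.
Qed.

Lemma pow_diff_le (v d : R) (m : nat) : 0 <= v -> 0 <= d ->
  0 <= (v + d) ^ S m - v ^ S m <= INR (S m) * (d * (v + d) ^ m).
Proof.
  intros Hv Hd. induction m as [|m IH].
  - simpl. lra.
  - assert (Hp : v ^ S m <= (v + d) ^ S m) by (apply pow_incr; lra).
    assert (Hq : 0 <= v ^ S m) by now apply pow_le.
    rewrite (S_INR (S m)).
    replace ((v + d) ^ S (S m) - v ^ S (S m))
      with (v * ((v + d) ^ S m - v ^ S m) + d * (v + d) ^ S m) by (simpl; ring).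
    assert (v * ((v + d) ^ S m - v ^ S m) <= (v + d) * (INR (S m) * (d * (v + d) ^ m))).
    { apply Rmult_le_compat; lra. }
    assert (0 <= v * ((v + d) ^ S m - v ^ S m)) by (apply Rmult_le_pos; lra).
    assert (0 <= d * (v + d) ^ S m) by (apply Rmult_le_pos; [lra | apply pow_le; lra]).
    split; [lra |].
    replace ((INR (S m) + 1) * (d * (v + d) ^ S m))
      with ((v + d) * (INR (S m) * (d * (v + d) ^ m)) + d * (v + d) ^ S m) by (simpl; ring).
    lra.
Qed.

(* With [q v = cos (t v)] or [- sin (t v)], [lterm q x n] is the real or
   imaginary part of [(n + 1) ^ - (x + i t)]. *)
Definition lterm (q : R -> R) (x : R) (n : nat) : R := q (lnS n) * exp (- x * lnS n).

Definition lpair (q : R -> R) (x : R) (n : nat) : R := lterm q x n - lterm q x (S n).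

(* The alternating series of [lterm q x], with the convergence improved by one
   averaging step so that it is absolute for [x > 0]. *)
Definition eta (q : R -> R) (x : R) : R :=
  1 / 2 * lterm q x 0 + 1 / 2 * Series (fun n => (-1) ^ n * lpair q x n).

(** All that is used of [cos (t v)] and [- sin (t v)], so that real and imaginary parts are treated
    at once; [tau] stands for [Rabs t]. *)
Definition bounded_lipschitz (q : R -> R) (tau : R) : Prop :=
  (forall v, Rabs (q v) <= 1) /\ (forall v w, Rabs (q v - q w) <= tau * Rabs (v - w)).

Lemma bounded_lipschitz_nonneg (q : R -> R) (tau : R) : bounded_lipschitz q tau -> 0 <= tau.
Proof.
  intros [_ H]. specialize (H 1 0). rewrite Rminus_0_r, Rabs_R1, Rmult_1_r in H.
  eapply Rle_trans; [apply Rabs_pos | apply H].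
Qed.

Lemma bounded_lipschitz_damped_increment (q : R -> R) (tau x v d : R) :
  bounded_lipschitz q tau -> 0 <= x -> 0 <= d ->
  Rabs (q v * exp (- x * v) - q (v + d) * exp (- x * (v + d)))
  <= d * exp (- x * v) * (x + tau).
Proof.
  intros Hq Hx Hd. pose proof (bounded_lipschitz_nonneg _ _ Hq) as Ht. destruct Hq as [Hq1 Hq2].
  replace (q v * exp (- x * v) - q (v + d) * exp (- x * (v + d)))
    with (q (v + d) * (exp (- x * v) - exp (- x * (v + d))) + (q v - q (v + d)) * exp (- x * v)) by ring.
  pose proof (exp_diff_le x v d Hx Hd) as He. pose proof (exp_pos (- x * v)) as Hp.
  eapply Rle_trans; [apply Rabs_triang |]. rewrite !Rabs_mult.
  rewrite (Rabs_pos_eq (exp (- x * v) - _)) by lra.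
  rewrite (Rabs_pos_eq (exp (- x * v))) by lra.
  specialize (Hq1 (v + d)). specialize (Hq2 v (v + d)).
  replace (v - (v + d)) with (- d) in Hq2 by ring. rewrite Rabs_Ropp, (Rabs_pos_eq d) in Hq2 by auto.
  pose proof (Rabs_pos (q (v + d))).
  apply Rle_trans with (1 * (exp (- x * v) * (x * d)) + (tau * d) * exp (- x * v)).
  - apply Rplus_le_compat.
    + apply Rmult_le_compat; lra.
    + apply Rmult_le_compat_r; lra.
  - right; ring.
Qed.

(** The majorant telescopes over [n]. The factor [exp x] pays for moving the exponential from
    [lnS n] to [lnS (S n)], a step of length at most [1]. *)
Lemma lpair_bound (q : R -> R) (tau x : R) (n : nat) :
  bounded_lipschitz q tau -> 0 < x ->
  Rabs (lpair q x n)
  <= (x + tau) * exp x / x * (exp (- x * lnS n) - exp (- x * lnS (S n))).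
Proof.
  intros Hq Hx. pose proof (bounded_lipschitz_nonneg _ _ Hq) as Ht. unfold lpair, lterm.
  pose proof (lnS_step n) as Hd. set (d := lnS (S n) - lnS n) in *.
  replace (lnS (S n)) with (lnS n + d) by (unfold d; ring). set (v := lnS n) in *.
  eapply Rle_trans; [apply (bounded_lipschitz_damped_increment q tau x v d Hq); lra |].
  pose proof (exp_diff_ge x v d) as He.
  apply Rle_trans with ((x + tau) * exp x / x * (exp (- x * (v + d)) * (x * d))).
  - replace (exp (- x * v)) with (exp (- x * (v + d)) * exp (x * d))
      by (rewrite <- exp_plus; f_equal; ring).
    replace ((x + tau) * exp x / x * (exp (- x * (v + d)) * (x * d)))
      with ((d * exp (- x * (v + d)) * (x + tau)) * exp x) by (field; lra).
    replace (d * (exp (- x * (v + d)) * exp (x * d)) * (x + tau))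
      with ((d * exp (- x * (v + d)) * (x + tau)) * exp (x * d)) by ring.
    apply Rmult_le_compat_l.
    + pose proof (exp_pos (- x * (v + d))). repeat apply Rmult_le_pos; lra.
    + apply exp_mono. nra.
  - apply Rmult_le_compat_l; auto. pose proof (exp_pos x).
    apply Rmult_le_pos; [| apply Rlt_le, Rinv_0_lt_compat; lra].
    apply Rmult_le_pos; lra.
Qed.

Lemma is_series_exp_telescope (x K : R) : 0 < x ->
  is_series (fun n => K * (exp (- x * lnS n) - exp (- x * lnS (S n)))) K.
Proof.
  intros Hx.
  assert (H : is_series (fun n => K * (exp (- x * lnS n) - exp (- x * lnS (S n))))
     (K * exp (- x * lnS 0))).
  { apply (is_series_scal_l K (fun n => exp (- x * lnS n) - exp (- x * lnS (S n)))).
    apply (is_series_telescope (fun n => exp (- x * lnS n))). now apply is_lim_exp_lnS. }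
  rewrite lnS_0, Rmult_0_r, exp_0, Rmult_1_r in H. exact H.
Qed.

Lemma Rabs_pow_m1 (n : nat) (y : R) : Rabs ((-1) ^ n * y) = Rabs y.
Proof. rewrite Rabs_mult, pow_1_abs. ring. Qed.

Lemma ex_series_Rabs_lpair (q : R -> R) (tau x : R) :
  bounded_lipschitz q tau -> 0 < x -> ex_series (fun n => Rabs (lpair q x n)).
Proof.
  intros Hq Hx. eapply ex_series_Rabs_le.
  - intros n. apply (lpair_bound q tau x n Hq Hx).
  - eexists. now apply is_series_exp_telescope.
Qed.

Lemma real_analytic_at_eta (q : R -> R) (tau x0 : R) :
  bounded_lipschitz q tau -> 0 < x0 -> real_analytic_at (eta q) x0.
Proof.
  intros Hq Hx. pose proof (bounded_lipschitz_nonneg _ _ Hq) as Ht. pose proof Hq as [Hq1 Hq2].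
  unfold eta. apply real_analytic_at_plus.
  { apply real_analytic_at_ext with (fun x => 1 / 2 * q (lnS 0) * exp (- x * lnS 0)).
    - intros x; unfold lterm; ring.
    - apply real_analytic_at_exp. }
  apply real_analytic_at_mult; [apply real_analytic_at_const |].
  (* Summing the Taylor majorants produces [exp (rho * lnS (S n))]. With this radius it spoils only
     half of the decay [exp (- x0 * lnS n)], and [exp (- rho * lnS n)] remains. *)
  set (rho := x0 / 2). assert (Hrho : 0 < rho) by (unfold rho; lra).
  set (w := fun n m => q (lnS n) * exp (- x0 * lnS n) * (- lnS n) ^ m / INR (fact m)).
  (* The two summands are the two parts of a product rule: the first comes from the increment of
     [q (l) * exp (- x0 * l)], the second from that of [(- l) ^ m]. The latter lowers the exponent
     by one, hence the shifted index. *)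
  set (b := fun n m => (lnS (S n) - lnS n) * exp (- x0 * lnS n) *
     ((x0 + tau) * ((rho * lnS (S n)) ^ m / INR (fact m)) +
      match m with O => 0 | S k => rho * ((rho * lnS (S n)) ^ k / INR (fact k)) end)).
  (* The factor [exp (2 * rho)] absorbs [exp (2 * rho * d)] for the increment [d <= 1], and [/ rho]
     is what [exp_diff_ge] costs. *)
  set (K := (x0 + tau + rho) * exp (2 * rho) / rho).
  apply (real_analytic_at_Series (fun n x => (-1) ^ n * lpair q x n) x0 rho
    (fun n m => (-1) ^ n * (w n m - w (S n) m)) b
    (fun n => K * (exp (- rho * lnS n) - exp (- rho * lnS (S n))))); auto.
  - intros n u _.
    apply is_series_ext with (fun m => (-1) ^ n * (w n m * u ^ m - w (S n) m * u ^ m)).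
    { intros m. real_eq. ring. }
    apply (is_series_scal_l ((-1) ^ n) (fun m => w n m * u ^ m - w (S n) m * u ^ m)).
    apply (is_series_minus (fun m => w n m * u ^ m) (fun m => w (S n) m * u ^ m)
       (lterm q (x0 + u) n) (lterm q (x0 + u) (S n))); apply is_series_expmul.
  - intros n m. rewrite Rabs_pow_m1. unfold w, b.
    pose proof (lnS_step n) as Hd. pose proof (lnS_nonneg n) as Hv.
    set (d := lnS (S n) - lnS n) in *.
    replace (lnS (S n)) with (lnS n + d) by (unfold d; ring). set (v := lnS n) in *.
    assert (Hf : 0 < INR (fact m)) by apply INR_fact_lt_0.
    assert (Hrm : 0 <= rho ^ m) by (apply pow_le; lra).
    pose proof (exp_pos (- x0 * v)) as He.
    assert (Hvm : 0 <= (v + d) ^ m) by (apply pow_le; lra).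
    set (A0 := q v * exp (- x0 * v)). set (A1 := q (v + d) * exp (- x0 * (v + d))).
    assert (HA : Rabs (A0 - A1) <= d * exp (- x0 * v) * (x0 + tau))
      by (apply bounded_lipschitz_damped_increment; [split; auto | lra | lra]).
    assert (HA0 : Rabs A0 <= exp (- x0 * v)).
    { unfold A0. rewrite Rabs_mult, (Rabs_pos_eq (exp _)) by lra.
      specialize (Hq1 v). nra. }
    assert (Hin : Rabs (A0 * (- v) ^ m - A1 * (- (v + d)) ^ m)
       <= d * exp (- x0 * v) * (x0 + tau) * (v + d) ^ m
          + exp (- x0 * v) * ((v + d) ^ m - v ^ m)).
    { replace (A0 * (- v) ^ m - A1 * (- (v + d)) ^ m)
        with ((-1) ^ m * ((A0 - A1) * (v + d) ^ m + - (A0 * ((v + d) ^ m - v ^ m)))).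
      2:{ replace (- v) with ((-1) * v) by ring. replace (- (v + d)) with ((-1) * (v + d)) by ring.
          rewrite !Rpow_mult_distr. ring. }
      rewrite Rabs_pow_m1. eapply Rle_trans; [apply Rabs_triang |].
      rewrite Rabs_Ropp, !Rabs_mult.
      assert (v ^ m <= (v + d) ^ m) by (apply pow_incr; lra).
      rewrite (Rabs_pos_eq ((v + d) ^ m)) by auto.
      rewrite (Rabs_pos_eq ((v + d) ^ m - v ^ m)) by lra.
      apply Rplus_le_compat; apply Rmult_le_compat_r; lra. }
    replace (A0 * (- v) ^ m / INR (fact m) - A1 * (- (v + d)) ^ m / INR (fact m))
      with ((A0 * (- v) ^ m - A1 * (- (v + d)) ^ m) * / INR (fact m)) by (field; lra).
    rewrite Rabs_mult, (Rabs_pos_eq (/ INR (fact m))) by (apply Rlt_le, Rinv_0_lt_compat; auto).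
    apply Rle_trans with ((d * exp (- x0 * v) * (x0 + tau) * (v + d) ^ m
          + exp (- x0 * v) * ((v + d) ^ m - v ^ m)) * / INR (fact m) * rho ^ m).
    { apply Rmult_le_compat_r; auto. apply Rmult_le_compat_r; auto.
      apply Rlt_le, Rinv_0_lt_compat; auto. }
    rewrite (Rpow_mult_distr rho (v + d) m).
    replace ((d * exp (- x0 * v) * (x0 + tau) * (v + d) ^ m
       + exp (- x0 * v) * ((v + d) ^ m - v ^ m)) * / INR (fact m) * rho ^ m)
      with (d * exp (- x0 * v) * ((x0 + tau) * (rho ^ m * (v + d) ^ m / INR (fact m)))
       + exp (- x0 * v) * (((v + d) ^ m - v ^ m) * (rho ^ m / INR (fact m)))) by (field; lra).
    rewrite Rmult_plus_distr_l. apply Rplus_le_compat_l.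
    rewrite (Rmult_comm d), Rmult_assoc. apply Rmult_le_compat_l; [lra |].
    destruct m as [|k]; [simpl; lra |].
    pose proof (pow_diff_le v d k Hv (proj1 Hd)) as Hp.
    assert (Hfk : 0 < INR (fact k)) by apply INR_fact_lt_0.
    apply Rle_trans with (INR (S k) * (d * (v + d) ^ k) * (rho ^ S k / INR (fact (S k)))).
    { apply Rmult_le_compat_r; [| lra].
      apply Rmult_le_pos; [auto | apply Rlt_le, Rinv_0_lt_compat; auto]. }
    right. rewrite Rpow_mult_distr. rewrite fact_simpl, mult_INR.
    pose proof (INR_S_pos k). simpl (rho ^ S k). field. split; lra.
  - intros n.
    set (d := lnS (S n) - lnS n). pose proof (lnS_step n) as Hd. fold d in Hd.
    exists (d * exp (- x0 * lnS n) * ((x0 + tau) * exp (rho * lnS (S n)) + rho * exp (rho * lnS (S n)))).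
    split.
    + unfold b. fold d. apply is_series_Rscal, is_series_Rplus.
      * apply (is_series_scal_l (x0 + tau) (fun m => (rho * lnS (S n)) ^ m / INR (fact m))).
        apply is_series_exp.
      * apply is_series_exp_shift.
    + replace (lnS (S n)) with (lnS n + d) by (unfold d; ring). set (v := lnS n) in *.
      apply Rle_trans with (K * (exp (- rho * (v + d)) * (rho * d))).
      * replace (d * exp (- x0 * v) * ((x0 + tau) * exp (rho * (v + d)) + rho * exp (rho * (v + d))))
          with (d * (x0 + tau + rho) * (exp (- x0 * v) * exp (rho * (v + d)))) by ring.
        rewrite <- exp_plus.
        replace (- x0 * v + rho * (v + d)) with (- rho * (v + d) + 2 * rho * d) by (unfold rho; field).
        rewrite exp_plus. unfold K.
        replace ((x0 + tau + rho) * exp (2 * rho) / rho * (exp (- rho * (v + d)) * (rho * d)))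
          with (d * (x0 + tau + rho) * (exp (- rho * (v + d)) * exp (2 * rho))) by (field; lra).
        apply Rmult_le_compat_l; [apply Rmult_le_pos; lra |].
        apply Rmult_le_compat_l; [apply Rlt_le, exp_pos |]. apply exp_mono. nra.
      * apply Rmult_le_compat_l; [| apply exp_diff_ge].
        unfold K. apply Rmult_le_pos; [| apply Rlt_le, Rinv_0_lt_compat; auto].
        apply Rmult_le_pos; [lra | apply Rlt_le, exp_pos].
  - eexists. now apply is_series_exp_telescope.
Qed.

(** * Finite differences and Euler's transformation *)

(* [x ^ (- s)] for [x > 0]. *)
Definition cpow (s : C) (x : R) : C :=
  (cos (Im s * ln x) * exp (- Re s * ln x), - sin (Im s * ln x) * exp (- Re s * ln x)).

Fixpoint fdiff (k : nat) (s : C) (x : R) : C :=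
  match k with
  | O => cpow s x
  | S k => (fdiff k s x - fdiff k s (x + 1))%C
  end.

Lemma exp_ln_succ (a x : R) : 0 < x -> exp (- (a + 1) * ln x) = exp (- a * ln x) / x.
Proof.
  intros Hx. replace (- (a + 1) * ln x) with (- a * ln x + - ln x) by ring.
  rewrite exp_plus, exp_Ropp, exp_ln by auto. reflexivity.
Qed.

(** Differencing commutes with differentiation in [x], and differentiating [x^(-s)] gives
    [- s x^(-s-1)]. *)
Lemma is_derive_fdiff (k : nat) (s : C) (x : R) : 0 < x ->
  is_derive (fun y => Re (fdiff k s y)) x (Re (- s * fdiff k (s + 1) x)%C) /\
  is_derive (fun y => Im (fdiff k s y)) x (Im (- s * fdiff k (s + 1) x)%C).
Proof.
  revert x. induction k as [|k IH]; intros x Hx.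
  - destruct s as [a t]. unfold fdiff, cpow, Re, Im, Cmult, Copp, Cplus; simpl fst; simpl snd.
    rewrite Rplus_0_r, exp_ln_succ by auto.
    split; (auto_derive; [auto |]); field; lra.
  - destruct (IH x Hx) as [R1 I1]. destruct (IH (x + 1)) as [R2 I2]; [lra |].
    assert (Hs : is_derive (fun y : R => y + 1) x 1) by (auto_derive; auto; ring).
    pose proof (is_derive_comp (fun y => Re (fdiff k s y)) (fun y => y + 1) x _ _ R2 Hs) as R3.
    pose proof (is_derive_comp (fun y => Im (fdiff k s y)) (fun y => y + 1) x _ _ I2 Hs) as I3.
    pose proof (is_derive_minus _ _ x _ _ R1 R3) as R4.
    pose proof (is_derive_minus _ _ x _ _ I1 I3) as I4.
    split.
    + match type of R4 with is_derive _ _ ?l =>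
        replace (Re (- s * fdiff (S k) (s + 1) x)%C) with l; [exact R4 |] end.
      unfold minus, plus, opp, scal; simpl; unfold mult; simpl. ring.
    + match type of I4 with is_derive _ _ ?l =>
        replace (Im (- s * fdiff (S k) (s + 1) x)%C) with l; [exact I4 |] end.
      unfold minus, plus, opp, scal; simpl; unfold mult; simpl. ring.
Qed.

Lemma Re_mult_le (w z : C) : Rabs (Re w * Re z + Im w * Im z) <= Cmod w * Cmod z.
Proof.
  replace (Re w * Re z + Im w * Im z) with (Re (Cconj w * z)%C) by (destruct w, z; unfold Cconj, Cmult, Re, Im; simpl; ring).
  eapply Rle_trans; [apply re_le_Cmod |]. rewrite Cmod_mult, Cmod_conj. lra.
Qed.

Lemma Cmod_sqr (z : C) : Cmod z * Cmod z = Re z * Re z + Im z * Im z.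
Proof.
  unfold Cmod. rewrite sqrt_sqrt; [unfold Re, Im; ring |]. nra.
Qed.

(** There is no mean value equality for complex values; it is applied to the real function obtained
    by pairing [F] with its own increment [w], and the Cauchy-Schwarz inequality then allows
    division by [Cmod w]. *)
Lemma Cmod_increment_le (F dF : R -> C) (x B : R) :
  (forall y, x <= y <= x + 1 ->
     is_derive (fun y => Re (F y)) y (Re (dF y)) /\ is_derive (fun y => Im (F y)) y (Im (dF y))) ->
  (forall y, x <= y <= x + 1 -> Cmod (dF y) <= B) ->
  Cmod (F x - F (x + 1)%R)%C <= B.
Proof.
  intros HF HB. set (w := (F x - F (x + 1)%R)%C).
  destruct (MVT_gen (fun y => Re w * Re (F y) + Im w * Im (F y)) x (x + 1)
    (fun y => Re w * Re (dF y) + Im w * Im (dF y))) as (c & Hc & E).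
  - rewrite Rmin_left, Rmax_right by lra. intros y Hy.
    destruct (HF y) as [H1 H2]; [lra |].
    apply (is_derive_plus (fun y => Re w * Re (F y)) (fun y => Im w * Im (F y))).
    + now apply (is_derive_scal (fun y => Re (F y)) y (Re w)).
    + now apply (is_derive_scal (fun y => Im (F y)) y (Im w)).
  - rewrite Rmin_left, Rmax_right by lra. intros y Hy.
    destruct (HF y) as [H1 H2]; [lra |]. apply continuity_pt_filterlim.
    apply (continuous_plus (fun y => Re w * Re (F y)) (fun y => Im w * Im (F y))).
    + apply (continuous_mult (fun _ => Re w)); [apply continuous_const |].
      apply @ex_derive_continuous. eexists; eauto.
    + apply (continuous_mult (fun _ => Im w)); [apply continuous_const |].
      apply @ex_derive_continuous. eexists; eauto.
  - rewrite Rmin_left, Rmax_right in Hc by lra.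
    assert (Hw : Cmod w * Cmod w = - (Re w * Re (dF c) + Im w * Im (dF c))).
    { rewrite Cmod_sqr. replace (x + 1 - x) with 1 in E by ring. rewrite Rmult_1_r in E.
      rewrite <- E. unfold w, Re, Im; simpl; ring. }
    pose proof (Re_mult_le w (dF c)) as H. specialize (HB c Hc).
    rewrite <- Rabs_Ropp, <- Hw in H.
    pose proof (Cmod_ge_0 w) as H0. rewrite Rabs_pos_eq in H by nra.
    destruct (Req_dec (Cmod w) 0) as [Hz | Hz].
    + rewrite Hz. eapply Rle_trans; [apply (Cmod_ge_0 (dF c)) | auto].
    + apply Rle_trans with (Cmod (dF c)); auto.
      apply Rmult_le_reg_l with (Cmod w); lra.
Qed.

Lemma Cmod_cpow (s : C) (x : R) : Cmod (cpow s x) = exp (- Re s * ln x).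
Proof.
  pose proof (exp_pos (- Re s * ln x)) as Hp.
  apply Rsqr_inj; [apply Cmod_ge_0 | lra |]. unfold Rsqr. rewrite Cmod_sqr.
  unfold cpow; simpl. pose proof (sin2_cos2 (Im s * ln x)) as H. unfold Rsqr in H.
  replace (exp (- Re s * ln x) * exp (- Re s * ln x)) with
    ((sin (Im s * ln x) * sin (Im s * ln x) + cos (Im s * ln x) * cos (Im s * ln x))
     * (exp (- Re s * ln x) * exp (- Re s * ln x))) by (rewrite H; ring).
  ring.
Qed.

(** Each difference is bounded by a derivative, which trades one power of [x] for one factor
    [|s + i|]. The induction on [k] replaces [s] by [s + 1], hence the hypothesis on all the
    shifts. *)
Lemma Cmod_fdiff (k : nat) (s : C) (x a : R) :
  0 <= Re s -> 0 < x -> 0 <= a -> (forall i, (i < k)%nat -> Cmod (s + INR i)%C <= a) ->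
  Cmod (fdiff k s x) <= a ^ k * exp (- (Re s + INR k) * ln x).
Proof.
  intros Hs Hx Ha. revert s x Hs Hx. induction k as [|k IH]; intros s x Hs Hx Hi.
  - simpl fdiff. rewrite Cmod_cpow. simpl. rewrite Rplus_0_r. lra.
  - simpl fdiff.
    apply (Cmod_increment_le (fdiff k s) (fun y => (- s * fdiff k (s + 1) y)%C)).
    + intros y Hy. apply is_derive_fdiff. lra.
    + intros y Hy. rewrite Cmod_mult, Cmod_opp.
      assert (H0 : Cmod s <= a).
      { specialize (Hi O). replace (s + INR 0)%C with s in Hi by (simpl; ring). apply Hi; lia. }
      assert (Hr : Re (s + 1)%C = Re s + 1) by reflexivity.
      assert (H1 : Cmod (fdiff k (s + 1) y) <= a ^ k * exp (- (Re (s + 1)%C + INR k) * ln y)).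
      { apply IH; [rewrite Hr; lra | lra |]. intros i Hik.
        replace (s + 1 + INR i)%C with (s + INR (S i))%C.
        - apply Hi; lia.
        - rewrite S_INR, RtoC_plus. ring. }
      rewrite Hr in H1. simpl pow. rewrite Rmult_assoc.
      apply Rmult_le_compat; auto; try apply Cmod_ge_0.
      eapply Rle_trans; [exact H1 |].
      apply Rmult_le_compat_l; [now apply pow_le |]. apply exp_mono.
      rewrite S_INR. pose proof (pos_INR k). assert (ln x <= ln y) by (apply ln_le; lra).
      replace (Re s + 1 + INR k) with (Re s + (INR k + 1)) by ring. nra.
Qed.

Definition altsum (g : nat -> R) (N : nat) : R := Series (fun j => (-1) ^ j * g (N + j)%nat).

Definition ndiff (g : nat -> R) (n : nat) : R := g n - g (S n).

Lemma ex_series_alt (g : nat -> R) (N : nat) :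
  ex_series (fun n => Rabs (g n)) -> ex_series (fun j => (-1) ^ j * g (N + j)%nat).
Proof.
  intros H. apply ex_series_Rabs.
  apply ex_series_ext with (fun j => Rabs (g (N + j)%nat)).
  - intros j. now rewrite Rabs_pow_m1.
  - now apply (ex_series_incr_n (fun n => Rabs (g n)) N).
Qed.

Lemma ex_series_ndiff (g : nat -> R) :
  ex_series (fun n => Rabs (g n)) -> ex_series (fun n => Rabs (ndiff g n)).
Proof.
  intros H. apply (ex_series_Rabs_le _ (fun n => Rabs (g n) + Rabs (g (S n)))).
  - intros n. unfold ndiff, Rminus. rewrite <- (Rabs_Ropp (g (S n))). apply Rabs_triang.
  - apply (ex_series_plus (fun n => Rabs (g n)) (fun n => Rabs (g (S n)))); auto.
    now apply (ex_series_incr_1 (fun n => Rabs (g n))).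
Qed.

Lemma altsum_step (g : nat -> R) (N : nat) :
  ex_series (fun n => Rabs (g n)) -> altsum g N = g N - altsum g (S N).
Proof.
  intros H. unfold altsum. rewrite Series_incr_1 by now apply ex_series_alt.
  rewrite Nat.add_0_r, pow_O, Rmult_1_l. unfold Rminus. f_equal.
  rewrite <- Series_opp. apply Series_ext. intros j.
  replace (N + S j)%nat with (S N + j)%nat by lia. simpl. ring.
Qed.

(** One step of Euler's transformation: two consecutive tails have sum [g N], and their difference
    is the alternating series of the differences. *)
Lemma altsum_ndiff (g : nat -> R) (N : nat) :
  ex_series (fun n => Rabs (g n)) ->
  altsum g N = 1 / 2 * g N + 1 / 2 * altsum (ndiff g) N.
Proof.
  intros H. assert (E : altsum (ndiff g) N = altsum g N - altsum g (S N)).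
  { unfold altsum. rewrite <- Series_minus by now apply ex_series_alt.
    apply Series_ext. intros j. unfold ndiff.
    replace (S (N + j)) with (S N + j)%nat by lia. ring. }
  rewrite E. pose proof (altsum_step g N H). lra.
Qed.

(** A substitute for [altsum g N] that makes sense when only the differences of [g] are absolutely
    summable, as for [n^(-s)] with [0 < Re s <= 1]. *)
Definition avgsum (g : nat -> R) (N : nat) : R := 1 / 2 * g N + 1 / 2 * altsum (ndiff g) N.

Lemma avgsum_split (g : nat -> R) (N : nat) :
  ex_series (fun n => Rabs (ndiff g n)) ->
  avgsum g 0 = sum_f_R0 (fun n => (-1) ^ n * g n) N + (-1) ^ S N * avgsum g (S N).
Proof.
  intros H.
  assert (E : forall n, avgsum g n = g n - avgsum g (S n)).
  { intros n. unfold avgsum. rewrite (altsum_step (ndiff g) n H). unfold ndiff at 1. field. }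
  induction N as [|N IH].
  - simpl. rewrite E. ring.
  - rewrite IH, (E (S N)). simpl. ring.
Qed.

Lemma altsum_le (g b : nat -> R) (l : R) (N : nat) :
  (forall j, Rabs (g (N + j)%nat) <= b j) -> is_series b l -> Rabs (altsum g N) <= l.
Proof.
  intros H Hb. assert (Hex : ex_series b) by (eexists; eauto).
  rewrite <- (is_series_unique _ _ Hb). unfold altsum.
  assert (Hexr : ex_series (fun j => Rabs ((-1) ^ j * g (N + j)%nat))).
  { apply ex_series_Rabs_le with b; auto. intros j; rewrite Rabs_pow_m1; auto. }
  eapply Rle_trans; [apply Series_Rabs; auto |].
  apply Series_le; auto. intros j; rewrite Rabs_pow_m1. split; [apply Rabs_pos | auto].
Qed.

Fixpoint ndiffs (k : nat) (g : nat -> R) : nat -> R :=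
  match k with O => g | S k => ndiff (ndiffs k g) end.

(* Euler's transformation: [K] averaging steps of an alternating tail. *)
Lemma avgsum_euler_bound (g : nat -> R) (N K : nat) (c e : R) :
  (1 <= K)%nat -> 0 <= c ->
  ex_series (fun n => Rabs (ndiff g n)) ->
  (forall k, (k < K)%nat -> Rabs (ndiffs k g N) <= c * (/ 2) ^ k) ->
  (/ 2) ^ K * Rabs (altsum (ndiffs K g) N) <= e ->
  Rabs (avgsum g N) <= c + e.
Proof.
  intros HK Hc Hex Hg He.
  assert (Hexk : forall k, (1 <= k)%nat -> ex_series (fun n => Rabs (ndiffs k g n))).
  { intros k Hk. induction k as [|k IH]; [lia |].
    destruct k as [|k]; [exact Hex |]. apply ex_series_ndiff, IH. lia. }
  assert (Hp : forall k, 0 < (/ 2) ^ k) by (intros; apply pow_lt; lra).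
  (* Descent from level [K] to level [1]; at level [0] the series need not converge absolutely. The
     weight [(/ 2) ^ k] makes the averaging step harmless: [c * (/ 4) ^ k] dominates its half plus
     [c * (/ 4) ^ S k]. *)
  assert (HB : forall j, (j < K)%nat ->
    (/ 2) ^ (K - j) * Rabs (altsum (ndiffs (K - j) g) N) <= c * (/ 4) ^ (K - j) + e).
  { intros j. induction j as [|j IH]; intros Hj.
    - rewrite Nat.sub_0_r. eapply Rle_trans; [exact He |].
      assert (0 <= c * (/ 4) ^ K) by (apply Rmult_le_pos; [auto | apply pow_le; lra]). lra.
    - specialize (IH ltac:(lia)). set (k := (K - S j)%nat) in *.
      replace (K - j)%nat with (S k) in IH by (unfold k; lia).
      rewrite (altsum_ndiff (ndiffs k g) N) by (apply Hexk; unfold k; lia).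
      change (ndiff (ndiffs k g)) with (ndiffs (S k) g).
      specialize (Hg k ltac:(unfold k; lia)).
      assert (Ht : Rabs (1 / 2 * ndiffs k g N + 1 / 2 * altsum (ndiffs (S k) g) N)
        <= / 2 * Rabs (ndiffs k g N) + / 2 * Rabs (altsum (ndiffs (S k) g) N)).
      { eapply Rle_trans; [apply Rabs_triang |]. rewrite !Rabs_mult.
        rewrite (Rabs_pos_eq (1 / 2)) by lra. lra. }
      simpl pow in IH. specialize (Hp k).
      assert (E4 : (/ 4) ^ k = (/ 2) ^ k * (/ 2) ^ k).
      { rewrite <- Rpow_mult_distr. f_equal. lra. }
      assert (Hc4 : 0 <= c * (/ 4) ^ k) by (apply Rmult_le_pos; [auto | apply pow_le; lra]).
      apply Rle_trans with ((/ 2) ^ k * (/ 2 * Rabs (ndiffs k g N)) +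
        / 2 * (/ 2) ^ k * Rabs (altsum (ndiffs (S k) g) N)).
      + apply Rle_trans with (1 := Rmult_le_compat_l _ _ _ (Rlt_le _ _ Hp) Ht). right; ring.
      + assert ((/ 2) ^ k * (/ 2 * Rabs (ndiffs k g N)) <= / 2 * (c * (/ 4) ^ k)).
        { rewrite E4. apply Rle_trans with ((/ 2) ^ k * (/ 2 * (c * (/ 2) ^ k))).
          - apply Rmult_le_compat_l; lra.
          - right; ring. }
        lra. }
  specialize (HB (K - 1)%nat ltac:(lia)). replace (K - (K - 1))%nat with 1%nat in HB by lia.
  simpl in HB. specialize (Hg O ltac:(lia)). simpl in Hg.
  unfold avgsum. eapply Rle_trans; [apply Rabs_triang |]. rewrite !Rabs_mult.
  rewrite (Rabs_pos_eq (1 / 2)) by lra. lra.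
Qed.

Lemma exp_half_ln (y : R) : 0 < y -> exp (- (1 / 2) * ln y) = / sqrt y.
Proof.
  intros Hy. rewrite <- (Rpower_sqrt y Hy). unfold Rpower. rewrite <- exp_Ropp.
  f_equal. field.
Qed.

Lemma exp_ln_INR (k : nat) (y : R) : 0 < y -> exp (INR k * ln y) = y ^ k.
Proof. intros Hy. rewrite <- Rpower_pow by auto. reflexivity. Qed.

Lemma four_pow_ge (M : nat) : (1 <= M)%nat -> 4 * INR M <= 4 ^ M.
Proof.
  intros H. induction M as [|M IH]; [lia |]. destruct M as [|M]; [simpl; lra |].
  specialize (IH ltac:(lia)). rewrite S_INR. simpl pow in *.
  assert (1 <= INR (S M)) by (apply (le_INR 1); lia). lra.
Qed.

Lemma is_series_telescope_from (f : nat -> R) (N : nat) :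
  is_lim_seq f 0 -> is_series (fun j => f (N + j)%nat - f (N + S j)%nat) (f N).
Proof.
  intros H. pose proof (is_series_telescope (fun j => f (N + j)%nat)) as T.
  cbv beta in T. rewrite Nat.add_0_r in T. apply T.
  apply (is_lim_seq_ext (fun j => f (j + N)%nat)).
  - intros j. now rewrite Nat.add_comm.
  - now apply (is_lim_seq_incr_n f).
Qed.

(** For [i < M] one has [|s + i| <= 2 M], while the argument is at least [4 M]; so each of the [M]
    differences gains the factor [1/2] that [avgsum_euler_bound] asks for. The function [r] is the
    real or the imaginary part. *)
Lemma avgsum_cpow_bound (r : C -> R) (s : C) (M : nat) :
  (forall z1 z2, r (z1 - z2)%C = r z1 - r z2) -> (forall z, Rabs (r z) <= Cmod z) ->
  Re s = 1 / 2 -> 0 <= Im s <= INR M -> (2 <= M)%nat ->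
  let g := fun n => r (cpow s (INR (S n))) in
  ex_series (fun n => Rabs (ndiff g n)) ->
  Rabs (avgsum g (4 * M)) <= / sqrt (INR M).
Proof.
  intros Hr1 Hr2 Hs Ht HM g Hex.
  assert (HM2 : 2 <= INR M) by (apply (le_INR 2); lia).
  assert (Hg : forall k n, ndiffs k g n = r (fdiff k s (INR (S n)))).
  { intros k. induction k as [|k IH]; intros n; [reflexivity |].
    change (ndiffs (S k) g n) with (ndiffs k g n - ndiffs k g (S n)).
    rewrite !IH, (S_INR (S n)), <- Hr1. reflexivity. }
  assert (Hgb : forall k n, (k <= M)%nat ->
    Rabs (ndiffs k g n) <= (2 * INR M) ^ k * exp (- (1 / 2 + INR k) * ln (INR (S n)))).
  { intros k n Hk. rewrite Hg. eapply Rle_trans; [apply Hr2 |]. rewrite <- Hs.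
    apply Cmod_fdiff; [rewrite Hs; lra | apply INR_S_pos | lra |].
    intros i Hi.
    replace (s + INR i)%C with ((1 / 2 + INR i, Im s) : C).
    2:{ destruct s as [sr si]; simpl in *. unfold Cplus, RtoC; simpl. f_equal; lra. }
    replace ((1 / 2 + INR i, Im s) : C) with (RtoC (1 / 2 + INR i) + Ci * RtoC (Im s))%C.
    2:{ unfold Cplus, Cmult, Ci, RtoC; simpl. f_equal; ring. }
    eapply Rle_trans; [apply Cmod_triangle |].
    rewrite Cmod_mult, !Cmod_R. replace (Cmod Ci) with 1.
    2:{ unfold Cmod, Ci; simpl. replace (0 * (0 * 1) + 1 * (1 * 1)) with 1 by ring. now rewrite sqrt_1. }
    pose proof (pos_INR i). rewrite !Rabs_pos_eq by lra.
    assert (INR (S i) <= INR M) by (apply le_INR; lia). rewrite S_INR in H0. lra. }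
  assert (H4M : INR (4 * M) = 4 * INR M) by (rewrite mult_INR; simpl; lra).
  (* This is [(4 M)^(-1/2)], half of the bound to be proved: one [c] pays for the averaged terms,
     the other for the final remainder. *)
  set (c := / (2 * sqrt (INR M))).
  assert (Hsq : 0 < sqrt (INR M)) by (apply sqrt_lt_R0; lra).
  assert (Hc : 0 < c) by (apply Rinv_0_lt_compat; lra).
  assert (Hexp : forall k x, 4 * INR M <= x ->
    exp (- (1 / 2 + INR k) * ln x) <= c * / x ^ k).
  { intros k x Hx. replace (- (1 / 2 + INR k) * ln x) with (- (1 / 2) * ln x + - (INR k * ln x)) by ring.
    rewrite exp_plus, exp_Ropp, exp_ln_INR, exp_half_ln by lra.
    apply Rmult_le_compat_r.
    - apply Rlt_le, Rinv_0_lt_compat, pow_lt. lra.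
    - unfold c. apply Rinv_le_contravar; [lra |].
      replace (2 * sqrt (INR M)) with (sqrt (4 * INR M)).
      + apply sqrt_le_1_alt; lra.
      + rewrite sqrt_mult by lra. f_equal. replace 4 with (2 * 2) by ring. apply sqrt_square; lra. }
  replace (/ sqrt (INR M)) with (c + c) by (unfold c; field; lra).
  apply (avgsum_euler_bound g (4 * M) M c c); auto; try lia; try lra.
  - intros k Hk. eapply Rle_trans; [apply Hgb; lia |].
    assert (Hx : 4 * INR M <= INR (S (4 * M))) by (rewrite S_INR, H4M; lra).
    eapply Rle_trans; [apply Rmult_le_compat_l; [apply pow_le; lra | apply (Hexp k _ Hx)] |].
    replace ((2 * INR M) ^ k * (c * / INR (S (4 * M)) ^ k))
      with (c * ((2 * INR M) * / INR (S (4 * M))) ^ k)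
      by (rewrite Rpow_mult_distr, pow_inv; ring).
    apply Rmult_le_compat_l; [lra |]. apply pow_incr. split.
    + apply Rmult_le_pos; [lra | apply Rlt_le, Rinv_0_lt_compat; lra].
    + apply Rmult_le_reg_r with (INR (S (4 * M))); [lra |].
      rewrite Rmult_assoc, Rinv_l by lra. lra.
  (* Two of the [M] factors [2 M / x] are kept, so that [/ x ^ 2] can be summed by telescoping; the
     other [M - 2] are estimated by [1/2]. This gives [(2 M)^2 * 2^(2 - M) = 16 M^2 * 2^(- M)]. *)
  - set (D := c * (16 * INR M ^ 2 * (/ 2) ^ M)).
    assert (Hp2 : 0 < (/ 2) ^ M) by (apply pow_lt; lra).
    assert (HD : 0 <= D) by (unfold D; apply Rmult_le_pos; [lra |]; apply Rmult_le_pos; [nra | lra]).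
    assert (Hal : Rabs (altsum (ndiffs M g) (4 * M)) <= D * / INR (4 * M)).
    { apply altsum_le with (fun j => D * (/ INR (4 * M + j) - / INR (4 * M + S j))).
      - intros j. eapply Rle_trans; [apply Hgb; lia |].
        set (x := INR (S (4 * M + j))).
        assert (Hx : x = INR (4 * M + j) + 1) by apply S_INR.
        replace (4 * M + S j)%nat with (S (4 * M + j)) by lia. fold x.
        assert (Hx0 : 4 * INR M <= INR (4 * M + j)) by (rewrite <- H4M; apply le_INR; lia).
        eapply Rle_trans; [apply Rmult_le_compat_l; [apply pow_le; lra | apply (Hexp M x); lra] |].
        apply Rle_trans with (D * / x ^ 2).
        + assert (Hsplit : (2 * INR M) ^ M * / x ^ M <= 16 * INR M ^ 2 * (/ 2) ^ M * / x ^ 2).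
          { replace M with (2 + (M - 2))%nat at 2 3 by lia.
            rewrite !pow_add.
            replace ((2 * INR M) ^ 2 * (2 * INR M) ^ (M - 2) * / (x ^ 2 * x ^ (M - 2)))
              with ((4 * INR M ^ 2 * / x ^ 2) * ((2 * INR M) * / x) ^ (M - 2)).
            2:{ rewrite Rpow_mult_distr, pow_inv. field. repeat split; try lra; apply pow_nonzero; lra. }
            replace (16 * INR M ^ 2 * (/ 2) ^ M * / x ^ 2)
              with ((4 * INR M ^ 2 * / x ^ 2) * (/ 2) ^ (M - 2)).
            2:{ replace M with (2 + (M - 2))%nat at 4 by lia. rewrite pow_add. field. lra. }
            apply Rmult_le_compat_l.
            - apply Rmult_le_pos; [nra |]. apply Rlt_le, Rinv_0_lt_compat, pow_lt. lra.
            - apply pow_incr. split.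
              + apply Rmult_le_pos; [lra | apply Rlt_le, Rinv_0_lt_compat; lra].
              + apply Rmult_le_reg_r with x; [lra |]. rewrite Rmult_assoc, Rinv_l; lra. }
          unfold D.
          replace ((2 * INR M) ^ M * (c * / x ^ M)) with (c * ((2 * INR M) ^ M * / x ^ M)) by ring.
          rewrite Rmult_assoc. apply Rmult_le_compat_l; lra.
        + apply Rmult_le_compat_l; auto.
          replace (INR (4 * M + j)) with (x - 1) by lra.
          replace (/ (x - 1) - / x) with (/ (x * (x - 1))) by (field; lra).
          apply Rinv_le_contravar; [nra |]. simpl. nra.
      - apply is_series_Rscal, (is_series_telescope_from (fun j => / INR j)).
        replace (Finite 0) with (Rbar_inv p_infty) by reflexivity.
        apply is_lim_seq_inv; [apply is_lim_seq_INR | discriminate]. }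
    apply Rle_trans with ((/ 2) ^ M * (D * / INR (4 * M))).
    { apply Rmult_le_compat_l; lra. }
    unfold D. rewrite H4M.
    replace ((/ 2) ^ M * (c * (16 * INR M ^ 2 * (/ 2) ^ M) * / (4 * INR M)))
      with (c * (4 * INR M * ((/ 2) ^ M * (/ 2) ^ M))) by (field; lra).
    rewrite <- Rpow_mult_distr. replace (/ 2 * / 2) with (/ 4) by lra. rewrite pow_inv.
    rewrite <- (Rmult_1_r c) at 2. apply Rmult_le_compat_l; [lra |].
    apply Rmult_le_reg_r with (4 ^ M); [apply pow_lt; lra |].
    rewrite Rmult_assoc, Rinv_l by (apply pow_nonzero; lra).
    pose proof (four_pow_ge M ltac:(lia)). lra.
Qed.

Lemma eta_avgsum (q : R -> R) (x : R) : eta q x = avgsum (lterm q x) 0.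
Proof. reflexivity. Qed.

Lemma avgsum_lterm_lim (q : R -> R) (tau x : R) :
  bounded_lipschitz q tau -> 0 < x -> is_lim_seq (avgsum (lterm q x)) 0.
Proof.
  intros Hq Hx. set (K := (x + tau) * exp x / x).
  assert (Hb : forall N, Rabs (avgsum (lterm q x) N) <= (1 + K) * exp (- x * lnS N)).
  { intros N. unfold avgsum. eapply Rle_trans; [apply Rabs_triang |]. rewrite !Rabs_mult.
    rewrite (Rabs_pos_eq (1 / 2)) by lra.
    assert (H1 : Rabs (lterm q x N) <= exp (- x * lnS N)).
    { unfold lterm. rewrite Rabs_mult. pose proof (exp_pos (- x * lnS N)).
      rewrite (Rabs_pos_eq (exp _)) by lra. pose proof (proj1 Hq (lnS N)). nra. }
    assert (H2 : Rabs (altsum (ndiff (lterm q x)) N) <= K * exp (- x * lnS N)).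
    { apply altsum_le with
        (fun j => K * (exp (- x * lnS (N + j)) - exp (- x * lnS (N + S j)))).
      - intros j. replace (N + S j)%nat with (S (N + j)) by lia.
        now apply (lpair_bound q tau x (N + j)).
      - apply is_series_Rscal, (is_series_telescope_from (fun j => exp (- x * lnS j))).
        now apply is_lim_exp_lnS. }
  pose proof (Rabs_pos (lterm q x N)). pose proof (Rabs_pos (altsum (ndiff (lterm q x)) N)). lra. }
  apply is_lim_seq_abs_0.
  apply is_lim_seq_le_le with (fun _ => 0) (fun N => (1 + K) * exp (- x * lnS N)).
  - intros N. split; [apply Rabs_pos | apply Hb].
  - apply is_lim_seq_const.
  - replace (Finite 0) with (Rbar_mult (1 + K) 0) by (simpl; f_equal; ring).
    apply is_lim_seq_scal_l. now apply is_lim_exp_lnS.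
Qed.

(** Only partial sums with an even number of terms are considered, to match
    [alternating_sum_even]. *)
Lemma eta_lim (q : R -> R) (tau x : R) :
  bounded_lipschitz q tau -> 0 < x ->
  is_lim_seq (fun m => sum_f_R0 (fun n => (-1) ^ n * lterm q x n) (2 * m + 1)) (eta q x).
Proof.
  intros Hq Hx.
  apply (is_lim_seq_ext (fun m => eta q x - avgsum (lterm q x) (2 * m + 2))).
  - intros m. rewrite eta_avgsum.
    rewrite (avgsum_split (lterm q x) (2 * m + 1)) by now apply (ex_series_Rabs_lpair q tau).
    replace (S (2 * m + 1)) with (2 * (m + 1))%nat by lia. rewrite pow_1_even.
    replace (2 * (m + 1))%nat with (2 * m + 2)%nat by lia. ring.
  - replace (Finite (eta q x)) with (Finite (eta q x - 0)) by (f_equal; ring).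
    apply is_lim_seq_minus'; [apply is_lim_seq_const |].
    apply (is_lim_seq_subseq (avgsum (lterm q x)) 0 (fun m => 2 * m + 2)%nat).
    + apply eventually_subseq. intros n; lia.
    + now apply avgsum_lterm_lim with tau.
Qed.

(** * The zeta-function on the critical line *)

Lemma bounded_lipschitz_of_derive (h dh : R -> R) (t : R) :
  (forall v, Rabs (h v) <= 1) -> (forall v, is_derive h v (dh v)) ->
  (forall v, Rabs (dh v) <= 1) -> bounded_lipschitz (fun v => h (t * v)) (Rabs t).
Proof.
  intros H0 Hd H1. split; [auto |]. intros v w.
  destruct (MVT_gen h (t * w) (t * v) dh) as (c & _ & E).
  - intros y _. apply Hd.
  - intros y _. apply continuity_pt_filterlim, @ex_derive_continuous. eexists; apply Hd.
  - rewrite E, Rabs_mult. replace (t * v - t * w) with (t * (v - w)) by ring.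
    rewrite Rabs_mult. specialize (H1 c).
    assert (0 <= Rabs t * Rabs (v - w)) by (apply Rmult_le_pos; apply Rabs_pos).
    nra.
Qed.

Definition qcos (t v : R) : R := cos (t * v).
Definition qsin (t v : R) : R := - sin (t * v).

Lemma qcos_bounded_lipschitz (t : R) : bounded_lipschitz (qcos t) (Rabs t).
Proof.
  apply (bounded_lipschitz_of_derive cos (fun v => - sin v)).
  - intros v. apply Rabs_le. pose proof (COS_bound v). lra.
  - intros v. apply is_derive_cos.
  - intros v. rewrite Rabs_Ropp. apply Rabs_le. pose proof (SIN_bound v). lra.
Qed.

Lemma qsin_bounded_lipschitz (t : R) : bounded_lipschitz (qsin t) (Rabs t).
Proof.
  apply (bounded_lipschitz_of_derive (fun v => - sin v) (fun v => - cos v)).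
  - intros v. rewrite Rabs_Ropp. apply Rabs_le. pose proof (SIN_bound v). lra.
  - intros v. apply (is_derive_opp sin). apply is_derive_sin.
  - intros v. rewrite Rabs_Ropp. apply Rabs_le. pose proof (COS_bound v). lra.
Qed.

Lemma cpow_lterm (x t : R) (n : nat) :
  cpow (x, t) (INR (S n)) = (lterm (qcos t) x n, lterm (qsin t) x n).
Proof. reflexivity. Qed.

Lemma nat_Cpow_opp_cpow (n : nat) (s : C) : nat_Cpow_opp (S n) s = cpow s (INR (S n)).
Proof.
  unfold nat_Cpow_opp, Cexp, cpow. destruct s as [x t].
  replace (Re (- (x, t) * RtoC (ln (INR (S n))))%C) with (- x * ln (INR (S n)))
    by (unfold Re, Copp, Cmult, RtoC; cbn [fst snd]; ring).
  replace (Im (- (x, t) * RtoC (ln (INR (S n))))%C) with (- (t * ln (INR (S n))))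
    by (unfold Im, Copp, Cmult, RtoC; cbn [fst snd]; ring).
  rewrite cos_neg, sin_neg. unfold Re, Im; cbn [fst snd]. f_equal; ring.
Qed.

Lemma is_lim_seq_C (u : nat -> C) (l : C) :
  filterlim u eventually (@locally C_UniformSpace l) ->
  is_lim_seq (fun n => Re (u n)) (Re l) /\ is_lim_seq (fun n => Im (u n)) (Im l).
Proof.
  intros H. split.
  - apply (filterlim_comp _ _ _ u Re eventually (@locally C_UniformSpace l) (locally (Re l)) H).
    intros P [e He]. exists e. intros y [Hy _]. now apply He.
  - apply (filterlim_comp _ _ _ u Im eventually (@locally C_UniformSpace l) (locally (Im l)) H).
    intros P [e He]. exists e. intros y [_ Hy]. now apply He.
Qed.

Lemma sum_n_C (a : nat -> C) (n : nat) :
  Re (@sum_n C_AbelianGroup a n) = sum_n (fun k => Re (a k)) n /\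
  Im (@sum_n C_AbelianGroup a n) = sum_n (fun k => Im (a k)) n.
Proof.
  induction n as [|n [IH1 IH2]].
  - now rewrite !sum_O.
  - rewrite !sum_Sn, <- IH1, <- IH2. split; reflexivity.
Qed.

Lemma is_series_C (a : nat -> C) (l : C) :
  @is_series C_AbsRing C_NormedModule a l ->
  is_series (fun n => Re (a n)) (Re l) /\ is_series (fun n => Im (a n)) (Im l).
Proof.
  intros H. destruct (is_lim_seq_C (@sum_n C_AbelianGroup a) l H) as [H1 H2]. split.
  - change (is_lim_seq (sum_n (fun n => Re (a n))) (Re l)).
    apply (is_lim_seq_ext (fun n => Re (@sum_n C_AbelianGroup a n))); auto.
    intros n. apply sum_n_C.
  - change (is_lim_seq (sum_n (fun n => Im (a n))) (Im l)).
    apply (is_lim_seq_ext (fun n => Im (@sum_n C_AbelianGroup a n))); auto.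
    intros n. apply sum_n_C.
Qed.

Lemma pow_n_RtoC (u : R) (delta : C) (n : nat) :
  @pow_n C_Ring (RtoC u * delta)%C n = (RtoC (u ^ n) * @pow_n C_Ring delta n)%C.
Proof.
  induction n as [|n IH].
  - simpl. change (@one C_Ring) with (RtoC 1). now rewrite Cmult_1_l.
  - simpl pow_n. rewrite IH. change (@mult C_Ring) with Cmult. simpl pow. rewrite RtoC_mult.
    match goal with |- @eq _ ?x ?y => change (@eq C x y) end. ring.
Qed.

(** The direction is left open for two uses: [delta = 1] for the continuation in [Re s], and
    [delta = Ci] for the continuity of [Z^2] on the critical line. *)
Lemma analytic_at_line (f : C -> C) (s0 delta : C) :
  analytic_at f s0 -> Cmod delta = 1 ->
  real_analytic_at (fun u => Re (f (s0 + RtoC u * delta)%C)) 0 /\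
  real_analytic_at (fun u => Im (f (s0 + RtoC u * delta)%C)) 0.
Proof.
  intros (a & r & Hr & Ha) Hd.
  assert (H : forall u, Rabs u < r ->
    is_series (fun n => Re (@pow_n C_Ring delta n * a n)%C * u ^ n) (Re (f (s0 + RtoC u * delta)%C)) /\
    is_series (fun n => Im (@pow_n C_Ring delta n * a n)%C * u ^ n) (Im (f (s0 + RtoC u * delta)%C))).
  { intros u Hu.
    assert (E : (s0 + RtoC u * delta - s0 = RtoC u * delta)%C) by ring.
    specialize (Ha (s0 + RtoC u * delta)%C). rewrite E in Ha.
    rewrite Cmod_mult, Hd, Cmod_R, Rmult_1_r in Ha. specialize (Ha Hu).
    destruct (is_series_C _ _ Ha) as [H1 H2].
    assert (Hn : forall n, (@scal C_AbsRing C_NormedModule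
        (@pow_n C_AbsRing (RtoC u * delta)%C n) (a n) : C)
      = (RtoC (u ^ n) * (@pow_n C_Ring delta n * a n))%C).
    { intros n. change (@scal C_AbsRing C_NormedModule) with Cmult.
      change (@pow_n C_AbsRing) with (@pow_n C_Ring). rewrite pow_n_RtoC. ring. }
    split.
    - eapply is_series_ext; [| exact H1]. intros n. 
      transitivity (Re (RtoC (u ^ n) * (@pow_n C_Ring delta n * a n))%C); [exact (f_equal Re (Hn n)) |].
      real_eq. unfold Re at 1, Cmult at 1, RtoC; cbn [fst snd]. unfold Re. ring.
    - eapply is_series_ext; [| exact H2]. intros n. 
      transitivity (Im (RtoC (u ^ n) * (@pow_n C_Ring delta n * a n))%C); [exact (f_equal Im (Hn n)) |].
      real_eq. unfold Im at 1, Cmult at 1, RtoC; cbn [fst snd]. unfold Im. ring. }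
  split; eexists; exists r; (split; [exact Hr |]); intros u Hu; apply is_pseries_R;
    rewrite Rplus_0_l; apply (H u Hu).
Qed.

Lemma real_analytic_at_shift (f g : R -> R) (x0 : R) :
  (forall u, g u = f (x0 + u)) -> real_analytic_at g 0 -> real_analytic_at f x0.
Proof.
  intros E (a & r & Hr & Ha). exists a, r. split; auto. intros u Hu.
  rewrite <- E. specialize (Ha u Hu). now rewrite Rplus_0_l in Ha.
Qed.

Lemma real_analytic_at_continuous (f : R -> R) (x0 : R) :
  real_analytic_at f x0 -> continuous f x0.
Proof.
  intros (a & r & Hr & Ha).
  assert (Hc : continuous (fun x => PSeries a (x - x0)) x0).
  { apply (continuous_comp (fun x => x - x0) (PSeries a)).
    - apply (continuous_minus (fun x => x) (fun _ => x0)); [apply continuous_id | apply continuous_const].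
    - apply continuity_pt_filterlim, PSeries_continuity.
      apply CV_radius_ge with r.
      + intros u Hu; eexists; now apply Ha.
      + unfold Rminus. rewrite Rplus_opp_r, Rabs_R0. lra. }
  apply continuous_ext_loc with (2 := Hc).
  exists (mkposreal r Hr). intros y Hy.
  change (Rabs (y - x0) < r) in Hy.
  rewrite (is_pseries_unique _ _ _ (Ha _ Hy)). f_equal. ring.
Qed.

Lemma zeta_line_analytic (zeta : C -> C) (x t : R) : is_riemann_zeta zeta -> t <> 0 ->
  real_analytic_at (fun x => Re (zeta (x, t))) x /\ real_analytic_at (fun x => Im (zeta (x, t))) x.
Proof.
  intros Hzeta Ht.
  assert (Hne : ((x, t) : C) <> RtoC 1) by (intros E; apply Ht; now inversion E).
  destruct (analytic_at_line zeta (x, t) (RtoC 1) (proj2 Hzeta _ Hne)) as [H1 H2].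
  { rewrite Cmod_R. apply Rabs_R1. }
  assert (E : forall u, ((x, t) + RtoC u * RtoC 1)%C = ((x + u, t) : C)).
  { intros u. unfold Cplus, Cmult, RtoC; simpl. f_equal; ring. }
  split.
  - eapply real_analytic_at_shift; [| exact H1]. intros u; cbv beta. now rewrite E.
  - eapply real_analytic_at_shift; [| exact H2]. intros u; cbv beta. now rewrite E.
Qed.

Lemma hardyZ2_continuous (zeta : C -> C) (t : R) :
  is_riemann_zeta zeta -> continuous (hardyZ2 zeta) t.
Proof.
  intros Hzeta.
  assert (Hne : ((1 / 2, t) : C) <> RtoC 1) by (intros E; inversion E; lra).
  destruct (analytic_at_line zeta (1 / 2, t) Ci (proj2 Hzeta _ Hne)) as [H1 H2].
  { unfold Cmod, Ci; simpl. replace (0 * (0 * 1) + 1 * (1 * 1)) with 1 by ring. apply sqrt_1. }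
  assert (E : forall u, (((1 / 2)%R, t) + RtoC u * Ci)%C = ((1 / 2, t + u) : C)).
  { intros u. unfold Cplus, Cmult, Ci, RtoC; simpl. f_equal; ring. }
  assert (C1 : continuous (fun t => Re (zeta (1 / 2, t))) t).
  { apply real_analytic_at_continuous. eapply real_analytic_at_shift; [| exact H1].
    intros u; cbv beta. now rewrite E. }
  assert (C2 : continuous (fun t => Im (zeta (1 / 2, t))) t).
  { apply real_analytic_at_continuous. eapply real_analytic_at_shift; [| exact H2].
    intros u; cbv beta. now rewrite E. }
  apply continuous_ext with
    (fun t => Re (zeta (1 / 2, t)) * Re (zeta (1 / 2, t)) + Im (zeta (1 / 2, t)) * Im (zeta (1 / 2, t))).
  - intros y. unfold hardyZ2, zeta_half. rewrite <- Cmod_sqr. simpl. ring.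
  - apply (continuous_plus (fun t => Re (zeta (1 / 2, t)) * Re (zeta (1 / 2, t)))).
    + now apply (continuous_mult (fun t => Re (zeta (1 / 2, t)))).
    + now apply (continuous_mult (fun t => Im (zeta (1 / 2, t)))).
Qed.

(** * The relation between zeta and the alternating series *)

Lemma ln_even (j : nat) : lnS (2 * j + 1) = ln 2 + lnS j.
Proof.
  unfold lnS. replace (S (2 * j + 1)) with (2 * S j)%nat by lia.
  rewrite mult_INR, ln_mult; [reflexivity | simpl; lra | apply INR_S_pos].
Qed.

Lemma cpow_even (x t : R) (j : nat) :
  cpow (x, t) (INR (S (2 * j + 1))) = (cpow (x, t) 2 * cpow (x, t) (INR (S j)))%C.
Proof.
  unfold cpow. fold (lnS (2 * j + 1)). fold (lnS j). rewrite ln_even.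
  unfold Re, Im, Cmult; cbn [fst snd]. rewrite !Rmult_plus_distr_l, exp_plus, cos_plus, sin_plus.
  f_equal; ring.
Qed.

(** The odd indices [2 j + 1] belong to the even integers [2 j + 2], whose terms change sign. *)
Lemma alternating_sum_even (g : nat -> R) (m : nat) :
  sum_f_R0 (fun n => (-1) ^ n * g n) (2 * m + 1)
  = sum_f_R0 g (2 * m + 1) - 2 * sum_f_R0 (fun j => g (2 * j + 1)%nat) m.
Proof.
  induction m as [|m IH].
  - simpl. ring.
  - replace (2 * S m + 1)%nat with (S (S (2 * m + 1))) by lia.
    rewrite !tech5, IH.
    replace (2 * S m + 1)%nat with (S (S (2 * m + 1))) by lia.
    replace (S (2 * m + 1)) with (2 * (m + 1))%nat by lia.
    rewrite pow_1_odd, pow_1_even. ring.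
Qed.

(** Here [2 * cpow s 2] is [2^(1-s)]. *)
Definition eta_zeta (zeta : C -> C) (s : C) : C := ((1 - 2 * cpow s 2) * zeta s)%C.

Lemma eta_zeta_right (zeta : C -> C) (x t : R) : is_riemann_zeta zeta -> 1 < x ->
  eta_zeta zeta (x, t) = (eta (qcos t) x, eta (qsin t) x).
Proof.
  intros Hzeta Hx.
  set (A := lterm (qcos t) x). set (B := lterm (qsin t) x).
  destruct (is_series_C _ _ (proj1 Hzeta (x, t) Hx)) as [H1 H2].
  assert (HA : is_lim_seq (sum_f_R0 A) (Re (zeta (x, t)))).
  { apply (is_lim_seq_ext (sum_n (fun n => Re (nat_Cpow_opp (S n) (x, t))))); auto.
    intros n. rewrite <- sum_n_Reals. apply sum_n_ext. intros k.
    now rewrite nat_Cpow_opp_cpow, cpow_lterm. }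
  assert (HB : is_lim_seq (sum_f_R0 B) (Im (zeta (x, t)))).
  { apply (is_lim_seq_ext (sum_n (fun n => Im (nat_Cpow_opp (S n) (x, t))))); auto.
    intros n. rewrite <- sum_n_Reals. apply sum_n_ext. intros k.
    now rewrite nat_Cpow_opp_cpow, cpow_lterm. }
  assert (Hsub : forall (u : nat -> R) l, is_lim_seq u l -> is_lim_seq (fun m => u (2 * m + 1)%nat) l).
  { intros u l Hu. apply (is_lim_seq_subseq u l (fun m => 2 * m + 1)%nat); auto.
    apply eventually_subseq. intros n; lia. }
  set (p := Re (cpow (x, t) 2)). set (r := Im (cpow (x, t) 2)).
  assert (Ee : forall j, A (2 * j + 1)%nat = p * A j - r * B j /\ B (2 * j + 1)%nat = p * B j + r * A j).
  { intros j. pose proof (cpow_even x t j) as E. rewrite !cpow_lterm in E.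
    fold A B in E. split.
    - apply (f_equal Re) in E. exact E.
    - apply (f_equal Im) in E. exact E. }
  assert (Hlin : forall (u v : nat -> R) c d m, sum_f_R0 (fun j => c * u j + d * v j) m
     = c * sum_f_R0 u m + d * sum_f_R0 v m).
  { intros u v c d m. induction m as [|m IH]; [simpl; ring |]. rewrite !tech5, IH. ring. }
  assert (Hpos : 0 < x) by lra.
  pose proof (eta_lim (qcos t) (Rabs t) x (qcos_bounded_lipschitz t) Hpos) as LA.
  pose proof (eta_lim (qsin t) (Rabs t) x (qsin_bounded_lipschitz t) Hpos) as LB.
  fold A in LA. fold B in LB.
  (* A second evaluation of the limit in [LA]: by [cpow_even] the terms at even integers are
     [2^(-s)] times the original series, which converges for [x > 1]. *)
  assert (LA' : is_lim_seq (fun m => sum_f_R0 (fun n => (-1) ^ n * A n) (2 * m + 1))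
     (Re (zeta (x, t)) - 2 * (p * Re (zeta (x, t)) + - r * Im (zeta (x, t))))).
  { apply (is_lim_seq_ext (fun m => sum_f_R0 A (2 * m + 1) -
        2 * (p * sum_f_R0 A m + - r * sum_f_R0 B m))).
    - intros m. rewrite alternating_sum_even, <- Hlin. do 2 f_equal.
      apply sum_eq. intros j _. rewrite (proj1 (Ee j)). ring.
    - apply is_lim_seq_minus'; [now apply Hsub |].
      apply (is_lim_seq_scal_l _ 2 (p * Re (zeta (x, t)) + - r * Im (zeta (x, t)))).
      apply is_lim_seq_plus'.
      + now apply (is_lim_seq_scal_l _ p (Re (zeta (x, t)))).
      + now apply (is_lim_seq_scal_l _ (- r) (Im (zeta (x, t)))). }
  assert (LB' : is_lim_seq (fun m => sum_f_R0 (fun n => (-1) ^ n * B n) (2 * m + 1))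
     (Im (zeta (x, t)) - 2 * (p * Im (zeta (x, t)) + r * Re (zeta (x, t))))).
  { apply (is_lim_seq_ext (fun m => sum_f_R0 B (2 * m + 1) -
        2 * (p * sum_f_R0 B m + r * sum_f_R0 A m))).
    - intros m. rewrite alternating_sum_even, <- Hlin. do 2 f_equal.
      apply sum_eq. intros j _. rewrite (proj2 (Ee j)). ring.
    - apply is_lim_seq_minus'; [now apply Hsub |].
      apply (is_lim_seq_scal_l _ 2 (p * Im (zeta (x, t)) + r * Re (zeta (x, t)))).
      apply is_lim_seq_plus'.
      + now apply (is_lim_seq_scal_l _ p (Im (zeta (x, t)))).
      + now apply (is_lim_seq_scal_l _ r (Re (zeta (x, t)))). }
  apply is_lim_seq_unique in LA. apply is_lim_seq_unique in LA'.
  apply is_lim_seq_unique in LB. apply is_lim_seq_unique in LB'.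
  rewrite LA in LA'. rewrite LB in LB'. injection LA' as EA. injection LB' as EB.
  unfold eta_zeta. rewrite EA, EB.
  replace (cpow (x, t) 2) with ((p, r) : C) by (unfold p, r; now destruct (cpow (x, t) 2)).
  destruct (zeta (x, t)) as [zr zi]. unfold Cmult, Cminus, Copp, Cplus, RtoC, Re, Im; cbn [fst snd].
  f_equal; ring.
Qed.

(** For [t <> 0] the horizontal line avoids the point [1], so both sides are real-analytic on
    [[1/2, 2]]; they agree on [(1, 2]]. *)
Lemma eta_zeta_half (zeta : C -> C) (t : R) : is_riemann_zeta zeta -> t <> 0 ->
  eta_zeta zeta (1 / 2, t) = (eta (qcos t) (1 / 2), eta (qsin t) (1 / 2)).
Proof.
  intros Hzeta Ht.
  set (p := fun x => Re (1 - 2 * cpow (x, t) 2)%C).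
  set (r := fun x => Im (1 - 2 * cpow (x, t) 2)%C).
  assert (Hp : forall x, real_analytic_at p x).
  { intros x. apply real_analytic_at_ext with (fun x => 1 - 2 * cos (t * ln 2) * exp (- x * ln 2)).
    - intros y. unfold p, cpow, Cmult, Cminus, Copp, Cplus, RtoC, Re, Im; cbn [fst snd]. ring.
    - apply real_analytic_at_minus; [apply real_analytic_at_const | apply real_analytic_at_exp]. }
  assert (Hr : forall x, real_analytic_at r x).
  { intros x. apply real_analytic_at_ext with (fun x => 2 * sin (t * ln 2) * exp (- x * ln 2)).
    - intros y. unfold r, cpow, Cmult, Cminus, Copp, Cplus, RtoC, Re, Im; cbn [fst snd]. ring.
    - apply real_analytic_at_exp. }
  assert (ER : Re (eta_zeta zeta (1 / 2, t)) - eta (qcos t) (1 / 2) = 0).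
  { apply (real_analytic_identity (fun x => Re (eta_zeta zeta (x, t)) - eta (qcos t) x) (1 / 2) 1 2);
      [lra | | | lra].
    - intros x Hx. apply real_analytic_at_minus.
      + apply real_analytic_at_ext with (fun x => p x * Re (zeta (x, t)) - r x * Im (zeta (x, t))).
        { intros y. reflexivity. }
        destruct (zeta_line_analytic zeta x t Hzeta Ht).
        apply real_analytic_at_minus; now apply real_analytic_at_mult.
      + apply real_analytic_at_eta with (Rabs t); [apply qcos_bounded_lipschitz | try (apply Rlt_0_1 || lra)].
    - intros x Hx. rewrite eta_zeta_right by (auto; lra). unfold Re; simpl. ring. }
  assert (EI : Im (eta_zeta zeta (1 / 2, t)) - eta (qsin t) (1 / 2) = 0).
  { apply (real_analytic_identity (fun x => Im (eta_zeta zeta (x, t)) - eta (qsin t) x) (1 / 2) 1 2);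
      [lra | | | lra].
    - intros x Hx. apply real_analytic_at_minus.
      + apply real_analytic_at_ext with (fun x => p x * Im (zeta (x, t)) + r x * Re (zeta (x, t))).
        { intros y. reflexivity. }
        destruct (zeta_line_analytic zeta x t Hzeta Ht).
        apply real_analytic_at_plus; now apply real_analytic_at_mult.
      + apply real_analytic_at_eta with (Rabs t); [apply qsin_bounded_lipschitz | lra].
    - intros x Hx. rewrite eta_zeta_right by (auto; lra). unfold Im; simpl. ring. }
  destruct (eta_zeta zeta (1 / 2, t)) as [a b]. unfold Re, Im in *; cbn [fst snd] in *.
  f_equal; lra.
Qed.

Definition dpoly (q : R -> R) (N : nat) : R :=
  sum_f_R0 (fun n => (-1) ^ n * lterm q (1 / 2) n) N.

Lemma eta_zeta_approx (zeta : C -> C) (t : R) (M : nat) :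
  is_riemann_zeta zeta -> (2 <= M)%nat -> 0 < t <= INR M ->
  Rabs (Re (eta_zeta zeta (1 / 2, t)) - dpoly (qcos t) (4 * M - 1)) <= / sqrt (INR M) /\
  Rabs (Im (eta_zeta zeta (1 / 2, t)) - dpoly (qsin t) (4 * M - 1)) <= / sqrt (INR M).
Proof.
  intros Hzeta HM Ht. rewrite eta_zeta_half by (auto; lra). unfold Re, Im; cbn [fst snd].
  assert (H : forall q, bounded_lipschitz q (Rabs t) ->
    Rabs (avgsum (lterm q (1 / 2)) (4 * M)) <= / sqrt (INR M) ->
    Rabs (eta q (1 / 2) - dpoly q (4 * M - 1)) <= / sqrt (INR M)).
  { intros q Hq Hb. rewrite eta_avgsum, (avgsum_split _ (4 * M - 1)).
    - unfold dpoly. replace (S (4 * M - 1)) with (4 * M)%nat by lia.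
      match goal with |- Rabs (?x + ?y - ?x) <= _ => replace (x + y - x) with y by ring end.
      now rewrite Rabs_pow_m1.
    - apply (ex_series_Rabs_lpair q (Rabs t)); auto; lra. }
  split.
  - apply H; [apply qcos_bounded_lipschitz |].
    apply (avgsum_cpow_bound Re (1 / 2, t) M); auto.
    + intros z; apply re_le_Cmod.
    + simpl; lra.
    + apply (ex_series_Rabs_lpair (qcos t) (Rabs t) (1 / 2)); [apply qcos_bounded_lipschitz | lra].
  - apply H; [apply qsin_bounded_lipschitz |].
    apply (avgsum_cpow_bound Im (1 / 2, t) M); auto.
    + intros z. apply Rle_trans with (2 := Rmax_Cmod z). apply Rmax_r.
    + simpl; lra.
    + apply (ex_series_Rabs_lpair (qsin t) (Rabs t) (1 / 2)); [apply qsin_bounded_lipschitz | lra].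
Qed.

(** * Mean squares *)

Lemma ex_RInt_cont (f : R -> R) (a b : R) : (forall t, continuous f t) -> ex_RInt f a b.
Proof. intros H. apply @ex_RInt_continuous. auto. Qed.

Lemma RInt_Rscal (f : R -> R) (c a b : R) :
  ex_RInt f a b -> RInt (fun t => c * f t) a b = c * RInt f a b.
Proof. exact (RInt_scal f a b c). Qed.

Lemma RInt_Rplus (f g : R -> R) (a b : R) :
  ex_RInt f a b -> ex_RInt g a b -> RInt (fun t => f t + g t) a b = RInt f a b + RInt g a b.
Proof. exact (RInt_plus f g a b). Qed.

Lemma RInt_Rconst (c a b : R) : RInt (fun _ => c) a b = (b - a) * c.
Proof. exact (RInt_const a b c). Qed.

Lemma continuous_sum_f_R0 (f : nat -> R -> R) (N : nat) (t : R) :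
  (forall n, continuous (f n) t) -> continuous (fun t => sum_f_R0 (fun n => f n t) N) t.
Proof.
  intros H. induction N as [|N IH]; simpl; auto.
  apply (continuous_plus (fun t => sum_f_R0 (fun n => f n t) N)); auto.
Qed.

Lemma RInt_sum_f_R0 (f : nat -> R -> R) (N : nat) (a b : R) :
  (forall n t, continuous (f n) t) ->
  RInt (fun t => sum_f_R0 (fun n => f n t) N) a b = sum_f_R0 (fun n => RInt (f n) a b) N.
Proof.
  intros H. induction N as [|N IH]; simpl; [reflexivity |].
  rewrite <- IH. apply (RInt_plus (fun t => sum_f_R0 (fun n => f n t) N) (f (S N))).
  - apply ex_RInt_cont. intros t. now apply continuous_sum_f_R0.
  - now apply ex_RInt_cont.
Qed.

Lemma continuous_cos_mul (l t : R) : continuous (fun t => cos (t * l)) t.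
Proof. apply @ex_derive_continuous. auto_derive. auto. Qed.

Lemma RInt_cos_mul (l a b : R) : l <> 0 ->
  RInt (fun t => cos (t * l)) a b = (sin (b * l) - sin (a * l)) / l.
Proof.
  intros Hl. apply is_RInt_unique.
  replace ((sin (b * l) - sin (a * l)) / l) with (sin (b * l) / l - sin (a * l) / l) by (field; auto).
  apply (is_RInt_derive (fun t => sin (t * l) / l) (fun t => cos (t * l))).
  - intros t _. auto_derive; [auto | field; auto].
  - intros t _. apply continuous_cos_mul.
Qed.

Lemma Rabs_sin_le (x : R) : Rabs (sin x) <= 1.
Proof. apply Rabs_le. pose proof (SIN_bound x). lra. Qed.

Lemma RInt_cos_mul_bound (l a b : R) : 0 < l -> Rabs (RInt (fun t => cos (t * l)) a b) <= 2 / l.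
Proof.
  intros Hl. rewrite RInt_cos_mul by lra. unfold Rdiv. rewrite Rabs_mult.
  assert (0 < / l) by now apply Rinv_0_lt_compat.
  rewrite (Rabs_pos_eq (/ l)) by lra. apply Rmult_le_compat_r; [lra |].
  unfold Rminus. eapply Rle_trans; [apply Rabs_triang |]. rewrite Rabs_Ropp.
  pose proof (Rabs_sin_le (b * l)). pose proof (Rabs_sin_le (a * l)). lra.
Qed.

Lemma RInt_cos_mul_bound0 (l b : R) : 0 < l -> Rabs (RInt (fun t => cos (t * l)) 0 b) <= / l.
Proof.
  intros Hl. rewrite RInt_cos_mul by lra. rewrite Rmult_0_l, sin_0, Rminus_0_r.
  unfold Rdiv. rewrite Rabs_mult.
  assert (0 < / l) by now apply Rinv_0_lt_compat.
  rewrite (Rabs_pos_eq (/ l)) by lra. pose proof (Rabs_sin_le (b * l)). nra.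
Qed.

Definition inv_sqrt_S (n : nat) : R := / sqrt (INR (S n)).

Lemma inv_sqrt_S_pos (n : nat) : 0 < inv_sqrt_S n.
Proof. apply Rinv_0_lt_compat, sqrt_lt_R0, INR_S_pos. Qed.

Lemma inv_sqrt_S_0 : inv_sqrt_S 0 = 1.
Proof. unfold inv_sqrt_S. simpl. rewrite sqrt_1. field. Qed.

Lemma lterm_half (q : R -> R) (n : nat) : lterm q (1 / 2) n = q (lnS n) * inv_sqrt_S n.
Proof.
  unfold lterm, inv_sqrt_S. rewrite <- exp_half_ln by apply INR_S_pos. reflexivity.
Qed.

Lemma sum_inv_sqrt_S (N : nat) : sum_f_R0 inv_sqrt_S N <= 2 * sqrt (INR (S N)).
Proof.
  induction N as [|N IH].
  - simpl. rewrite inv_sqrt_S_0, sqrt_1. lra.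
  - simpl sum_f_R0. apply Rle_trans with (2 * sqrt (INR (S N)) + inv_sqrt_S (S N)); [lra |].
    unfold inv_sqrt_S. rewrite (S_INR (S N)). set (x := INR (S N)).
    assert (Hx : 0 < x) by apply INR_S_pos.
    set (u := sqrt x). set (v := sqrt (x + 1)).
    assert (Hu : u * u = x) by (apply sqrt_sqrt; lra).
    assert (Hv : v * v = x + 1) by (apply sqrt_sqrt; lra).
    assert (Hu0 : 0 < u) by (apply sqrt_lt_R0; lra).
    assert (Hv0 : 0 < v) by (apply sqrt_lt_R0; lra).
    apply Rmult_le_reg_r with v; auto. rewrite Rmult_plus_distr_r, Rinv_l by lra.
    nra.
Qed.

Lemma dpoly_bound (q : R -> R) (N : nat) : (forall v, Rabs (q v) <= 1) ->
  Rabs (dpoly q N) <= 2 * sqrt (INR (S N)).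
Proof.
  intros Hq. eapply Rle_trans; [| apply sum_inv_sqrt_S]. unfold dpoly.
  eapply Rle_trans; [apply Rsum_abs |]. apply sum_Rle. intros n _.
  rewrite Rabs_pow_m1, lterm_half, Rabs_mult.
  pose proof (inv_sqrt_S_pos n). rewrite (Rabs_pos_eq (inv_sqrt_S n)) by lra.
  specialize (Hq (lnS n)). nra.
Qed.

Lemma continuous_dpoly_cos (N : nat) (t : R) : continuous (fun t => dpoly (qcos t) N) t.
Proof.
  apply (continuous_sum_f_R0 (fun n t => (-1) ^ n * lterm (qcos t) (1 / 2) n)).
  intros n. unfold lterm, qcos. apply @ex_derive_continuous. auto_derive. auto.
Qed.

Lemma continuous_dpoly_sin (N : nat) (t : R) : continuous (fun t => dpoly (qsin t) N) t.
Proof.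
  apply (continuous_sum_f_R0 (fun n t => (-1) ^ n * lterm (qsin t) (1 / 2) n)).
  intros n. unfold lterm, qsin. apply @ex_derive_continuous. auto_derive. auto.
Qed.

Lemma ln_2_ge : / 2 <= ln 2.
Proof. pose proof ln_lt_2. lra. Qed.

Lemma lnS_ge (n : nat) : / 2 <= lnS (S n).
Proof.
  apply Rle_trans with (ln 2); [apply ln_2_ge |]. apply ln_le; [lra |]. apply (le_INR 2); lia.
Qed.

(** The term for the integer [1] is constant and yields [b - a]. Every other term oscillates with
    frequency at least [ln 2 >= 1/2], so its integral is at most [4] times its coefficient. *)
Lemma RInt_dpoly_cos (N : nat) (a b : R) :
  Rabs (RInt (fun t => dpoly (qcos t) N) a b - (b - a)) <= 8 * sqrt (INR (S N)).
Proof.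
  unfold dpoly.
  assert (Hc : forall n t, continuous (fun t => (-1) ^ n * lterm (qcos t) (1 / 2) n) t).
  { intros n t. unfold lterm, qcos. apply @ex_derive_continuous. auto_derive. auto. }
  rewrite (RInt_sum_f_R0 (fun n t => (-1) ^ n * lterm (qcos t) (1 / 2) n)) by exact Hc.
  assert (HI : forall n, RInt (fun t => (-1) ^ n * lterm (qcos t) (1 / 2) n) a b =
     (-1) ^ n * (inv_sqrt_S n * RInt (fun t => cos (t * lnS n)) a b)).
  { intros n.
    rewrite (RInt_ext _ (fun t => ((-1) ^ n * inv_sqrt_S n) * cos (t * lnS n)))
      by (intros t _; rewrite lterm_half; unfold qcos; real_eq; ring).
    rewrite <- Rmult_assoc. apply (RInt_scal (fun t => cos (t * lnS n)) a b).
    apply ex_RInt_cont. intros t. apply continuous_cos_mul. }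
  assert (Hind : Rabs (sum_f_R0 (fun n => RInt (fun t => (-1) ^ n * lterm (qcos t) (1 / 2) n) a b) N
      - (b - a)) <= 4 * sum_f_R0 inv_sqrt_S N).
  { induction N as [|N IH].
    - cbn [sum_f_R0]. rewrite HI, lnS_0, inv_sqrt_S_0. simpl pow.
      rewrite (RInt_ext _ (fun _ => 1)) by (intros t _; now rewrite Rmult_0_r, cos_0).
      rewrite RInt_Rconst.
      replace (1 * (1 * ((b - a) * 1)) - (b - a)) with 0 by ring. rewrite Rabs_R0. lra.
    - cbn [sum_f_R0].
      match goal with |- Rabs (?x + ?y - ?z) <= _ => replace (x + y - z) with (x - z + y) by ring end.
      eapply Rle_trans; [apply Rabs_triang |]. rewrite Rmult_plus_distr_l.
      apply Rplus_le_compat; auto. rewrite HI, Rabs_pow_m1, Rabs_mult.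
      pose proof (inv_sqrt_S_pos (S N)). rewrite (Rabs_pos_eq (inv_sqrt_S (S N))) by lra.
      rewrite Rmult_comm. apply Rmult_le_compat_r; [lra |].
      pose proof (lnS_ge N) as Hl.
      eapply Rle_trans; [apply RInt_cos_mul_bound; lra |].
      apply Rmult_le_reg_r with (lnS (S N)); [lra |].
      unfold Rdiv. rewrite Rmult_assoc, Rinv_l; lra. }
  eapply Rle_trans; [exact Hind |]. pose proof (sum_inv_sqrt_S N). lra.
Qed.

Definition dpoly_sq (N : nat) (t : R) : R := dpoly (qcos t) N ^ 2 + dpoly (qsin t) N ^ 2.

Lemma continuous_dpoly_sq (N : nat) (t : R) : continuous (dpoly_sq N) t.
Proof.
  unfold dpoly_sq.
  apply (continuous_ext (fun t => dpoly (qcos t) N * dpoly (qcos t) N + dpoly (qsin t) N * dpoly (qsin t) N)).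
  { intros y. simpl. ring. }
  apply (continuous_plus (fun t => dpoly (qcos t) N * dpoly (qcos t) N)).
  - apply (continuous_mult (fun t => dpoly (qcos t) N)); apply continuous_dpoly_cos.
  - apply (continuous_mult (fun t => dpoly (qsin t) N)); apply continuous_dpoly_sin.
Qed.

(** The expansion of [|D + z|^2] for the polynomial [D] and the new term [z]. The cross terms are
    pure cosines with the nonzero frequencies [lnS (S N) - lnS n], so they integrate to bounded
    quantities. *)
Lemma dpoly_sq_succ (N : nat) (t : R) :
  dpoly_sq (S N) t = dpoly_sq N t + inv_sqrt_S (S N) ^ 2 + 2 * (-1) ^ S N * inv_sqrt_S (S N) *
    sum_f_R0 (fun n => (-1) ^ n * inv_sqrt_S n * cos (t * (lnS (S N) - lnS n))) N.
Proof.
  unfold dpoly_sq, dpoly. rewrite !tech5.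
  set (A := sum_f_R0 (fun n => (-1) ^ n * lterm (qcos t) (1 / 2) n) N).
  set (B := sum_f_R0 (fun n => (-1) ^ n * lterm (qsin t) (1 / 2) n) N).
  rewrite !lterm_half. unfold qcos at 1, qsin at 1. set (l := lnS (S N)).
  assert (E : sum_f_R0 (fun n => (-1) ^ n * inv_sqrt_S n * cos (t * (l - lnS n))) N
     = A * cos (t * l) - B * sin (t * l)).
  { unfold A, B. rewrite (Rmult_comm _ (cos (t * l))), (Rmult_comm _ (sin (t * l))).
    rewrite !scal_sum, <- minus_sum. apply sum_eq. intros n _.
    rewrite !lterm_half. unfold qcos, qsin.
    rewrite Rmult_minus_distr_l, cos_minus. ring. }
  rewrite E. set (e := (-1) ^ S N).
  assert (He : e * e = 1).
  { unfold e. rewrite <- pow_add. replace (S N + S N)%nat with (2 * S N)%nat by lia. apply pow_1_even. }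
  pose proof (sin2_cos2 (t * l)) as Hsc. unfold Rsqr in Hsc.
  replace ((A + e * (cos (t * l) * inv_sqrt_S (S N))) ^ 2 + (B + e * (- sin (t * l) * inv_sqrt_S (S N))) ^ 2)
    with (A ^ 2 + B ^ 2 + (e * e) * (sin (t * l) * sin (t * l) + cos (t * l) * cos (t * l)) * inv_sqrt_S (S N) ^ 2
      + 2 * e * inv_sqrt_S (S N) * (A * cos (t * l) - B * sin (t * l))) by ring.
  rewrite He, Hsc. ring.
Qed.

Lemma ln_ratio_ge (x y : R) : 0 < x -> x < y -> (y - x) / y <= ln y - ln x.
Proof.
  intros Hx Hy. rewrite <- ln_div by lra.
  pose proof (exp_ineq1_le (- ln (y / x))) as H.
  assert (0 < y / x) by (apply Rmult_lt_0_compat; [lra | now apply Rinv_0_lt_compat]).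
  rewrite exp_Ropp, exp_ln in H by auto.
  replace (/ (y / x)) with (1 - (y - x) / y) in H by (field; lra). lra.
Qed.

Lemma harmonic_rev (N : nat) : sum_f_R0 (fun n => / INR (S N - n)) N <= 1 + lnS N.
Proof.
  induction N as [|N IH].
  - simpl. rewrite lnS_0, Rinv_1. lra.
  - rewrite decomp_sum by lia. change (pred (S N)) with N. rewrite Nat.sub_0_r.
    rewrite (sum_eq (fun i => / INR (S (S N) - S i)) (fun n => / INR (S N - n)) N) by reflexivity.
    assert (/ INR (S (S N)) <= lnS (S N) - lnS N).
    { unfold lnS. replace (/ INR (S (S N))) with ((INR (S (S N)) - INR (S N)) / INR (S (S N))).
      - apply ln_ratio_ge; [apply INR_S_pos |]. apply lt_INR; lia.
      - rewrite (S_INR (S N)). pose proof (INR_S_pos N). field. lra. }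
    lra.
Qed.

(** With [p = N + 2] and [m = n + 1], the inverse of [ln (p / m)] is at most
    [p / (p - m) = 1 + m / (p - m)]. The first part keeps the product of the coefficients; in the
    second the square roots combine to [sqrt (m / p) <= 1]. *)
Lemma cross_term_bound (N n : nat) : (n <= N)%nat ->
  inv_sqrt_S (S N) * inv_sqrt_S n * / (lnS (S N) - lnS n) <= inv_sqrt_S (S N) * inv_sqrt_S n + / INR (S N - n).
Proof.
  intros Hn. set (p := INR (S (S N))). set (m := INR (S n)).
  assert (Hm : 0 < m) by apply INR_S_pos.
  assert (Hmp : m < p) by (apply lt_INR; lia).
  assert (Hd : INR (S N - n) = p - m).
  { unfold p, m. rewrite <- minus_INR by lia. reflexivity. }
  rewrite Hd. unfold inv_sqrt_S. fold p m.
  set (u := sqrt p). set (v := sqrt m).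
  assert (Hu : u * u = p) by (apply sqrt_sqrt; lra).
  assert (Hv : v * v = m) by (apply sqrt_sqrt; lra).
  assert (Hv0 : 0 < v) by (apply sqrt_lt_R0; lra).
  assert (Huv : v <= u) by (apply sqrt_le_1_alt; lra).
  pose proof (ln_ratio_ge m p Hm Hmp) as Hl. fold (lnS (S N)) (lnS n) in *.
  change (ln p) with (lnS (S N)) in Hl. change (ln m) with (lnS n) in Hl.
  assert (Hr : 0 < (p - m) / p) by (apply Rmult_lt_0_compat; [lra | apply Rinv_0_lt_compat; lra]).
  apply Rle_trans with (/ u * / v * / ((p - m) / p)).
  - apply Rmult_le_compat_l.
    + apply Rmult_le_pos; apply Rlt_le, Rinv_0_lt_compat; lra.
    + apply Rinv_le_contravar; auto.
  - replace (/ ((p - m) / p)) with (1 + m / (p - m)) by (field; lra).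
    rewrite Rmult_plus_distr_l, Rmult_1_r. apply Rplus_le_compat_l.
    replace (/ u * / v * (m / (p - m))) with ((v / u) * / (p - m)) by (rewrite <- Hv; field; lra).
    rewrite <- (Rmult_1_l (/ (p - m))) at 2. apply Rmult_le_compat_r.
    + apply Rlt_le, Rinv_0_lt_compat; lra.
    + apply Rmult_le_reg_r with u; [lra |]. unfold Rdiv. rewrite Rmult_assoc, Rinv_l; lra.
Qed.

(** Induction adds one term at a time. The new diagonal term [X / (N + 2)] is paid by the growth of
    [lnS], and the cross terms, at most [2 * (3 + lnS (S N))], by the growth of [2 * INR N]. *)
Lemma dpoly_mean_square (N : nat) (X : R) : 0 <= X ->
  RInt (dpoly_sq N) 0 X <= (X + 2 * INR N) * (3 + lnS N).
Proof.
  intros HX. induction N as [|N IH].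
  - rewrite (RInt_ext _ (fun _ => 1)).
    + rewrite RInt_Rconst, lnS_0. simpl. lra.
    + intros t _. unfold dpoly_sq, dpoly. simpl sum_f_R0. rewrite !lterm_half, inv_sqrt_S_0, lnS_0.
      unfold qcos, qsin. rewrite Rmult_0_r, cos_0, sin_0. simpl. real_eq. ring.
  - set (h := fun n t => (-1) ^ n * inv_sqrt_S n * cos (t * (lnS (S N) - lnS n))).
    assert (Hh : forall n t, continuous (h n) t).
    { intros n t. unfold h. apply @ex_derive_continuous. auto_derive. auto. }
    assert (Hhs : forall t, continuous (fun t => sum_f_R0 (fun n => h n t) N) t)
      by (intros t; apply continuous_sum_f_R0; auto).
    rewrite (RInt_ext _ (fun t => (dpoly_sq N t + inv_sqrt_S (S N) ^ 2) +
      (2 * (-1) ^ S N * inv_sqrt_S (S N)) * sum_f_R0 (fun n => h n t) N))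
      by (intros t _; rewrite dpoly_sq_succ; reflexivity).
    assert (E : RInt (fun t => (dpoly_sq N t + inv_sqrt_S (S N) ^ 2) +
      (2 * (-1) ^ S N * inv_sqrt_S (S N)) * sum_f_R0 (fun n => h n t) N) 0 X
      = RInt (dpoly_sq N) 0 X + X * inv_sqrt_S (S N) ^ 2
        + (2 * (-1) ^ S N * inv_sqrt_S (S N)) * sum_f_R0 (fun n => RInt (h n) 0 X) N).
    { rewrite <- (RInt_sum_f_R0 h) by auto.
      rewrite (RInt_Rplus (fun t => dpoly_sq N t + inv_sqrt_S (S N) ^ 2)
        (fun t => (2 * (-1) ^ S N * inv_sqrt_S (S N)) * sum_f_R0 (fun n => h n t) N)).
      - rewrite (RInt_Rplus (dpoly_sq N) (fun _ => inv_sqrt_S (S N) ^ 2)).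
        + rewrite RInt_Rconst.
          rewrite (RInt_Rscal (fun t => sum_f_R0 (fun n => h n t) N)) by (apply ex_RInt_cont; auto).
          real_eq. ring.
        + apply ex_RInt_cont, continuous_dpoly_sq.
        + apply ex_RInt_cont. intros t; apply continuous_const.
      - apply ex_RInt_cont. intros t.
        apply (continuous_plus (dpoly_sq N)); [apply continuous_dpoly_sq | apply continuous_const].
      - apply ex_RInt_cont. intros t.
        apply (continuous_mult (fun _ => 2 * (-1) ^ S N * inv_sqrt_S (S N))); [apply continuous_const | auto]. }
    rewrite E. clear E.
    assert (Hcross : inv_sqrt_S (S N) * Rabs (sum_f_R0 (fun n => RInt (h n) 0 X) N) <= 3 + lnS (S N)).
    { pose proof (inv_sqrt_S_pos (S N)) as Hi.
      apply Rle_trans with (sum_f_R0 (fun n => inv_sqrt_S (S N) * inv_sqrt_S n + / INR (S N - n)) N).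
      - apply Rle_trans with (inv_sqrt_S (S N) * sum_f_R0 (fun n => Rabs (RInt (h n) 0 X)) N).
        { apply Rmult_le_compat_l; [lra | apply Rsum_abs]. }
        rewrite scal_sum. apply sum_Rle. intros n Hn.
        eapply Rle_trans; [| now apply cross_term_bound].
        rewrite (Rmult_comm _ (inv_sqrt_S (S N))), Rmult_assoc. apply Rmult_le_compat_l; [lra |].
        unfold h.
        rewrite (RInt_Rscal (fun t => cos (t * (lnS (S N) - lnS n))))
          by (apply ex_RInt_cont; intros t; apply continuous_cos_mul).
        rewrite Rmult_assoc, Rabs_pow_m1, Rabs_mult.
        pose proof (inv_sqrt_S_pos n). rewrite (Rabs_pos_eq (inv_sqrt_S n)) by lra.
        apply Rmult_le_compat_l; [lra |]. apply RInt_cos_mul_bound0.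
        assert (ln (INR (S n)) < ln (INR (S (S N)))) by (apply ln_increasing; [apply INR_S_pos | apply lt_INR; lia]).
        unfold lnS. lra.
      - rewrite plus_sum.
        assert (H1 : sum_f_R0 (fun n => inv_sqrt_S (S N) * inv_sqrt_S n) N <= 2).
        { rewrite (sum_eq _ (fun n => inv_sqrt_S n * inv_sqrt_S (S N))) by (intros; ring).
          rewrite <- scal_sum. apply Rle_trans with (inv_sqrt_S (S N) * (2 * sqrt (INR (S (S N))))).
          - apply Rmult_le_compat_l; [lra |]. eapply Rle_trans; [apply sum_inv_sqrt_S |].
            apply Rmult_le_compat_l; [lra |]. apply sqrt_le_1_alt, le_INR. lia.
          - unfold inv_sqrt_S. right. field. apply Rgt_not_eq, sqrt_lt_R0, INR_S_pos. }
        pose proof (harmonic_rev N). pose proof (lnS_step N). lra. }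
    set (Sg := sum_f_R0 (fun n => RInt (h n) 0 X) N) in *.
    assert (Hc2 : 2 * (-1) ^ S N * inv_sqrt_S (S N) * Sg <= 2 * (3 + lnS (S N))).
    { apply Rle_trans with (Rabs (2 * (-1) ^ S N * inv_sqrt_S (S N) * Sg)); [apply Rle_abs |].
      replace (2 * (-1) ^ S N * inv_sqrt_S (S N) * Sg) with ((-1) ^ S N * (2 * (inv_sqrt_S (S N) * Sg))) by ring.
      rewrite Rabs_pow_m1, !Rabs_mult. pose proof (inv_sqrt_S_pos (S N)).
      rewrite (Rabs_pos_eq 2), (Rabs_pos_eq (inv_sqrt_S (S N))) by lra. lra. }
    assert (Hi2 : inv_sqrt_S (S N) ^ 2 <= lnS (S N) - lnS N).
    { unfold inv_sqrt_S. rewrite pow_inv. rewrite <- Rsqr_pow2, Rsqr_sqrt by (apply Rlt_le, INR_S_pos).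
      unfold lnS. replace (/ INR (S (S N))) with ((INR (S (S N)) - INR (S N)) / INR (S (S N))).
      - apply ln_ratio_ge; [apply INR_S_pos |]. apply lt_INR; lia.
      - rewrite (S_INR (S N)). pose proof (INR_S_pos N). field. lra. }
    pose proof (lnS_step N). pose proof (pos_INR N). rewrite (S_INR N). nra.
Qed.

Lemma hardyZ2_nonneg (zeta : C -> C) (t : R) : 0 <= hardyZ2 zeta t.
Proof. apply pow_le, Cmod_ge_0. Qed.

(** On the critical line [2^(1-s)] has modulus [sqrt 2], so the modulus of [1 - 2^(1-s)] lies
    between [sqrt 2 - 1] and [sqrt 2 + 1], whose squares lie in [[1/6, 6]]. *)
Lemma eta_zeta_sq (zeta : C -> C) (t : R) :
  hardyZ2 zeta t <= 6 * (Re (eta_zeta zeta (1 / 2, t)) ^ 2 + Im (eta_zeta zeta (1 / 2, t)) ^ 2) /\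
  Re (eta_zeta zeta (1 / 2, t)) ^ 2 + Im (eta_zeta zeta (1 / 2, t)) ^ 2 <= 6 * hardyZ2 zeta t.
Proof.
  set (c := Cmod (1 - 2 * cpow ((1 / 2)%R, t) 2)%C).
  assert (E : Re (eta_zeta zeta (1 / 2, t)) ^ 2 + Im (eta_zeta zeta (1 / 2, t)) ^ 2
     = c ^ 2 * hardyZ2 zeta t).
  { unfold hardyZ2, zeta_half. rewrite <- Rpow_mult_distr. unfold c. rewrite <- Cmod_mult.
    change ((1 - 2 * cpow ((1 / 2)%R, t) 2) * zeta ((1 / 2)%R, t))%C with (eta_zeta zeta ((1 / 2)%R, t)).
    rewrite <- !Rsqr_pow2. unfold Rsqr. rewrite <- Cmod_sqr. reflexivity. }
  assert (Hm : Cmod (2 * cpow ((1 / 2)%R, t) 2)%C = sqrt 2).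
  { rewrite Cmod_mult, Cmod_R, Cmod_cpow, Rabs_pos_eq by lra. unfold Re; cbn [fst].
    rewrite exp_half_ln by lra. rewrite <- (sqrt_sqrt 2) at 1 by lra. field.
    apply Rgt_not_eq, sqrt_lt_R0; lra. }
  assert (H2 : sqrt 2 * sqrt 2 = 2) by (apply sqrt_sqrt; lra).
  pose proof (sqrt_pos 2) as Hs.
  assert (Hu : c <= 1 + sqrt 2).
  { unfold c, Cminus. eapply Rle_trans; [apply Cmod_triangle |].
    rewrite Cmod_opp, Hm, Cmod_1. lra. }
  assert (Hl : sqrt 2 - 1 <= c).
  { assert (H : Cmod (2 * cpow ((1 / 2)%R, t) 2)%C <= c + Cmod 1).
    { replace (2 * cpow ((1 / 2)%R, t) 2)%C with (- (1 - 2 * cpow ((1 / 2)%R, t) 2) + 1)%C at 1 by ring.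
      eapply Rle_trans; [apply Cmod_triangle |]. rewrite Cmod_opp. apply Rle_refl. }
    rewrite Hm, Cmod_1 in H. lra. }
  rewrite E. pose proof (hardyZ2_nonneg zeta t) as Hw.
  assert (H14 : 1.414 <= sqrt 2 <= 1.415) by (split; nra).
  assert (/ 6 <= c ^ 2 <= 6) by (simpl; split; nra).
  split; nra.
Qed.

Lemma nat_between (t : R) : 0 <= t -> exists M : nat, (2 <= M)%nat /\ t <= INR M <= t + 2 /\ (4 <= t -> 4 <= INR M).
Proof.
  intros Ht. destruct (nfloor_ex t Ht) as [n Hn]. exists (n + 2)%nat.
  rewrite plus_INR. simpl (INR 2). split; [lia |]. lra.
Qed.

(** The interface between zeta and the ladder: the analysis of the ladder equation uses [Z^2] only
    through these properties. The pointwise bound serves to discard what happens near [t = mu x].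
    The square-root threshold in [msd_lower] reflects the error term of [RInt_dpoly_cos]. *)
Record mean_square_density (w : R -> R) : Prop := {
  msd_continuous : forall t, continuous w t;
  msd_nonneg : forall t, 0 <= w t;
  msd_pointwise : forall t, 0 < t -> w t <= 400 * (t + 2);
  msd_upper : forall T, 3 <= T -> RInt w 0 T <= 2000 * T * ln T;
  msd_lower : forall a b, 0 <= a -> 4 <= b -> 128 * sqrt (b + 2) <= b - a ->
    (b - a) / 48 <= RInt w a b
}.

Lemma sq_close (x y e : R) : Rabs (x - y) <= e -> x ^ 2 <= 2 * y ^ 2 + 2 * e ^ 2.
Proof.
  intros H. apply Rabs_le_between in H.
  assert ((x - y) ^ 2 <= e ^ 2) by (simpl; nra). 
  pose proof (pow2_ge_0 (x - 2 * y)). simpl in *. nra.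
Qed.

Lemma hardyZ2_le_dpoly (zeta : C -> C) (t : R) (M : nat) :
  is_riemann_zeta zeta -> (2 <= M)%nat -> 0 < t <= INR M ->
  hardyZ2 zeta t <= 12 * dpoly_sq (4 * M - 1) t + 24 / INR M.
Proof.
  intros Hz HM Ht.
  destruct (eta_zeta_approx zeta t M Hz HM Ht) as [H1 H2].
  apply sq_close in H1. apply sq_close in H2.
  assert (HM0 : 0 < INR M) by (apply lt_0_INR; lia).
  rewrite pow_inv, pow2_sqrt in H1, H2 by lra.
  pose proof (proj1 (eta_zeta_sq zeta t)). unfold dpoly_sq, Rdiv. lra.
Qed.

Lemma RInt_mono (f g : R -> R) (a b : R) : a <= b ->
  (forall t, continuous f t) -> (forall t, continuous g t) ->
  (forall t, a < t < b -> f t <= g t) -> RInt f a b <= RInt g a b.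
Proof. intros. apply RInt_le; auto; now apply ex_RInt_cont. Qed.

Lemma RInt_nonneg (w : R -> R) (a b : R) : a <= b ->
  (forall t, continuous w t) -> (forall t, 0 <= w t) -> 0 <= RInt w a b.
Proof. intros. apply RInt_ge_0; auto. now apply ex_RInt_cont. Qed.

Lemma RInt_split (w : R -> R) (a b c : R) : (forall t, continuous w t) ->
  RInt w a b + RInt w b c = RInt w a c.
Proof. intros H. apply (RInt_Chasles w a b c); now apply ex_RInt_cont. Qed.

Lemma INR_4M (M : nat) : (2 <= M)%nat -> INR (S (4 * M - 1)) = 4 * INR M.
Proof.
  intros H. replace (S (4 * M - 1)) with (4 * M)%nat by lia. rewrite mult_INR. simpl. lra.
Qed.

Lemma hardyZ2_mean_square (zeta : C -> C) :
  is_riemann_zeta zeta -> mean_square_density (hardyZ2 zeta).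
Proof.
  intros Hz.
  assert (Hc : forall t, continuous (hardyZ2 zeta) t) by (intros t; now apply hardyZ2_continuous).
  assert (Hn : forall t, 0 <= hardyZ2 zeta t) by apply hardyZ2_nonneg.
  split; auto.
  - intros t Ht. destruct (nat_between t) as (M & HM & HMt & _); [lra |].
    eapply Rle_trans; [apply (hardyZ2_le_dpoly zeta t M); auto; lra |].
    assert (HM2 : 2 <= INR M) by (apply (le_INR 2); lia).
    assert (Hsq : forall q, (forall v, Rabs (q v) <= 1) -> dpoly q (4 * M - 1) ^ 2 <= 16 * INR M).
    { intros q Hq. pose proof (dpoly_bound q (4 * M - 1) Hq) as Hb. rewrite INR_4M in Hb by auto.
      assert (Hs : sqrt (4 * INR M) * sqrt (4 * INR M) = 4 * INR M) by (apply sqrt_sqrt; lra).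
      pose proof (sqrt_pos (4 * INR M)). apply Rabs_le_between in Hb.
      set (x := dpoly q (4 * M - 1)) in *. replace (x ^ 2) with (x * x) by ring. nra. }
    unfold dpoly_sq.
    pose proof (Hsq (qcos t) (proj1 (qcos_bounded_lipschitz t))). pose proof (Hsq (qsin t) (proj1 (qsin_bounded_lipschitz t))).
    assert (24 / INR M <= 12).
    { apply Rmult_le_reg_r with (INR M); [lra |]. unfold Rdiv. rewrite Rmult_assoc, Rinv_l; lra. }
    lra.
  (* As [INR M >= T], one polynomial of length [4 M] approximates on the whole of [(0, T]]. *)
  - intros T HT. destruct (nat_between T) as (M & HM & HMT & _); [lra |].
    assert (HM2 : 2 <= INR M) by (apply (le_INR 2); lia).
    assert (H1 : RInt (hardyZ2 zeta) 0 T <= RInt (hardyZ2 zeta) 0 (INR M)).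
    { rewrite <- (RInt_split (hardyZ2 zeta) 0 T (INR M) Hc).
      pose proof (RInt_nonneg (hardyZ2 zeta) T (INR M) (proj1 HMT) Hc Hn). lra. }
    assert (H2 : RInt (hardyZ2 zeta) 0 (INR M) <=
       12 * RInt (dpoly_sq (4 * M - 1)) 0 (INR M) + INR M * (24 / INR M)).
    { apply Rle_trans with (RInt (fun t => 12 * dpoly_sq (4 * M - 1) t + 24 / INR M) 0 (INR M)).
      - apply RInt_mono; [lra | exact Hc | |].
        + intros t. apply (continuous_plus (fun t => 12 * dpoly_sq (4 * M - 1) t)); [| apply continuous_const].
          apply (continuous_mult (fun _ => 12)); [apply continuous_const | apply continuous_dpoly_sq].
        + intros t Ht. apply hardyZ2_le_dpoly; auto; lra.
      - rewrite RInt_Rplus.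
        + rewrite RInt_Rscal by (apply ex_RInt_cont, continuous_dpoly_sq).
          rewrite RInt_Rconst. lra.
        + apply ex_RInt_cont. intros t.
          apply (continuous_mult (fun _ => 12)); [apply continuous_const | apply continuous_dpoly_sq].
        + apply ex_RInt_cont. intros t. apply continuous_const. }
    pose proof (dpoly_mean_square (4 * M - 1) (INR M)) as H3.
    specialize (H3 ltac:(lra)).
    assert (E : INR (4 * M - 1) = 4 * INR M - 1).
    { rewrite <- INR_4M by auto. rewrite S_INR. ring. }
    unfold lnS in H3. rewrite INR_4M, E in H3 by auto.
    assert (Hl1 : 1 <= ln T).
    { rewrite <- (ln_exp 1). apply ln_le; [apply exp_pos |]. pose proof exp_le_3. lra. }
    assert (Hl2 : ln (4 * INR M) <= 3 + ln T).
    { apply Rle_trans with (ln (8 * T)); [apply ln_le; lra |].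
      rewrite ln_mult by lra. apply Rplus_le_compat_r.
      rewrite <- (ln_exp 3). apply ln_le; [lra |].
      replace 3 with (1 + 1 + 1) by ring. rewrite !exp_plus.
      pose proof (exp_ineq1_le 1). nra. }
    assert (Hfin : 12 * ((INR M + 2 * (4 * INR M - 1)) * (3 + ln (4 * INR M))) <= 12 * ((18 * T) * (7 * ln T))).
    { apply Rmult_le_compat_l; [lra |]. 
      assert (0 <= ln (4 * INR M)) by (rewrite <- ln_1; apply ln_le; lra).
      apply Rmult_le_compat; lra. }
    replace (INR M * (24 / INR M)) with 24 in H2 by (field; lra).
    assert (T <= T * ln T) by nra. nra.
  - intros a b Ha Hb Hab. destruct (nat_between b) as (M & HM & HMb & HM4); [lra |].
    specialize (HM4 Hb).
    assert (Hs2 : 2 <= sqrt (INR M)).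
    { replace 2 with (sqrt (2 * 2)) by (apply sqrt_square; lra). apply sqrt_le_1_alt; lra. }
    assert (Hsb : sqrt (INR M) <= sqrt (b + 2)) by (apply sqrt_le_1_alt; lra).
    assert (He : / sqrt (INR M) <= / 2) by (apply Rinv_le_contravar; lra).
    pose proof (RInt_dpoly_cos (4 * M - 1) a b) as H1. rewrite INR_4M in H1 by auto.
    replace (sqrt (4 * INR M)) with (2 * sqrt (INR M)) in H1.
    2:{ rewrite sqrt_mult by lra. f_equal. replace 4 with (2 * 2) by ring. symmetry. apply sqrt_square; lra. }
    apply Rabs_le_between in H1.
    (* Linearisation of the square: with [X = Re eta], [X^2 >= X/2 - 1/16] from the square of
       [X - 1/4], and [X] exceeds the polynomial minus [1/2]. Dividing by [6] gives
       [- 1/24 - 1/96 = - 5/96]. Integration leaves [(b - a) / 32] minus at most [(b - a) / 96]. *)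
    assert (H2 : RInt (fun t => / 12 * dpoly (qcos t) (4 * M - 1) + - (5 / 96)) a b
       <= RInt (hardyZ2 zeta) a b).
    { apply RInt_mono; [lra | | exact Hc |].
      - intros t. apply (continuous_plus (fun t => / 12 * dpoly (qcos t) (4 * M - 1))); [| apply continuous_const].
        apply (continuous_mult (fun _ => / 12)); [apply continuous_const | apply continuous_dpoly_cos].
      - intros t Ht. destruct (eta_zeta_approx zeta t M Hz HM) as [H3 _]; [lra |].
        apply Rabs_le_between in H3.
        pose proof (proj2 (eta_zeta_sq zeta t)) as H4.
        set (X := Re (eta_zeta zeta (1 / 2, t))) in *.
        pose proof (pow2_ge_0 (Im (eta_zeta zeta (1 / 2, t)))).
        pose proof (pow2_ge_0 (X - 1 / 4)).
        assert (X / 2 - / 16 <= X ^ 2) by (simpl in *; lra). lra. }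
    rewrite RInt_Rplus in H2.
    + rewrite RInt_Rscal, RInt_Rconst in H2 by (apply ex_RInt_cont, continuous_dpoly_cos). lra.
    + apply ex_RInt_cont. intros t.
      apply (continuous_mult (fun _ => / 12)); [apply continuous_const | apply continuous_dpoly_cos].
    + apply ex_RInt_cont. intros t. apply continuous_const.
Qed.

(** * The left-hand side of the ladder equation *)

Definition ladderInt (w : R -> R) (x : R) : R :=
  RInt (fun t => w t * exp (- (2 * t) / x)) 0 (mu x).

Definition ladderMoment (w : R -> R) (x : R) : R :=
  RInt (fun t => t * w t * exp (- (2 * t) / x)) 0 (mu x).

(** The contribution of the moving upper limit in Leibniz' rule; [7 * ln x + 7] is the derivative of
    [mu]. Since the exponential equals [x^(-14)] at [t = mu x], it is tiny. *)
Definition ladderBoundary (w : R -> R) (x : R) : R :=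
  w (mu x) * exp (- (2 * mu x) / x) * (7 * ln x + 7).

Definition dladder (w : R -> R) (x : R) : R :=
  2 / x ^ 2 * ladderMoment w x + ladderBoundary w x.

Lemma continuous_Rmult (f g : R -> R) (x : R) :
  continuous f x -> continuous g x -> continuous (fun t => f t * g t) x.
Proof. exact (continuous_mult f g x). Qed.

Lemma continuous_exp_div (x t : R) : continuous (fun t => exp (- (2 * t) / x)) t.
Proof.
  apply @ex_derive_continuous. unfold Rdiv. auto_derive. auto.
Qed.

Lemma continuous_ladder_integrand (w : R -> R) (x t : R) :
  (forall t, continuous w t) -> continuous (fun t => w t * exp (- (2 * t) / x)) t.
Proof. intros H. apply (continuous_Rmult w); [auto | apply continuous_exp_div]. Qed.

Lemma continuous_moment_integrand (w : R -> R) (x t : R) :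
  (forall t, continuous w t) -> continuous (fun t => t * w t * exp (- (2 * t) / x)) t.
Proof.
  intros H. apply (continuous_Rmult (fun t => t * w t)); [| apply continuous_exp_div].
  apply (continuous_Rmult (fun t => t)); [apply continuous_id | auto].
Qed.

Lemma is_derive_mu (x : R) : 0 < x -> is_derive mu x (7 * ln x + 7).
Proof. intros Hx. unfold mu. auto_derive; [auto | field; lra]. Qed.

Lemma is_derive_ladder_integrand (w : R -> R) (u v : R) : 0 < u ->
  is_derive (fun z => w v * exp (- (2 * v) / z)) u (w v * (exp (- (2 * v) / u) * ((2 * v) / u ^ 2))).
Proof.
  intros Hu. auto_derive; [lra |].
  change (exp (- (2 * v) * / u)) with (exp (- (2 * v) / u)). field. lra.
Qed.

Lemma continuity_2d_ladder (w : R -> R) (u v : R) : (forall t, continuous w t) -> 0 < u ->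
  continuity_2d_pt (fun u v => Derive (fun z => w v * exp (- (2 * v) / z)) u) u v.
Proof.
  intros Hw Hu.
  apply continuity_2d_pt_ext_loc with (fun u v => w v * (exp (- (2 * v) / u) * ((2 * v) / u ^ 2))).
  - exists (mkposreal u Hu). intros u' v' Hu' _. simpl in Hu'.
    symmetry. apply is_derive_unique, is_derive_ladder_integrand.
    apply Rabs_lt_between in Hu'. lra.
  - assert (Hv : continuity_2d_pt (fun u v => 2 * v) u v).
    { apply continuity_2d_pt_mult; [apply continuity_2d_pt_const | apply continuity_2d_pt_id2]. }
    apply continuity_2d_pt_mult.
    + apply (continuity_1d_2d_pt_comp w (fun u v => v)); [| apply continuity_2d_pt_id2].
      apply continuity_pt_filterlim, Hw.
    + apply continuity_2d_pt_mult.
      * apply (continuity_1d_2d_pt_comp exp (fun u v => - (2 * v) / u)).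
        { apply derivable_continuous_pt, derivable_pt_exp. }
        unfold Rdiv. apply continuity_2d_pt_mult; [apply continuity_2d_pt_opp; auto |].
        apply continuity_2d_pt_inv; [apply continuity_2d_pt_id1 | lra].
      * unfold Rdiv. apply continuity_2d_pt_mult; auto.
        apply continuity_2d_pt_inv; [| apply pow_nonzero; lra].
        apply (continuity_1d_2d_pt_comp (fun u => u ^ 2) (fun u v => u)); [| apply continuity_2d_pt_id1].
        apply derivable_continuous_pt, derivable_pt_pow.
Qed.

Lemma is_derive_ladderInt (w : R -> R) (x : R) : (forall t, continuous w t) -> 0 < x ->
  is_derive (ladderInt w) x (dladder w x).
Proof.
  intros Hw Hx.
  assert (Hex : forall y a b, ex_RInt (fun t => w t * exp (- (2 * t) / y)) a b)
    by (intros; apply ex_RInt_cont; intros t; now apply continuous_ladder_integrand).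
  assert (E : RInt (fun t => Derive (fun u => w t * exp (- (2 * t) / u)) x) 0 (mu x)
     = 2 / x ^ 2 * ladderMoment w x).
  { unfold ladderMoment. rewrite <- RInt_Rscal.
    - apply RInt_ext. intros t _.
      transitivity (w t * (exp (- (2 * t) / x) * ((2 * t) / x ^ 2))).
      + now apply is_derive_unique, is_derive_ladder_integrand.
      + real_eq. field. lra.
    - apply ex_RInt_cont. intros t. now apply continuous_moment_integrand. }
  replace (dladder w x) with
    (RInt (fun t => Derive (fun u => w t * exp (- (2 * t) / u)) x) 0 (mu x)
     + - (w 0 * exp (- (2 * 0) / x)) * 0
     + (w (mu x) * exp (- (2 * mu x) / x)) * (7 * ln x + 7))
    by (rewrite E; unfold dladder, ladderBoundary; ring).
  apply (is_derive_RInt_param_bound_comp (fun x t => w t * exp (- (2 * t) / x)) (fun _ => 0) mu x).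
  - exists (mkposreal 1 Rlt_0_1). intros; apply Hex.
  - exists (mkposreal 1 Rlt_0_1). exists (mkposreal 1 Rlt_0_1). intros; apply Hex.
  - exists (mkposreal 1 Rlt_0_1). exists (mkposreal 1 Rlt_0_1). intros; apply Hex.
  - apply @is_derive_const.
  - now apply is_derive_mu.
  - exists (mkposreal 1 Rlt_0_1). exists (mkposreal x Hx). intros y Hy t _.
    change (Rabs (y - x) < x) in Hy. apply Rabs_lt_between in Hy.
    eexists. apply is_derive_ladder_integrand. lra.
  - intros t _. now apply continuity_2d_ladder.
  - exists (mkposreal x Hx). intros u v Hu _. simpl in Hu. apply Rabs_lt_between in Hu.
    apply continuity_2d_ladder; auto. lra.
  - exists (mkposreal x Hx). intros u v Hu _. simpl in Hu. apply Rabs_lt_between in Hu.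
    apply continuity_2d_ladder; auto. lra.
  - apply continuity_pt_filterlim. now apply continuous_ladder_integrand.
  - apply continuity_pt_filterlim. now apply continuous_ladder_integrand.
Qed.

Lemma ln_ge_1 (x : R) : 3 <= x -> 1 <= ln x.
Proof.
  intros H. rewrite <- (ln_exp 1). apply ln_le; [apply exp_pos |]. pose proof exp_le_3. lra.
Qed.

Lemma ln_le_self (x : R) : 0 < x -> ln x <= x.
Proof.
  intros H. rewrite <- (ln_exp x) at 2. apply ln_le; auto.
  pose proof (exp_ineq1_le x). lra.
Qed.

Lemma mu_ge (x : R) : 3 <= x -> 7 * x <= mu x.
Proof. intros H. unfold mu. pose proof (ln_ge_1 x H). nra. Qed.

Lemma mu_le (x : R) : 3 <= x -> mu x <= 7 * x ^ 2.
Proof. intros H. unfold mu. pose proof (ln_le_self x ltac:(lra)). simpl. nra. Qed.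

Lemma mu_mono (x y : R) : 1 <= x <= y -> mu x <= mu y.
Proof.
  intros H. unfold mu. assert (ln x <= ln y) by (apply ln_le; lra).
  assert (0 <= ln x) by (rewrite <- ln_1; apply ln_le; lra).
  apply Rmult_le_compat; lra.
Qed.

Lemma exp_2_le_9 : exp 2 <= 9.
Proof.
  replace 2 with (1 + 1) by ring. rewrite exp_plus. pose proof exp_le_3. pose proof (exp_pos 1). nra.
Qed.

Lemma exp_cut (t x : R) : 0 < x -> t <= x -> / 9 <= exp (- (2 * t) / x).
Proof.
  intros Hx Ht. apply Rle_trans with (exp (Ropp 2)).
  - rewrite exp_Ropp. apply Rinv_le_contravar; [apply exp_pos | apply exp_2_le_9].
  - apply exp_mono. apply Rmult_le_reg_r with x; auto. unfold Rdiv. rewrite Rmult_assoc, Rinv_l; lra.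
Qed.

Lemma exp_le_1 (y : R) : y <= 0 -> exp y <= 1.
Proof. intros H. rewrite <- exp_0. now apply exp_mono. Qed.

Lemma exp_mu (x : R) : 0 < x -> exp (- (2 * mu x) / x) = / x ^ 14.
Proof.
  intros Hx. unfold mu. assert (E : INR 14 = 14) by (simpl; lra).
  replace (- (2 * (7 * x * ln x)) / x) with (- (INR 14 * ln x)) by (rewrite E; field; lra).
  rewrite exp_Ropp, exp_ln_INR by auto. reflexivity.
Qed.

Lemma neg_div_le_0 (t x : R) : 0 <= t -> 0 < x -> - (2 * t) / x <= 0.
Proof.
  intros Ht Hx. apply Rmult_le_reg_r with x; auto. unfold Rdiv. rewrite Rmult_assoc, Rinv_l; lra.
Qed.

Definition mean_sq (w : R -> R) (T : R) : R := RInt w 0 T.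

Lemma mean_sq_mono (w : R -> R) (a b : R) : mean_square_density w -> a <= b ->
  mean_sq w a <= mean_sq w b.
Proof.
  intros Hw H. unfold mean_sq. rewrite <- (RInt_split w 0 a b (msd_continuous w Hw)).
  pose proof (RInt_nonneg w a b H (msd_continuous w Hw) (msd_nonneg w Hw)). lra.
Qed.

(** The origin of the threshold [20000]: squaring asks for [16384 * (b + 2) <= (b - 1)^2]. *)
Lemma sqrt_threshold (a b : R) : 0 <= a <= 1 -> 20000 <= b -> 128 * sqrt (b + 2) <= b - a.
Proof.
  intros Ha Hb. apply Rsqr_incr_0_var; [| lra]. rewrite Rsqr_mult, Rsqr_sqrt by lra.
  unfold Rsqr. nra.
Qed.

Lemma mean_sq_lower (w : R -> R) (T : R) : mean_square_density w -> 20000 <= T ->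
  T / 48 <= mean_sq w T.
Proof.
  intros Hw HT. pose proof (msd_lower w Hw 0 T) as H. rewrite Rminus_0_r in H.
  apply H; try lra. pose proof (sqrt_threshold 0 T). lra.
Qed.

Lemma ladderInt_upper (w : R -> R) (x : R) : mean_square_density w -> 1 <= x ->
  ladderInt w x <= mean_sq w (mu x).
Proof.
  intros Hw Hx. pose proof (mu_mono 1 x ltac:(lra)) as H.
  replace (mu 1) with 0 in H by (unfold mu; rewrite ln_1; ring).
  apply RInt_mono; [lra | | apply Hw |].
  - intros t. apply continuous_ladder_integrand, Hw.
  - intros t Ht. pose proof (msd_nonneg w Hw t).
    pose proof (exp_le_1 _ (neg_div_le_0 t x ltac:(lra) ltac:(lra))). nra.
Qed.

Lemma ladderInt_lower (w : R -> R) (x : R) : mean_square_density w -> 3 <= x ->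
  mean_sq w x / 9 <= ladderInt w x.
Proof.
  intros Hw Hx. pose proof (mu_ge x Hx) as Hm.
  assert (Hc : forall t, continuous (fun t => w t * exp (- (2 * t) / x)) t)
    by (intros t; apply continuous_ladder_integrand, Hw).
  unfold ladderInt. rewrite <- (RInt_split (fun t => w t * exp (- (2 * t) / x)) 0 x (mu x) Hc).
  assert (0 <= RInt (fun t => w t * exp (- (2 * t) / x)) x (mu x)).
  { apply RInt_nonneg; [lra | auto |]. intros t. apply Rmult_le_pos; [apply Hw | apply Rlt_le, exp_pos]. }
  assert (RInt (fun t => / 9 * w t) 0 x <= RInt (fun t => w t * exp (- (2 * t) / x)) 0 x).
  { apply RInt_mono; [lra | | auto |].
    - intros t. apply (continuous_Rmult (fun _ => / 9)); [apply continuous_const | apply Hw].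
    - intros t Ht. pose proof (msd_nonneg w Hw t). pose proof (exp_cut t x ltac:(lra) ltac:(lra)). nra. }
  rewrite RInt_Rscal in H0 by (apply ex_RInt_cont, Hw). unfold mean_sq. lra.
Qed.

(** Far below the true size, since the factor [t] is replaced by [1] on [[1, x]]. It is enough to
    make [dladder] positive and to outweigh the boundary term and the error in
    [ladderMoment_growth]. *)
Lemma ladderMoment_lower (w : R -> R) (x : R) : mean_square_density w -> 20000 <= x ->
  x / 500 <= ladderMoment w x.
Proof.
  intros Hw Hx. pose proof (mu_ge x ltac:(lra)) as Hm.
  assert (Hc : forall t, continuous (fun t => t * w t * exp (- (2 * t) / x)) t)
    by (intros t; apply continuous_moment_integrand, Hw).
  assert (Hp : forall t, 0 <= t -> 0 <= t * w t * exp (- (2 * t) / x)).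
  { intros t Ht. pose proof (msd_nonneg w Hw t). pose proof (exp_pos (- (2 * t) / x)).
    apply Rmult_le_pos; [| lra]. apply Rmult_le_pos; lra. }
  unfold ladderMoment. set (g := fun t => t * w t * exp (- (2 * t) / x)) in *.
  rewrite <- (RInt_split g 0 1 (mu x) Hc), <- (RInt_split g 1 x (mu x) Hc).
  assert (0 <= RInt g 0 1)
    by (apply RInt_ge_0; [lra | now apply ex_RInt_cont | intros; apply Hp; lra]).
  assert (0 <= RInt g x (mu x))
    by (apply RInt_ge_0; [lra | now apply ex_RInt_cont | intros; apply Hp; lra]).
  assert (RInt (fun t => / 9 * w t) 1 x <= RInt g 1 x).
  { apply RInt_mono; [lra | | auto |].
    - intros t. apply (continuous_Rmult (fun _ => / 9)); [apply continuous_const | apply Hw].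
    - intros t Ht. pose proof (msd_nonneg w Hw t). pose proof (exp_cut t x ltac:(lra) ltac:(lra)).
      assert (w t <= t * w t) by nra. unfold g. nra. }
  rewrite RInt_Rscal in H1 by (apply ex_RInt_cont, Hw).
  pose proof (msd_lower w Hw 1 x ltac:(lra) ltac:(lra) (sqrt_threshold 1 x ltac:(lra) Hx)). lra.
Qed.

Lemma ladderMoment_upper (w : R -> R) (x : R) : mean_square_density w -> 3 <= x ->
  ladderMoment w x <= x / 2 * mean_sq w (mu x).
Proof.
  intros Hw Hx. pose proof (mu_ge x Hx) as Hm. unfold mean_sq.
  rewrite <- RInt_Rscal by (apply ex_RInt_cont, Hw).
  apply RInt_mono; [lra | | |].
  - intros t. apply continuous_moment_integrand, Hw.
  - intros t. apply (continuous_Rmult (fun _ => x / 2)); [apply continuous_const | apply Hw].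
  - intros t Ht. pose proof (msd_nonneg w Hw t) as H0.
    assert (H : t * exp (- (2 * t) / x) <= x / 2).
    { set (u := (2 * t) / x). assert (E : t = x / 2 * u) by (unfold u; field; lra).
      replace (- (2 * t) / x) with (- u) by (unfold u; field; lra). rewrite E at 1.
      rewrite Rmult_assoc. rewrite <- (Rmult_1_r (x / 2)) at 2. apply Rmult_le_compat_l; [lra |].
      rewrite exp_Ropp. pose proof (exp_ineq1_le u). pose proof (exp_pos u).
      apply Rmult_le_reg_r with (exp u); [lra |]. rewrite Rmult_assoc, Rinv_l; lra. }
    replace (t * w t * exp (- (2 * t) / x)) with (w t * (t * exp (- (2 * t) / x))) by ring.
    rewrite (Rmult_comm (x / 2)). apply Rmult_le_compat_l; auto.
Qed.

Lemma ladderBoundary_bound (w : R -> R) (x : R) : mean_square_density w -> 3 <= x ->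
  0 <= ladderBoundary w x <= 44800 * / x ^ 11.
Proof.
  intros Hw Hx. unfold ladderBoundary. rewrite exp_mu by lra.
  pose proof (mu_ge x Hx). pose proof (mu_le x Hx) as Hm.
  pose proof (ln_ge_1 x Hx). pose proof (ln_le_self x ltac:(lra)).
  pose proof (msd_nonneg w Hw (mu x)). pose proof (msd_pointwise w Hw (mu x) ltac:(lra)).
  assert (Hi : 0 < / x ^ 14) by (apply Rinv_0_lt_compat, pow_lt; lra).
  assert (Hw1 : w (mu x) <= 3200 * x ^ 2) by (simpl in *; nra).
  split.
  - apply Rmult_le_pos; [apply Rmult_le_pos; lra | lra].
  - replace (44800 * / x ^ 11) with ((3200 * x ^ 2) * / x ^ 14 * (14 * x)) by (field; lra).
    apply Rmult_le_compat; [apply Rmult_le_pos; lra | lra | | lra].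
    apply Rmult_le_compat_r; lra.
Qed.

Lemma dladder_pos (w : R -> R) (x : R) : mean_square_density w -> 20000 <= x -> 0 < dladder w x.
Proof.
  intros Hw Hx. pose proof (ladderMoment_lower w x Hw Hx).
  pose proof (ladderBoundary_bound w x Hw ltac:(lra)).
  assert (0 < 2 / x ^ 2 * ladderMoment w x); [| unfold dladder; lra].
  apply Rmult_lt_0_compat; [| lra].
  apply Rmult_lt_0_compat; [lra | apply Rinv_0_lt_compat, pow_lt; lra].
Qed.

Lemma ln_7_le_3 : ln 7 <= 3.
Proof.
  rewrite <- (ln_exp 3). apply ln_le; [lra |].
  replace 3 with (1 + 1 + 1) by ring. rewrite !exp_plus. pose proof (exp_ineq1_le 1). nra.
Qed.

Lemma mean_sq_mu_upper (w : R -> R) (x : R) : mean_square_density w -> 3 <= x ->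
  mean_sq w (mu x) <= 70000 * x * ln x ^ 2.
Proof.
  intros Hw Hx. pose proof (mu_ge x Hx) as Hm. pose proof (ln_ge_1 x Hx) as Hl.
  eapply Rle_trans; [apply (msd_upper w Hw (mu x)); lra |].
  assert (H : ln (mu x) <= 5 * ln x).
  { apply Rle_trans with (ln (7 * x ^ 2)).
    - apply ln_le; [lra | now apply mu_le].
    - rewrite ln_mult by (try apply pow_lt; lra). rewrite <- Rpower_pow by lra.
      unfold Rpower. rewrite ln_exp. simpl. pose proof ln_7_le_3. lra. }
  replace (70000 * x * ln x ^ 2) with (2000 * mu x * (5 * ln x)) by (unfold mu; ring).
  apply Rmult_le_compat_l; lra.
Qed.

Lemma dladder_upper (w : R -> R) (x : R) : mean_square_density w -> 3 <= x ->
  dladder w x <= 80000 * ln x ^ 2.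
Proof.
  intros Hw Hx. pose proof (ladderMoment_upper w x Hw Hx) as H1.
  pose proof (mean_sq_mu_upper w x Hw Hx) as H2.
  pose proof (ladderBoundary_bound w x Hw Hx) as [_ H3].
  pose proof (ln_ge_1 x Hx) as Hl.
  assert (H4 : 44800 * / x ^ 11 <= 1).
  { apply Rmult_le_reg_r with (x ^ 11); [apply pow_lt; lra |].
    rewrite Rmult_assoc, Rinv_l by (apply pow_nonzero; lra).
    assert (3 ^ 11 <= x ^ 11) by (apply pow_incr; lra). simpl (3 ^ 11) in H. lra. }
  assert (Hi : 0 < 2 / x ^ 2) by (apply Rmult_lt_0_compat; [lra | apply Rinv_0_lt_compat, pow_lt; lra]).
  assert (H5 : 2 / x ^ 2 * ladderMoment w x <= 70000 * ln x ^ 2).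
  { replace (70000 * ln x ^ 2) with (2 / x ^ 2 * (x / 2 * (70000 * x * ln x ^ 2))) by (field; lra).
    apply Rmult_le_compat_l; [lra |]. eapply Rle_trans; [exact H1 |].
    apply Rmult_le_compat_l; lra. }
  unfold dladder. assert (1 <= ln x ^ 2) by (simpl; nra). lra.
Qed.

Lemma RInt_le_const (f : R -> R) (a b c : R) : a <= b ->
  (forall t, continuous f t) -> (forall t, a < t < b -> f t <= c) -> RInt f a b <= (b - a) * c.
Proof.
  intros Hab Hf H. rewrite <- RInt_Rconst. apply RInt_mono; auto.
  intros t. apply continuous_const.
Qed.

(** For [t <= mu x = 7 x ln x] the exponents [2 t / x] and [2 t / y] differ by at most
    [14 (y - x) ln x / x]; this is where the condition for slow variation comes from. The additional
    range from [mu x] to [mu y] contributes only [O (1 / x)]. *)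
Lemma ladderMoment_growth (w : R -> R) (x y : R) : mean_square_density w ->
  20000 <= x -> x <= y <= 2 * x ->
  ladderMoment w x <= ladderMoment w y /\
  ladderMoment w y <= exp (14 * ((y - x) * ln x / x)) * ladderMoment w x + 9408000 * / x.
Proof.
  intros Hw Hx Hy. pose proof (mu_ge x ltac:(lra)) as Hmx.
  pose proof (mu_mono x y ltac:(lra)) as Hmm.
  pose proof (mu_le y ltac:(lra)) as Hmy.
  pose proof (ln_ge_1 x ltac:(lra)) as Hl.
  assert (Hmy2 : mu y <= 28 * x ^ 2).
  { apply Rle_trans with (1 := Hmy). replace (28 * x ^ 2) with (7 * (2 * x) ^ 2) by ring.
    apply Rmult_le_compat_l; [lra |]. apply pow_incr; lra. }
  set (g := fun z t => t * w t * exp (- (2 * t) / z)).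
  assert (Hc : forall z t, continuous (g z) t)
    by (intros z t; apply continuous_moment_integrand, Hw).
  assert (Htw : forall t, 0 <= t -> 0 <= t * w t).
  { intros t Ht. pose proof (msd_nonneg w Hw t). apply Rmult_le_pos; lra. }
  assert (Hp : forall z t, 0 <= t -> 0 <= g z t).
  { intros z t Ht. apply Rmult_le_pos; [auto | apply Rlt_le, exp_pos]. }
  change (ladderMoment w y) with (RInt (g y) 0 (mu y)).
  change (ladderMoment w x) with (RInt (g x) 0 (mu x)).
  rewrite <- (RInt_split (g y) 0 (mu x) (mu y)) by apply Hc.
  split.
  - assert (0 <= RInt (g y) (mu x) (mu y))
      by (apply RInt_ge_0; [lra | now apply ex_RInt_cont | intros; apply Hp; lra]).
    assert (RInt (g x) 0 (mu x) <= RInt (g y) 0 (mu x)); [| lra].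
    apply RInt_mono; auto; [lra |]. intros t Ht. unfold g.
    apply Rmult_le_compat_l; [apply Htw; lra |]. apply exp_mono.
    unfold Rdiv. rewrite !Ropp_mult_distr_l_reverse. apply Ropp_le_contravar.
    apply Rmult_le_compat_l; [lra |]. apply Rinv_le_contravar; lra.
  - apply Rplus_le_compat.
    + rewrite <- RInt_Rscal by (apply ex_RInt_cont, Hc).
      apply RInt_mono; auto; [lra | |].
      { intros t. apply (continuous_Rmult (fun _ => exp (14 * ((y - x) * ln x / x)))); [apply continuous_const | apply Hc]. }
      intros t Ht. unfold g.
      replace (exp (14 * ((y - x) * ln x / x)) * (t * w t * exp (- (2 * t) / x)))
        with (t * w t * (exp (14 * ((y - x) * ln x / x)) * exp (- (2 * t) / x))) by ring.
      apply Rmult_le_compat_l; [apply Htw; lra |]. rewrite <- exp_plus. apply exp_mono.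
      assert (2 * t * ((y - x) / (x * y)) <= 14 * ((y - x) * ln x / x)).
      { apply Rle_trans with (2 * mu x * ((y - x) / (x * y))).
        - apply Rmult_le_compat_r; [| lra].
          apply Rmult_le_pos; [lra | apply Rlt_le, Rinv_0_lt_compat; nra].
        - unfold mu. replace (2 * (7 * x * ln x) * ((y - x) / (x * y))) with
            (14 * ((y - x) * ln x / y)) by (field; lra).
          apply Rmult_le_compat_l; [lra |]. unfold Rdiv. apply Rmult_le_compat_l; [nra |].
          apply Rinv_le_contravar; lra. }
      replace (2 * t * ((y - x) / (x * y))) with (- (2 * t) / y + (2 * t) / x) in H by (field; lra).
      unfold Rdiv in *. lra.
    (* On the additional range [t <= 28 x^2] and [w t <= 400 (t + 2)], and the exponential is at
       most [x^(-7)] because [y <= 2 x]. The range is no longer than [28 x^2], which yields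
       [9408000 / x]. *)
    + set (c := 28 * x ^ 2 * (400 * (30 * x ^ 2)) * / x ^ 7).
      assert (Hx7 : 0 < / x ^ 7) by (apply Rinv_0_lt_compat, pow_lt; lra).
      assert (Hx2 : 0 <= x ^ 2) by (apply pow_le; lra).
      assert (Hc0 : 0 <= c) by (unfold c; repeat apply Rmult_le_pos; lra).
      apply Rle_trans with ((mu y - mu x) * c).
      * apply RInt_le_const; auto. intros t Ht. unfold g, c.
        assert (H1 : exp (- (2 * t) / y) <= / x ^ 7).
        { rewrite <- (exp_ln_INR 7 x), <- exp_Ropp by lra. apply exp_mono.
          apply Rle_trans with (- (2 * mu x) / y).
          - unfold Rdiv. apply Rmult_le_compat_r; [apply Rlt_le, Rinv_0_lt_compat; lra | lra].
          - unfold mu. apply Rmult_le_reg_r with y; [lra |]. unfold Rdiv.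
            rewrite Rmult_assoc, Rinv_l by lra. replace (INR 7) with 7 by (simpl; lra). nra. }
        apply Rmult_le_compat; [apply Htw; lra | apply Rlt_le, exp_pos | | exact H1].
        apply Rmult_le_compat; [lra | apply Hw | lra |].
        eapply Rle_trans; [apply Hw; lra |]. apply Rmult_le_compat_l; [lra |]. simpl in *. nra.
      * apply Rle_trans with (28 * x ^ 2 * c).
        { apply Rmult_le_compat_r; auto. lra. }
        unfold c. right. field. lra.
Qed.

(** Turns the boundary term into a relative error that tends to [0], so that only the moments have
    to be compared. *)
Lemma dladder_factor (w : R -> R) (x : R) : mean_square_density w -> 20000 <= x ->
  exists b, 0 <= b <= / x /\ dladder w x = 2 / x ^ 2 * ladderMoment w x * (1 + b).
Proof.
  intros Hw Hx. pose proof (ladderMoment_lower w x Hw Hx) as HG.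
  pose proof (ladderBoundary_bound w x Hw ltac:(lra)) as HB.
  assert (Hx2 : 0 < x ^ 2) by (apply pow_lt; lra).
  exists (ladderBoundary w x * x ^ 2 / (2 * ladderMoment w x)). split.
  - split.
    + apply Rmult_le_pos; [apply Rmult_le_pos; lra | apply Rlt_le, Rinv_0_lt_compat; lra].
    + apply Rmult_le_reg_r with (2 * ladderMoment w x); [lra |].
      unfold Rdiv. rewrite Rmult_assoc, Rinv_l, Rmult_1_r by lra.
      apply Rle_trans with (2 / 500); [| apply Rle_trans with (/ x * (2 * (x / 500))); [right; field; lra |]].
      * apply Rle_trans with (44800 * / x ^ 11 * x ^ 2); [apply Rmult_le_compat_r; lra |].
        replace (44800 * / x ^ 11 * x ^ 2) with (44800 * / x ^ 9) by (field; lra).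
        apply Rmult_le_reg_r with (x ^ 9); [apply pow_lt; lra |].
        rewrite Rmult_assoc, Rinv_l by (apply pow_nonzero; lra).
        assert (20000 ^ 9 <= x ^ 9) by (apply pow_incr; lra).
        assert (11200000 <= 20000 ^ 9) by (simpl; lra). lra.
      * apply Rmult_le_compat_l; [apply Rlt_le, Rinv_0_lt_compat; lra | lra].
  - unfold dladder. field. lra.
Qed.

Lemma is_lim_seq_eventually_gt (x : nat -> R) (c : R) :
  is_lim_seq x p_infty -> eventually (fun n => c < x n).
Proof. intros H. apply is_lim_seq_spec in H. exact (H c). Qed.

Lemma is_lim_seq_inv_p (x : nat -> R) : is_lim_seq x p_infty -> is_lim_seq (fun n => / x n) 0.
Proof.
  intros H. replace (Finite 0) with (Rbar_inv p_infty) by reflexivity.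
  apply is_lim_seq_inv; [auto | discriminate].
Qed.

Lemma is_lim_seq_squeeze0 (u v : nat -> R) :
  eventually (fun n => 0 <= u n <= v n) -> is_lim_seq v 0 -> is_lim_seq u 0.
Proof.
  intros H Hv. apply is_lim_seq_le_le_loc with (fun _ => 0) v; auto. apply is_lim_seq_const.
Qed.

Lemma dladder_slowly_varying (w : R -> R) (x y : nat -> R) : mean_square_density w ->
  is_lim_seq x p_infty -> eventually (fun n => x n <= y n) ->
  is_lim_seq (fun n => (y n - x n) * ln (x n) / x n) 0 ->
  is_lim_seq (fun n => dladder w (y n) / dladder w (x n)) 1.
Proof.
  intros Hw Hx Hxy Hd.
  set (r := fun n => ladderMoment w (y n) / ladderMoment w (x n)).
  set (betx := fun n => dladder w (x n) / (2 / x n ^ 2 * ladderMoment w (x n))).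
  set (bety := fun n => dladder w (y n) / (2 / y n ^ 2 * ladderMoment w (y n))).
  pose proof (is_lim_seq_eventually_gt x 20000 Hx) as Hx0.
  assert (Hgap : is_lim_seq (fun n => y n / x n) 1).
  { assert (H0 : is_lim_seq (fun n => (y n - x n) / x n) 0).
    { apply is_lim_seq_squeeze0 with (2 := Hd).
      generalize (filter_and _ _ Hx0 Hxy). apply filter_imp. intros n [H1 H2].
      pose proof (ln_ge_1 (x n) ltac:(lra)). pose proof (Rinv_0_lt_compat (x n) ltac:(lra)).
      unfold Rdiv. split; [apply Rmult_le_pos; lra |]. apply Rmult_le_compat_r; [lra |]. nra. }
    apply is_lim_seq_ext_loc with (fun n => 1 + (y n - x n) / x n).
    - revert Hx0. apply filter_imp. intros n H. field. lra.
    - replace (Finite 1) with (Finite (1 + 0)) by (f_equal; ring).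
      apply is_lim_seq_plus'; auto. apply is_lim_seq_const. }
  assert (Hy2 : eventually (fun n => y n <= 2 * x n)).
  { apply is_lim_seq_spec in Hgap. specialize (Hgap (mkposreal 1 Rlt_0_1)). simpl in Hgap.
    generalize (filter_and _ _ Hx0 Hgap). apply filter_imp. intros n [H1 H2].
    apply Rabs_lt_between in H2. apply Rmult_le_reg_r with (/ x n); [apply Rinv_0_lt_compat; lra |].
    rewrite (Rmult_assoc 2), Rinv_r by lra. unfold Rdiv in H2. lra. }
  pose proof (filter_and _ _ Hx0 (filter_and _ _ Hxy Hy2)) as Hev.
  pose proof (is_lim_seq_inv_p x Hx) as Hix.
  assert (Hr : is_lim_seq r 1).
  { apply is_lim_seq_le_le_loc with (fun _ => 1)
      (fun n => exp (14 * ((y n - x n) * ln (x n) / x n)) + 9408000 * (/ x n)).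
    - revert Hev. apply filter_imp. intros n (H1 & H2 & H3).
      destruct (ladderMoment_growth w (x n) (y n) Hw ltac:(lra) ltac:(lra)) as [G1 G2].
      pose proof (ladderMoment_lower w (x n) Hw ltac:(lra)) as HG.
      assert (HG1 : 1 <= ladderMoment w (x n)) by lra.
      assert (Hi : 0 < / ladderMoment w (x n)) by (apply Rinv_0_lt_compat; lra).
      unfold r. split.
      + apply Rmult_le_reg_r with (ladderMoment w (x n)); [lra |].
        unfold Rdiv. rewrite Rmult_assoc, Rinv_l; lra.
      + apply Rmult_le_reg_r with (ladderMoment w (x n)); [lra |].
        unfold Rdiv at 1. rewrite Rmult_assoc, Rinv_l, Rmult_1_r by lra.
        eapply Rle_trans; [exact G2 |]. rewrite Rmult_plus_distr_r.
        apply Rplus_le_compat_l.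
        assert (0 < / x n) by (apply Rinv_0_lt_compat; lra). nra.
    - apply is_lim_seq_const.
    - replace (Finite 1) with (Finite (exp 0 + 9408000 * 0))
        by (f_equal; rewrite exp_0; ring).
      apply is_lim_seq_plus'.
      + apply (is_lim_seq_continuous exp); [apply derivable_continuous_pt, derivable_pt_exp |].
        replace (Finite 0) with (Finite (14 * 0)) by (f_equal; ring).
        now apply (is_lim_seq_scal_l _ 14 0).
      + now apply (is_lim_seq_scal_l _ 9408000 0). }
  assert (Hbg : forall z : nat -> R, eventually (fun n => x n <= z n) ->
     is_lim_seq (fun n => dladder w (z n) / (2 / z n ^ 2 * ladderMoment w (z n))) 1).
  { intros z Hz. apply is_lim_seq_le_le_loc with (fun _ => 1) (fun n => 1 + / x n).
    - generalize (filter_and _ _ Hx0 Hz). apply filter_imp. intros n [H1 H2].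
      destruct (dladder_factor w (z n) Hw ltac:(lra)) as (b & Hb & E).
      pose proof (ladderMoment_lower w (z n) Hw ltac:(lra)).
      rewrite E. replace (2 / z n ^ 2 * ladderMoment w (z n) * (1 + b) / (2 / z n ^ 2 * ladderMoment w (z n)))
        with (1 + b) by (field; repeat split; lra).
      assert (/ z n <= / x n) by (apply Rinv_le_contravar; lra). lra.
    - apply is_lim_seq_const.
    - replace (Finite 1) with (Finite (1 + 0)) by (f_equal; ring).
      apply is_lim_seq_plus'; [apply is_lim_seq_const | auto]. }
  pose proof (Hbg x (filter_forall _ (fun n => Rle_refl (x n)))) as Hbx. fold betx in Hbx.
  pose proof (Hbg y Hxy) as Hby. fold bety in Hby.
  apply is_lim_seq_ext_loc with (fun n => / (y n / x n * (y n / x n)) * r n * (bety n / betx n)).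
  - revert Hev. apply filter_imp. intros n (H1 & H2 & H3).
    pose proof (ladderMoment_lower w (x n) Hw ltac:(lra)).
    pose proof (ladderMoment_lower w (y n) Hw ltac:(lra)).
    pose proof (dladder_pos w (x n) Hw ltac:(lra)).
    unfold r, betx, bety. field. repeat split; lra.
  - replace (Finite 1) with (Finite (/ (1 * 1) * 1 * (1 / 1))) by (f_equal; field).
    apply is_lim_seq_mult'.
    + apply is_lim_seq_mult'; auto.
      apply (is_lim_seq_inv _ (1 * 1)).
      * now apply is_lim_seq_mult'.
      * intros H. injection H. lra.
    + apply (is_lim_seq_div' bety betx 1 1); auto.
Qed.

(** * The ladder *)

(** The value [20001] leaves room for a step of length [1] to the left of [phi T] above the
    threshold [20000]; [ladder_continuous] takes such a step. *)
Definition ladder_from (w phi : R -> R) (T1 : R) : Prop :=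
  20001 <= T1 /\
  forall T, T1 <= T -> 20001 <= phi T /\ ladderInt w (phi T) = mean_sq w T.

(** While [phi T] stays below [M'], the left-hand side of the equation is at most
    [mean_sq w (mu M')], whereas the right-hand side is at least [T / 48]. *)
Lemma ladder_unbounded (w phi : R -> R) (X0 T0 M : R) : mean_square_density w -> 1 < X0 ->
  (forall T, T0 < T -> X0 <= phi T /\ ladderInt w (phi T) = mean_sq w T) ->
  exists T1, forall T, T1 <= T -> M <= phi T.
Proof.
  intros Hw HX H. set (M' := Rmax M X0).
  pose proof (Rmax_l M X0) as HM1. pose proof (Rmax_r M X0) as HM2. fold M' in HM1, HM2.
  exists (Rmax (T0 + 1) (Rmax 20000 (48 * (mean_sq w (mu M') + 1)))). intros T HT.
  pose proof (Rmax_l (T0 + 1) (Rmax 20000 (48 * (mean_sq w (mu M') + 1)))).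
  pose proof (Rmax_r (T0 + 1) (Rmax 20000 (48 * (mean_sq w (mu M') + 1)))).
  pose proof (Rmax_l 20000 (48 * (mean_sq w (mu M') + 1))).
  pose proof (Rmax_r 20000 (48 * (mean_sq w (mu M') + 1))).
  destruct (H T) as [H5 H6]; [lra |].
  destruct (Rle_dec M (phi T)) as [|Hn]; auto. exfalso.
  pose proof (mean_sq_lower w T Hw ltac:(lra)).
  pose proof (ladderInt_upper w (phi T) Hw ltac:(lra)).
  pose proof (mean_sq_mono w (mu (phi T)) (mu M') Hw (mu_mono (phi T) M' ltac:(lra))). lra.
Qed.

Lemma jacob_ladder_from (zeta : C -> C) (phi : R -> R) : is_riemann_zeta zeta ->
  is_jacob_ladder zeta phi -> exists T1, ladder_from (hardyZ2 zeta) phi T1.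
Proof.
  intros Hz (X0 & HX & T0 & H).
  assert (H' : forall T, T0 < T -> X0 <= phi T /\ ladderInt (hardyZ2 zeta) (phi T) = mean_sq (hardyZ2 zeta) T).
  { intros T HT. destruct (H T HT) as (H1 & H2 & _). split; [exact H1 | exact H2]. }
  destruct (ladder_unbounded _ phi X0 T0 20001 (hardyZ2_mean_square zeta Hz) HX H') as [T1 HT1].
  exists (Rmax (T0 + 1) (Rmax 20001 T1)).
  pose proof (Rmax_l (T0 + 1) (Rmax 20001 T1)). pose proof (Rmax_r (T0 + 1) (Rmax 20001 T1)).
  pose proof (Rmax_l 20001 T1). pose proof (Rmax_r 20001 T1).
  split; [lra |]. intros T HT. split; [apply HT1; lra | apply H'; lra].
Qed.

Lemma ladder_from_unbounded (w phi : R -> R) (T1 M : R) : mean_square_density w ->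
  ladder_from w phi T1 -> exists T2, forall T, T2 <= T -> M <= phi T.
Proof.
  intros Hw [HT1 H]. apply (ladder_unbounded w phi 20001 T1 M Hw); [lra |].
  intros T HT. apply H. lra.
Qed.

Lemma ladderInt_increment (w : R -> R) (x y : R) : mean_square_density w -> 20000 <= x -> x < y ->
  exists c, x <= c <= y /\ ladderInt w y - ladderInt w x = dladder w c * (y - x).
Proof.
  intros Hw Hx Hxy.
  destruct (MVT_gen (ladderInt w) x y (dladder w)) as (c & Hc & E).
  - rewrite Rmin_left, Rmax_right by lra. intros z Hz. apply is_derive_ladderInt; [apply Hw | lra].
  - rewrite Rmin_left, Rmax_right by lra. intros z Hz.
    apply continuity_pt_filterlim, @ex_derive_continuous. eexists.
    apply is_derive_ladderInt; [apply Hw | lra].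
  - rewrite Rmin_left, Rmax_right in Hc by lra. now exists c.
Qed.

Lemma ladderInt_incr (w : R -> R) (x y : R) : mean_square_density w -> 20000 <= x -> x < y ->
  ladderInt w x < ladderInt w y.
Proof.
  intros Hw Hx Hxy. destruct (ladderInt_increment w x y Hw Hx Hxy) as (c & Hc & E).
  pose proof (dladder_pos w c Hw ltac:(lra)). nra.
Qed.

Lemma ladderInt_inj_lt (w : R -> R) (x y : R) : mean_square_density w -> 20000 <= y ->
  ladderInt w x < ladderInt w y -> 20000 <= x -> x < y.
Proof.
  intros Hw Hy H Hx. destruct (Rlt_dec x y) as [|Hn]; auto. exfalso.
  destruct (Req_dec x y) as [E | E]; [rewrite E in H; lra |].
  pose proof (ladderInt_incr w y x Hw Hy ltac:(lra)). lra.
Qed.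

Lemma ladder_mono (w phi : R -> R) (T1 S T : R) : mean_square_density w ->
  ladder_from w phi T1 -> T1 <= S <= T -> phi S <= phi T.
Proof.
  intros Hw [_ H] HST. destruct (H S) as [H1 H2]; [lra |]. destruct (H T) as [H3 H4]; [lra |].
  destruct (Rle_dec (phi S) (phi T)) as [|Hn]; auto. exfalso.
  pose proof (ladderInt_incr w (phi T) (phi S) Hw ltac:(lra) ltac:(lra)).
  pose proof (mean_sq_mono w S T Hw ltac:(lra)). lra.
Qed.

Lemma is_derive_mean_sq (w : R -> R) (T : R) : mean_square_density w -> is_derive (mean_sq w) T (w T).
Proof.
  intros Hw. apply (is_derive_RInt w (mean_sq w) 0 T); [| apply Hw].
  exists (mkposreal 1 Rlt_0_1). intros y _. apply @RInt_correct. apply ex_RInt_cont, Hw.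
Qed.

Lemma mean_sq_continuous (w : R -> R) (T : R) : mean_square_density w -> continuous (mean_sq w) T.
Proof. intros Hw. apply @ex_derive_continuous. eexists. now apply is_derive_mean_sq. Qed.

(** Near [T], [phi] is the inverse of the strictly increasing [ladderInt] applied to the continuous
    [mean_sq]: values of [mean_sq] strictly between those of [ladderInt] at [phi T - d] and
    [phi T + d] confine [phi]. *)
Lemma ladder_continuous (w phi : R -> R) (T1 T : R) : mean_square_density w ->
  ladder_from w phi T1 -> T1 < T -> continuous phi T.
Proof.
  intros Hw [_ H] HT. apply filterlim_locally. intros [e He]. simpl.
  set (d := Rmin e 1). assert (Hd : 0 < d <= 1 /\ d <= e).
  { unfold d. pose proof (Rmin_l e 1). pose proof (Rmin_r e 1).
    pose proof (Rmin_pos e 1 He ltac:(lra)). lra. }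
  destruct (H T ltac:(lra)) as [H1 H2].
  pose proof (ladderInt_incr w (phi T - d) (phi T) Hw ltac:(lra) ltac:(lra)) as L1.
  pose proof (ladderInt_incr w (phi T) (phi T + d) Hw ltac:(lra) ltac:(lra)) as L2.
  rewrite H2 in L1, L2.
  pose proof (mean_sq_continuous w T Hw) as Hc.
  set (m := Rmin (ladderInt w (phi T + d) - mean_sq w T) (mean_sq w T - ladderInt w (phi T - d))).
  assert (Hm : 0 < m) by (apply Rmin_pos; lra).
  pose proof (proj1 (filterlim_locally _ _) Hc (mkposreal m Hm)) as Hloc.
  assert (Hgt : locally T (fun y => T1 < y)).
  { exists (mkposreal (T - T1) ltac:(lra)). intros y Hy. change (Rabs (y - T) < T - T1) in Hy.
    apply Rabs_lt_between in Hy. lra. }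
  generalize (filter_and _ _ Hloc Hgt). apply filter_imp. intros y [Hy Hy1].
  change (Rabs (mean_sq w y - mean_sq w T) < m) in Hy. apply Rabs_lt_between in Hy.
  change (Rabs (phi y - phi T) < e).
  pose proof (Rmin_l (ladderInt w (phi T + d) - mean_sq w T) (mean_sq w T - ladderInt w (phi T - d))).
  pose proof (Rmin_r (ladderInt w (phi T + d) - mean_sq w T) (mean_sq w T - ladderInt w (phi T - d))).
  fold m in H0, H3. destruct (H y ltac:(lra)) as [H5 H6].
  pose proof (ladderInt_inj_lt w (phi y) (phi T + d) Hw ltac:(lra) ltac:(lra) ltac:(lra)).
  pose proof (ladderInt_inj_lt w (phi T - d) (phi y) Hw ltac:(lra) ltac:(lra) ltac:(lra)).
  apply Rabs_lt_between. lra.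
Qed.

Lemma is_derive_quotient_lim (f : R -> R) (x l : R) :
  is_derive f x l <-> is_lim (fun h => (f (x + h) - f x) / h) 0 l.
Proof.
  rewrite is_derive_Reals. split.
  - intros H. apply is_lim_spec. intros [e He]. destruct (H e He) as [[d Hd] H'].
    exists (mkposreal d Hd). intros h Hh Hh0. change (Rabs (h - 0) < d) in Hh.
    rewrite Rminus_0_r in Hh. now apply H'.
  - intros H e He. apply is_lim_spec in H. destruct (H (mkposreal e He)) as [[d Hd] H'].
    exists (mkposreal d Hd). intros h Hh0 Hh. apply (H' h); auto.
    change (Rabs (h - 0) < d). now rewrite Rminus_0_r.
Qed.

(** Only continuity of [phi] is given, and [phi (T + h) = phi T] is not excluded. The difference
    quotient [q] of [F] is therefore completed by [l] at [phi T], which makes it continuous there;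
    in the degenerate case both increments vanish. *)
Lemma is_derive_implicit (F S phi : R -> R) (T l s : R) :
  continuous phi T -> is_derive F (phi T) l -> l <> 0 -> is_derive S T s ->
  locally T (fun y => F (phi y) = S y) -> is_derive phi T (s / l).
Proof.
  intros Hc HF Hl HS Heq.
  set (q := fun y => if Req_EM_T y (phi T) then l else (F y - F (phi T)) / (y - phi T)).
  assert (Hq : filterlim q (locally (phi T)) (locally l)).
  { apply filterlim_locally. intros e. apply is_derive_Reals in HF.
    destruct (HF e (cond_pos e)) as [d Hd]. exists d. intros y Hy.
    change (Rabs (y - phi T) < d) in Hy. change (Rabs (q y - l) < e). unfold q.
    destruct (Req_EM_T y (phi T)) as [E | E].
    - unfold Rminus. rewrite Rplus_opp_r, Rabs_R0. apply cond_pos.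
    - specialize (Hd (y - phi T) ltac:(lra) Hy).
      assert (E' : (phi T + (y - phi T))%R = y) by (real_eq; ring). now rewrite E' in Hd. }
  assert (Hshift : filterlim (fun h => T + h) (locally' 0) (locally T)).
  { apply filterlim_locally. intros e. exists e. intros h Hh _.
    change (Rabs (h - 0) < e) in Hh. change (Rabs (T + h - T) < e).
    now replace (T + h - T) with (h - 0) by ring. }
  assert (Hqphi : is_lim (fun h => q (phi (T + h))) 0 l).
  { apply (filterlim_comp _ _ _ (fun h => phi (T + h)) q (locally' 0) (locally (phi T))); auto.
    apply (filterlim_comp _ _ _ (fun h => T + h) phi (locally' 0) (locally T)); auto. }
  apply is_derive_quotient_lim in HS. apply is_derive_quotient_lim.
  apply is_lim_ext_loc with (fun h => (S (T + h) - S T) / h / q (phi (T + h))).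
  - assert (Hnz : locally' 0 (fun h => q (phi (T + h)) <> 0)).
    { apply is_lim_spec in Hqphi.
      specialize (Hqphi (mkposreal (Rabs l) (Rabs_pos_lt l Hl))). simpl in Hqphi.
      revert Hqphi. apply filter_imp. intros h Hh E. rewrite E in Hh.
      replace (0 - l) with (- l) in Hh by ring. rewrite Rabs_Ropp in Hh. lra. }
    assert (He : locally' 0 (fun h => F (phi (T + h)) = S (T + h))) by exact (Hshift _ Heq).
    assert (H0 : locally' 0 (fun h => h <> 0)).
    { exists (mkposreal 1 Rlt_0_1). auto. }
    pose proof (locally_singleton _ _ Heq) as HeqT. simpl in HeqT.
    generalize (filter_and _ _ Hnz (filter_and _ _ He H0)). apply filter_imp.
    intros h (N1 & N2 & N3). rewrite <- N2, <- HeqT. unfold q in *.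
    destruct (Req_EM_T (phi (T + h)) (phi T)) as [E | E].
    + rewrite E. field. auto.
    + field. repeat split; auto; try lra.
      intros Z. apply N1. rewrite Z. unfold Rdiv. apply Rmult_0_l.
  - apply (is_lim_div _ _ 0 s l); auto.
    + intros E. injection E. auto.
    + simpl. auto.
Qed.

Lemma is_derive_ladder1 (w phi : R -> R) (T1 T : R) : mean_square_density w ->
  ladder_from w phi T1 -> T1 < T ->
  is_derive (ladder1 phi) T (w T / (2 * dladder w (2 * ladder1 phi T))).
Proof.
  intros Hw Hphi HT. pose proof (proj2 Hphi T ltac:(lra)) as [H1 H2].
  pose proof (dladder_pos w (phi T) Hw ltac:(lra)) as Hp.
  assert (H : is_derive phi T (w T / dladder w (phi T))).
  { apply (is_derive_implicit (ladderInt w) (mean_sq w)).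
    - now apply (ladder_continuous w phi T1).
    - apply is_derive_ladderInt; [apply Hw | lra].
    - lra.
    - now apply is_derive_mean_sq.
    - exists (mkposreal (T - T1) ltac:(lra)). intros y Hy.
      change (Rabs (y - T) < T - T1) in Hy. apply Rabs_lt_between in Hy.
      apply Hphi. lra. }
  unfold ladder1. replace (2 * (phi T / 2)) with (phi T) by field.
  replace (w T / (2 * dladder w (phi T))) with (/ 2 * (w T / dladder w (phi T))) by (field; lra).
  apply (is_derive_ext (fun T => / 2 * phi T)).
  - intros t. real_eq. field.
  - now apply (is_derive_scal phi T (/ 2)).
Qed.

Lemma ladder1_surjective (w phi : R -> R) (T1 X : R) : mean_square_density w ->
  ladder_from w phi T1 -> exists Y, forall y, Y <= y -> exists x, X <= x /\ ladder1 phi x = y.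
Proof.
  intros Hw Hphi. set (X' := Rmax X T1).
  pose proof (Rmax_l X T1) as HX1. pose proof (Rmax_r X T1) as HX2. fold X' in HX1, HX2.
  (* The bounds [mean_sq / 9] for [ladderInt] and [T / 48] for [mean_sq], taken at [2 y], give
     [ladderInt w (2 * y) >= y / 216]. So this value is attained by [mean_sq] to the right of
     [X']. *)
  exists (Rmax 20000 (216 * mean_sq w X')). intros y Hy.
  pose proof (Rmax_l 20000 (216 * mean_sq w X')). pose proof (Rmax_r 20000 (216 * mean_sq w X')).
  set (v := ladderInt w (2 * y)).
  assert (Hv : mean_sq w X' <= v).
  { pose proof (ladderInt_lower w (2 * y) Hw ltac:(lra)).
    pose proof (mean_sq_lower w (2 * y) Hw ltac:(lra)). unfold v. lra. }
  pose proof (proj1 Hphi) as H20.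
  set (b := X' + 48 * Rabs v).
  assert (Hb : v <= mean_sq w b).
  { pose proof (Rabs_pos v). pose proof (Rle_abs v).
    pose proof (mean_sq_lower w b Hw ltac:(unfold b; lra)). unfold b in *. lra. }
  destruct (IVT_gen (mean_sq w) X' b v) as (x & Hx & E).
  - intros z. apply continuity_pt_filterlim. now apply mean_sq_continuous.
  - rewrite Rmin_left, Rmax_right by lra. lra.
  - pose proof (Rabs_pos v). rewrite Rmin_left, Rmax_right in Hx by (unfold b; lra).
    exists x. split; [lra |].
    destruct (proj2 Hphi x ltac:(lra)) as [P1 P2]. unfold ladder1.
    assert (phi x = 2 * y); [| lra].
    rewrite E in P2. unfold v in P2.
    destruct (Rtotal_order (phi x) (2 * y)) as [L | [L | L]]; auto; exfalso.
    + pose proof (ladderInt_incr w (phi x) (2 * y) Hw ltac:(lra) L). lra.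
    + pose proof (ladderInt_incr w (2 * y) (phi x) Hw ltac:(lra) L). lra.
Qed.

(** * Lengths of intervals under the inverse ladder *)

Lemma ln_pow_sqrt_bound (m : nat) (x : R) : 1 <= x ->
  ln x ^ m / sqrt x <= (4 * INR (S m)) ^ m * exp (- (1 / 4) * ln x).
Proof.
  intros Hx. set (y := ln x).
  assert (Hy : 0 <= y) by (unfold y; rewrite <- ln_1; apply ln_le; lra).
  (* With this [k] the [m]-th power of [y <= k * exp (y / k)] costs at most [exp (y / 4)], half of
     the decay of [/ sqrt x]; [S m] keeps [k] positive for [m = 0]. *)
  pose proof (INR_S_pos m) as Hm. set (k := 4 * INR (S m)). assert (Hk : 0 < k) by (unfold k; lra).
  assert (E : / sqrt x = exp (- (1 / 2) * y)) by (unfold y; rewrite exp_half_ln; lra).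
  unfold Rdiv at 1. rewrite E.
  assert (H1 : y <= k * exp (y / k)).
  { replace y with (k * (y / k)) at 1 by (field; lra). apply Rmult_le_compat_l; [lra |].
    pose proof (exp_ineq1_le (y / k)). lra. }
  assert (H2 : y ^ m <= k ^ m * exp (y / 4)).
  { apply Rle_trans with ((k * exp (y / k)) ^ m); [apply pow_incr; lra |].
    rewrite Rpow_mult_distr. apply Rmult_le_compat_l; [apply pow_le; lra |].
    rewrite <- (exp_ln_INR m (exp (y / k))) by apply exp_pos. rewrite ln_exp.
    apply exp_mono. unfold k. rewrite S_INR in *. pose proof (pos_INR m).
    replace (INR m * (y / (4 * (INR m + 1)))) with (y / 4 * (INR m / (INR m + 1))) by (field; lra).
    rewrite <- (Rmult_1_r (y / 4)) at 2. apply Rmult_le_compat_l; [lra |].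
    apply Rmult_le_reg_r with (INR m + 1); [lra |]. unfold Rdiv. rewrite Rmult_assoc, Rinv_l; lra. }
  replace (exp (- (1 / 4) * y)) with (exp (y / 4) * exp (- (1 / 2) * y))
    by (rewrite <- exp_plus; f_equal; field).
  rewrite <- Rmult_assoc. apply Rmult_le_compat_r; [apply Rlt_le, exp_pos | exact H2].
Qed.

Lemma is_lim_seq_ln_pow_sqrt (u : nat -> R) (m : nat) : is_lim_seq u p_infty ->
  is_lim_seq (fun n => ln (u n) ^ m / sqrt (u n)) 0.
Proof.
  intros Hu. apply is_lim_seq_squeeze0 with (fun n => (4 * INR (S m)) ^ m * exp (- (1 / 4) * ln (u n))).
  - generalize (is_lim_seq_eventually_gt u 1 Hu). apply filter_imp. intros n Hn. split.
    + apply Rmult_le_pos; [apply pow_le; rewrite <- ln_1; apply ln_le; lra |].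
      apply Rlt_le, Rinv_0_lt_compat, sqrt_lt_R0; lra.
    + apply ln_pow_sqrt_bound; lra.
  - replace (Finite 0) with (Rbar_mult ((4 * INR (S m)) ^ m) 0) by (simpl; f_equal; ring).
    apply is_lim_seq_scal_l.
    apply (is_lim_comp_seq exp (fun n => - (1 / 4) * ln (u n)) m_infty 0).
    + exact is_lim_exp_m.
    + exists O. intros n _. discriminate.
    + replace m_infty with (Rbar_mult (- (1 / 4)) p_infty).
      * apply is_lim_seq_scal_l. apply (is_lim_comp_seq ln u p_infty p_infty); auto.
        { exact is_lim_ln_p. }
        exists O. intros n _. discriminate.
      * simpl. destruct (Rle_dec 0 (- (1 / 4))) as [H|H]; [exfalso; lra | reflexivity].
Qed.

Definition negligible_gap (u v : nat -> R) : Prop :=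
  forall m, is_lim_seq (fun n => (v n - u n) * ln (u n) ^ m / u n) 0.

Lemma negligible_gap_const (u : nat -> R) (c : R) : 0 <= c -> is_lim_seq u p_infty ->
  negligible_gap u (fun n => u n + c).
Proof.
  intros Hc Hu m. apply is_lim_seq_squeeze0 with (fun n => c * (ln (u n) ^ m / sqrt (u n))).
  - generalize (is_lim_seq_eventually_gt u 1 Hu). apply filter_imp. intros n Hn.
    assert (H0 : 0 <= ln (u n) ^ m) by (apply pow_le; rewrite <- ln_1; apply ln_le; lra).
    replace (u n + c - u n) with c by ring. unfold Rdiv. rewrite Rmult_assoc. split.
    + apply Rmult_le_pos; auto. apply Rmult_le_pos; auto. apply Rlt_le, Rinv_0_lt_compat; lra.
    + apply Rmult_le_compat_l; auto. apply Rmult_le_compat_l; auto.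
      apply Rinv_le_contravar; [apply sqrt_lt_R0; lra |].
      rewrite <- (sqrt_sqrt (u n)) at 2 by lra.
      assert (1 <= sqrt (u n)) by (rewrite <- sqrt_1; apply sqrt_le_1_alt; lra). nra.
  - replace (Finite 0) with (Rbar_mult c 0) by (simpl; f_equal; ring).
    apply is_lim_seq_scal_l. now apply is_lim_seq_ln_pow_sqrt.
Qed.

(** Both sides of the ladder equation are of linear order in their arguments up to logarithms, so
    [u] and [ladder1 phi u] are comparable up to logarithms. *)
Lemma ladder_comparison (w phi : R -> R) (T1 u : R) : mean_square_density w ->
  ladder_from w phi T1 -> T1 <= u ->
  u <= 6720000 * ladder1 phi u * ln (2 * ladder1 phi u) ^ 2 /\
  ladder1 phi u <= 432000 * u * ln u.
Proof.
  intros Hw [HT H] Hu. destruct (H u Hu) as [H1 H2].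
  unfold ladder1. replace (2 * (phi u / 2)) with (phi u) by field.
  pose proof (mean_sq_lower w u Hw ltac:(lra)).
  pose proof (mean_sq_lower w (phi u) Hw ltac:(lra)).
  pose proof (ladderInt_upper w (phi u) Hw ltac:(lra)).
  pose proof (ladderInt_lower w (phi u) Hw ltac:(lra)).
  pose proof (mean_sq_mu_upper w (phi u) Hw ltac:(lra)).
  pose proof (msd_upper w Hw u ltac:(lra)) as H7. fold (mean_sq w u) in H7.
  split; lra.
Qed.

Lemma gap_increment (w phi : R -> R) (T1 u v : R) : mean_square_density w ->
  ladder_from w phi T1 -> T1 <= u <= v ->
  mean_sq w v - mean_sq w u
  <= 160000 * (ladder1 phi v - ladder1 phi u) * ln (2 * ladder1 phi v) ^ 2.
Proof.
  intros Hw Hphi Huv.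
  pose proof (ladder_mono w phi T1 u v Hw Hphi Huv) as Hm.
  destruct (proj2 Hphi u ltac:(lra)) as [H1 H2]. destruct (proj2 Hphi v ltac:(lra)) as [H3 H4].
  unfold ladder1. replace (2 * (phi v / 2)) with (phi v) by field.
  rewrite <- H2, <- H4.
  destruct (Req_dec (phi u) (phi v)) as [E | E].
  - rewrite E. lra.
  - destruct (ladderInt_increment w (phi u) (phi v) Hw ltac:(lra) ltac:(lra)) as (c & Hc & Ec).
    rewrite Ec. pose proof (dladder_upper w c Hw ltac:(lra)) as Hd.
    assert (Hl : ln c ^ 2 <= ln (phi v) ^ 2).
    { apply pow_incr. split; [rewrite <- ln_1; apply ln_le; lra | apply ln_le; lra]. }
    replace (160000 * (phi v / 2 - phi u / 2) * ln (phi v) ^ 2)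
      with (80000 * ln (phi v) ^ 2 * (phi v - phi u)) by field.
    apply Rmult_le_compat_r; lra.
Qed.

(* Either the gap is so short that it is negligible anyway, or the local lower
   bound for the mean square turns the increment of [mean_sq] into a bound. *)
Lemma gap_bound (w : R -> R) (u v : R) : mean_square_density w -> 200000 <= u <= v ->
  v - u <= 256 * sqrt u + 48 * (mean_sq w v - mean_sq w u).
Proof.
  intros Hw Huv.
  assert (Hs : mean_sq w v - mean_sq w u = RInt w u v).
  { unfold mean_sq. rewrite <- (RInt_split w 0 u v (msd_continuous w Hw)). ring. }
  assert (Hn : 0 <= RInt w u v) by (apply RInt_nonneg; [lra | apply Hw | apply Hw]).
  rewrite Hs. pose proof (sqrt_pos u).
  destruct (Rle_dec (128 * sqrt (v + 2)) (v - u)) as [L | L].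
  - pose proof (msd_lower w Hw u v ltac:(lra) ltac:(lra) L). lra.
  (* In this case [v <= 2 u]: otherwise the gap exceeds [v / 2], and [128 * sqrt (v + 2) <= v / 2]
     in this range. *)
  - apply Rnot_le_lt in L.
    assert (Hv : v <= 2 * u).
    { destruct (Rle_dec v (2 * u)) as [|Hn2]; auto. exfalso.
      pose proof (sqrt_threshold 0 ((v - 4) / 2 + 2) ltac:(lra)) as Ht.
      assert (H1 : 128 * sqrt (v + 2) <= v / 2); [| lra].
      apply Rsqr_incr_0_var; [| lra]. rewrite Rsqr_mult, Rsqr_sqrt by lra. unfold Rsqr. nra. }
    assert (sqrt (v + 2) <= 2 * sqrt u); [| lra].
    replace (2 * sqrt u) with (sqrt (4 * u)).
    + apply sqrt_le_1_alt; lra.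
    + rewrite sqrt_mult by lra. f_equal. replace 4 with (2 * 2) by ring. apply sqrt_square; lra.
Qed.

Lemma ladder1_lim (w phi : R -> R) (T1 : R) (u : nat -> R) : mean_square_density w ->
  ladder_from w phi T1 -> is_lim_seq u p_infty -> is_lim_seq (fun n => ladder1 phi (u n)) p_infty.
Proof.
  intros Hw Hphi Hu. apply is_lim_seq_spec. intros M.
  destruct (ladder_from_unbounded w phi T1 (2 * (M + 1)) Hw Hphi) as [T2 HT].
  generalize (is_lim_seq_eventually_gt u T2 Hu). apply filter_imp. intros n Hn.
  specialize (HT (u n) ltac:(lra)). unfold ladder1. lra.
Qed.

(** By [gap_bound] and [gap_increment] the inner gap is at most a multiple of [sqrt u] plus the
    outer gap times a squared logarithm. Replacing [/ u] by a bound in terms of [ladder1 phi u]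
    costs one more logarithm, whence the exponent [m + 3]. *)
Lemma negligible_gap_pull (w phi : R -> R) (T1 : R) (u v : nat -> R) : mean_square_density w ->
  ladder_from w phi T1 -> is_lim_seq u p_infty -> eventually (fun n => u n <= v n) ->
  negligible_gap (fun n => ladder1 phi (u n)) (fun n => ladder1 phi (v n)) ->
  negligible_gap u v.
Proof.
  intros Hw Hphi Hu Huv Hgap m.
  set (p := fun n => ladder1 phi (u n)). set (q := fun n => ladder1 phi (v n)).
  assert (Hp : is_lim_seq p p_infty) by now apply (ladder1_lim w phi T1).
  (* The factors come from [gap_bound], [gap_increment], [ln (2 Q) <= 2 ln P] squared,
     [ladder_comparison], and [ln U <= 4 ln P] raised to the power [S m]. *)
  set (C := 48 * 160000 * 4 * 432000 * 4 ^ S m).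
  apply is_lim_seq_squeeze0 with (fun n => 256 * (ln (u n) ^ m / sqrt (u n)) +
     C * ((q n - p n) * ln (p n) ^ (m + 3) / p n)).
  2:{ replace (Finite 0) with (Finite (256 * 0 + C * 0)) by (f_equal; ring).
      apply is_lim_seq_plus'.
      - apply (is_lim_seq_scal_l _ 256 0). now apply is_lim_seq_ln_pow_sqrt.
      - apply (is_lim_seq_scal_l _ C 0). apply (Hgap (m + 3)%nat). }
  assert (Hq2 : eventually (fun n => q n - p n < p n)).
  { pose proof (Hgap O) as H0. apply is_lim_seq_spec in H0. specialize (H0 (mkposreal 1 Rlt_0_1)).
    generalize (filter_and _ _ H0 (is_lim_seq_eventually_gt p 1 Hp)). apply filter_imp.
    intros n [H1 H2]. simpl in H1. fold (p n) (q n) in H1. apply Rabs_lt_between in H1.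
    rewrite Rmult_1_r, Rminus_0_r in H1.
    apply Rmult_lt_reg_r with (/ p n); [apply Rinv_0_lt_compat; lra |].
    rewrite Rinv_r by lra. unfold Rdiv in H1. lra. }
  generalize (filter_and _ _ (filter_and _ _ Huv Hq2)
    (filter_and _ _ (is_lim_seq_eventually_gt u (Rmax 200000 T1) Hu)
       (is_lim_seq_eventually_gt p 26880000 Hp))).
  apply filter_imp. intros n [[H1 H2] [H3 H4]].
  pose proof (Rmax_l 200000 T1). pose proof (Rmax_r 200000 T1).
  pose proof (gap_bound w (u n) (v n) Hw ltac:(lra)) as G1.
  pose proof (gap_increment w phi T1 (u n) (v n) Hw Hphi ltac:(lra)) as G2.
  destruct (ladder_comparison w phi T1 (u n) Hw Hphi ltac:(lra)) as [G3 G4].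
  pose proof (ladder_mono w phi T1 (u n) (v n) Hw Hphi ltac:(lra)) as G5.
  change (ladder1 phi (u n)) with (p n) in *. change (ladder1 phi (v n)) with (q n) in *.
  assert (G6 : p n <= q n) by (unfold p, q, ladder1; lra). clear G5.
  set (U := u n) in *. set (V := v n) in *. set (P := p n) in *. set (Q := q n) in *.
  pose proof (ln_ge_1 P ltac:(lra)) as HlP.
  assert (HlQ : ln (2 * Q) <= 2 * ln P).
  { replace (2 * ln P) with (ln (P * P)) by (rewrite ln_mult by lra; ring). apply ln_le; nra. }
  assert (HlQ0 : 0 <= ln (2 * Q)) by (rewrite <- ln_1; apply ln_le; lra).
  assert (HlU : ln U <= 4 * ln P).
  { replace (4 * ln P) with (ln (P * (P * P * P))) by (rewrite !ln_mult by nra; ring).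
    apply ln_le; [lra |]. apply Rle_trans with (1 := G3).
    assert (H5 : ln (2 * P) ^ 2 <= (2 * P) ^ 2).
    { apply pow_incr. split; [rewrite <- ln_1; apply ln_le; lra | apply ln_le_self; lra]. }
    apply Rle_trans with (6720000 * P * (2 * P) ^ 2).
    - apply Rmult_le_compat_l; lra.
    - replace (6720000 * P * (2 * P) ^ 2) with (26880000 * (P * P * P)) by ring.
      apply Rmult_le_compat_r; [| lra]. apply Rmult_le_pos; [apply Rmult_le_pos |]; lra. }
  assert (HlU0 : 0 <= ln U) by (rewrite <- ln_1; apply ln_le; lra).
  assert (HU0 : 0 < / U) by (apply Rinv_0_lt_compat; lra).
  assert (HUm : 0 <= ln U ^ m) by now apply pow_le.
  split.
  { unfold Rdiv. apply Rmult_le_pos; [| lra]. apply Rmult_le_pos; lra. }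
  assert (Hln2 : ln (2 * Q) ^ 2 <= 4 * ln P ^ 2).
  { replace (4 * ln P ^ 2) with ((2 * ln P) ^ 2) by ring. apply pow_incr; lra. }
  assert (G7 : V - U <= 256 * sqrt U + 48 * 160000 * 4 * ((Q - P) * ln P ^ 2)).
  { apply Rle_trans with (256 * sqrt U + 48 * (160000 * (Q - P) * (4 * ln P ^ 2))); [| lra].
    apply Rle_trans with (1 := G1). apply Rplus_le_compat_l. apply Rmult_le_compat_l; [lra |].
    apply Rle_trans with (1 := G2). apply Rmult_le_compat_l; lra. }
  apply Rle_trans with ((256 * sqrt U + 48 * 160000 * 4 * ((Q - P) * ln P ^ 2)) * (ln U ^ m * / U)).
  { unfold Rdiv. rewrite Rmult_assoc. apply Rmult_le_compat_r; auto. apply Rmult_le_pos; lra. }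
  rewrite Rmult_plus_distr_r. apply Rplus_le_compat.
  - right. assert (Hs : sqrt U * sqrt U = U) by (apply sqrt_sqrt; lra).
    assert (0 < sqrt U) by (apply sqrt_lt_R0; lra).
    rewrite <- Hs at 3. field. lra.
  - assert (Hiu : / U <= 432000 * ln U * / P).
    { apply Rmult_le_reg_r with (U * P); [nra |].
      replace (/ U * (U * P)) with P by (field; lra).
      replace (432000 * ln U * / P * (U * P)) with (432000 * U * ln U) by (field; lra). exact G4. }
    assert (HP0 : 0 < / P) by (apply Rinv_0_lt_compat; lra).
    assert (H8 : ln U ^ m * / U <= 432000 * (4 ^ S m * ln P ^ S m) * / P).
    { apply Rle_trans with (ln U ^ m * (432000 * ln U * / P)); [now apply Rmult_le_compat_l |].
      replace (ln U ^ m * (432000 * ln U * / P)) with (432000 * ln U ^ S m * / P) by (simpl; ring).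
      apply Rmult_le_compat_r; [lra |]. apply Rmult_le_compat_l; [lra |].
      rewrite <- Rpow_mult_distr. apply pow_incr; lra. }
    apply Rle_trans with (48 * 160000 * 4 * ((Q - P) * ln P ^ 2) * (432000 * (4 ^ S m * ln P ^ S m) * / P)).
    + apply Rmult_le_compat_l; auto. apply Rmult_le_pos; [lra |].
      apply Rmult_le_pos; [lra | apply pow_le; lra].
    + right. unfold C. replace (m + 3)%nat with (2 + S m)%nat by lia. rewrite pow_add.
      unfold Rdiv. ring.
Qed.

(** * The mean value points *)

Lemma iter_ladder_surjective (w phi : R -> R) (T1 X : R) (k : nat) : mean_square_density w ->
  ladder_from w phi T1 ->
  exists Y, forall y, Y <= y -> exists x, X <= x /\ Nat.iter k (ladder1 phi) x = y.
Proof.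
  intros Hw Hphi. induction k as [|k [Y IH]].
  - exists X. intros y Hy. now exists y.
  - destruct (ladder1_surjective w phi T1 Y Hw Hphi) as [Y' HY'].
    exists Y'. intros y Hy. destruct (HY' y Hy) as (z & Hz & Ez).
    destruct (IH z Hz) as (x & Hx & Ex). exists x. split; auto. simpl. now rewrite Ex.
Qed.

(** A priori [h] might send large [y] to small arguments. But every large [y] is the image of some
    large [x] by surjectivity, and [h] must return that [x]. *)
Lemma ladder_inverse_large (w phi h : R -> R) (T1 X : R) (k : nat) : mean_square_density w ->
  ladder_from w phi T1 -> inverse_at_infty (Nat.iter k (ladder1 phi)) h ->
  exists Y, forall y, Y <= y -> X <= h y /\ Nat.iter k (ladder1 phi) (h y) = y.
Proof.
  intros Hw Hphi [[M HM] _].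
  destruct (iter_ladder_surjective w phi T1 (Rmax X (M + 1)) k Hw Hphi) as [Y HY].
  exists Y. intros y Hy. destruct (HY y Hy) as (x & Hx & Ex).
  pose proof (Rmax_l X (M + 1)). pose proof (Rmax_r X (M + 1)).
  rewrite <- Ex, (HM x) by lra. split; [lra | reflexivity].
Qed.

Lemma iter_ladder_lim (w phi : R -> R) (T1 : R) (u : nat -> R) (i : nat) : mean_square_density w ->
  ladder_from w phi T1 -> is_lim_seq u p_infty ->
  is_lim_seq (fun n => Nat.iter i (ladder1 phi) (u n)) p_infty.
Proof.
  intros Hw Hphi Hu. induction i as [|i IH]; [exact Hu |].
  exact (ladder1_lim w phi T1 _ Hw Hphi IH).
Qed.

Lemma iter_ladder_mono (w phi : R -> R) (T1 : R) (u v : nat -> R) (i : nat) :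
  mean_square_density w -> ladder_from w phi T1 -> is_lim_seq u p_infty ->
  eventually (fun n => u n <= v n) ->
  eventually (fun n => Nat.iter i (ladder1 phi) (u n) <= Nat.iter i (ladder1 phi) (v n)).
Proof.
  intros Hw Hphi Hu Huv. induction i as [|i IH]; [exact Huv |].
  generalize (filter_and _ _ IH
    (is_lim_seq_eventually_gt _ T1 (iter_ladder_lim w phi T1 u i Hw Hphi Hu))).
  apply filter_imp. intros n [H1 H2]. simpl.
  pose proof (ladder_mono w phi T1 _ _ Hw Hphi (conj (Rlt_le _ _ H2) H1)).
  unfold ladder1 at 1 3. lra.
Qed.

Lemma iter_negligible_gap (w phi : R -> R) (T1 : R) (a b : nat -> R) (k i : nat) :
  mean_square_density w -> ladder_from w phi T1 -> is_lim_seq a p_infty ->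
  eventually (fun n => a n <= b n) -> (i <= k)%nat ->
  negligible_gap (fun n => Nat.iter k (ladder1 phi) (a n)) (fun n => Nat.iter k (ladder1 phi) (b n)) ->
  negligible_gap (fun n => Nat.iter i (ladder1 phi) (a n)) (fun n => Nat.iter i (ladder1 phi) (b n)).
Proof.
  intros Hw Hphi Ha Hab Hik Hk.
  assert (H : forall j, (j <= k)%nat ->
    negligible_gap (fun n => Nat.iter (k - j) (ladder1 phi) (a n))
                   (fun n => Nat.iter (k - j) (ladder1 phi) (b n))).
  { induction j as [|j IH]; intros Hj.
    - now rewrite Nat.sub_0_r.
    - specialize (IH ltac:(lia)). replace (k - j)%nat with (S (k - S j)) in IH by lia.
      apply (negligible_gap_pull w phi T1); auto.
      + now apply (iter_ladder_lim w phi T1).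
      + now apply (iter_ladder_mono w phi T1). }
  specialize (H (k - i)%nat ltac:(lia)). now replace (k - (k - i))%nat with i in H by lia.
Qed.

(** The comparison is with the left end point because [dladder_slowly_varying] requires ordered
    sequences, and the points [d] and [e] have no known order. *)
Lemma dladder_iter_ratio (w phi : R -> R) (T1 : R) (a b x : nat -> R) (k i : nat) :
  mean_square_density w -> ladder_from w phi T1 -> is_lim_seq a p_infty ->
  eventually (fun n => a n < x n < b n) -> (i <= k)%nat ->
  negligible_gap (fun n => Nat.iter k (ladder1 phi) (a n)) (fun n => Nat.iter k (ladder1 phi) (b n)) ->
  is_lim_seq (fun n => dladder w (2 * Nat.iter i (ladder1 phi) (x n))
                       / dladder w (2 * Nat.iter i (ladder1 phi) (a n))) 1.
Proof.
  intros Hw Hphi Ha Hx Hik Hgap.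
  assert (Hax : eventually (fun n => a n <= x n)) by (revert Hx; apply filter_imp; intros; lra).
  assert (Hab : eventually (fun n => a n <= b n)) by (revert Hx; apply filter_imp; intros; lra).
  assert (Hxlim : is_lim_seq x p_infty) by (apply is_lim_seq_le_p_loc with a; auto).
  assert (Hxb : eventually (fun n => x n <= b n)) by (revert Hx; apply filter_imp; intros; lra).
  pose proof (iter_ladder_mono w phi T1 a x i Hw Hphi Ha Hax) as M1.
  pose proof (iter_ladder_mono w phi T1 x b i Hw Hphi Hxlim Hxb) as M2.
  pose proof (iter_ladder_lim w phi T1 a i Hw Hphi Ha) as La.
  pose proof (iter_negligible_gap w phi T1 a b k i Hw Hphi Ha Hab Hik Hgap 1%nat) as G1.
  set (p := fun n => Nat.iter i (ladder1 phi) (a n)) in *.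
  set (q := fun n => Nat.iter i (ladder1 phi) (b n)) in *.
  set (y := fun n => Nat.iter i (ladder1 phi) (x n)) in *.
  apply (dladder_slowly_varying w (fun n => 2 * p n) (fun n => 2 * y n) Hw).
  - apply is_lim_seq_le_p_loc with p; auto.
    generalize (is_lim_seq_eventually_gt p 0 La). apply filter_imp. intros n Hn. lra.
  - revert M1. apply filter_imp. intros n Hn. unfold p, y. lra.
  - apply is_lim_seq_squeeze0 with (fun n => 2 * ((q n - p n) * ln (p n) ^ 1 / p n)).
    + generalize (filter_and _ _ (filter_and _ _ M1 M2) (is_lim_seq_eventually_gt p 3 La)).
      apply filter_imp. intros n [[H1 H2] H3]. fold (p n) (q n) (y n) in *.
      change (p n <= y n) in H1. change (y n <= q n) in H2.
      pose proof (ln_ge_1 (p n) ltac:(lra)) as Hl.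
      assert (H4 : ln (2 * p n) <= 2 * ln (p n)).
      { rewrite ln_mult by lra. assert (ln 2 <= ln (p n)) by (apply ln_le; lra). lra. }
      assert (H5 : 0 <= ln (2 * p n)) by (rewrite <- ln_1; apply ln_le; lra).
      replace ((2 * y n - 2 * p n) * ln (2 * p n) / (2 * p n))
        with ((y n - p n) * (ln (2 * p n) * / p n)) by (field; lra).
      assert (H6 : 0 < / p n) by (apply Rinv_0_lt_compat; lra). split.
      * apply Rmult_le_pos; [lra |]. apply Rmult_le_pos; lra.
      * replace (2 * ((q n - p n) * ln (p n) ^ 1 / p n)) with ((q n - p n) * (2 * ln (p n) * / p n))
          by (field; lra).
        apply Rmult_le_compat; [lra | apply Rmult_le_pos; lra | lra |].
        apply Rmult_le_compat_r; lra.
    + replace (Finite 0) with (Finite (2 * 0)) by (f_equal; ring).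
      now apply (is_lim_seq_scal_l _ 2 0).
Qed.

(** * Finite products and the limit of the mean value quotient *)

Lemma prodR_succ_l (F : nat -> R) (m n : nat) : prodR F m (S n) = F m * prodR F (S m) n.
Proof. reflexivity. Qed.

Lemma prodR_succ_r (F : nat -> R) (m n : nat) : prodR F m (S n) = prodR F m n * F (m + n)%nat.
Proof.
  revert m. induction n as [|n IH]; intros m.
  - unfold prodR. simpl. rewrite Nat.add_0_r. ring.
  - rewrite prodR_succ_l, IH, prodR_succ_l. replace (S m + n)%nat with (m + S n)%nat by lia. ring.
Qed.

Lemma prodR_shift (F : nat -> R) (m n : nat) : prodR (fun r => F (S r)) m n = prodR F (S m) n.
Proof.
  revert m. induction n as [|n IH]; intros m; [reflexivity |].
  now rewrite !prodR_succ_l, IH.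
Qed.

(** Reconciles the two indexings: [alpha] and [beta] with [1 <= r <= k] are the iterates of order
    [k - r], while the mean value formulas run over the iterates of order [0] to [k - 1]. *)
Lemma prodR_rev (F : nat -> R) (k : nat) : prodR (fun r => F (k - r)%nat) 1 k = prodR F 0 k.
Proof.
  induction k as [|k IH]; [reflexivity |].
  rewrite prodR_succ_l, <- prodR_shift, (prodR_succ_r F 0 k). simpl.
  rewrite Nat.sub_0_r, IH. ring.
Qed.

Lemma prodR_ext (F G : nat -> R) (m n : nat) :
  (forall r, (m <= r < m + n)%nat -> F r = G r) -> prodR F m n = prodR G m n.
Proof.
  revert m. induction n as [|n IH]; intros m H; [reflexivity |].
  rewrite !prodR_succ_l, (H m) by lia. f_equal. apply IH. intros r Hr. apply H. lia.
Qed.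

Lemma prodR_nonzero (F : nat -> R) (m n r : nat) :
  prodR F m n <> 0 -> (m <= r < m + n)%nat -> F r <> 0.
Proof.
  revert m. induction n as [|n IH]; intros m H Hr; [lia |].
  rewrite prodR_succ_l in H. destruct (Nat.eq_dec r m) as [-> | Hne].
  - intros E. apply H. rewrite E. ring.
  - apply (IH (S m)); [| lia]. intros E. apply H. rewrite E. ring.
Qed.

Lemma prodR_mult (F G : nat -> R) (m n : nat) :
  prodR (fun r => F r * G r) m n = prodR F m n * prodR G m n.
Proof.
  revert m. induction n as [|n IH]; intros m; [unfold prodR; simpl; ring |].
  rewrite !prodR_succ_l, IH. ring.
Qed.

Lemma is_lim_seq_prodR_1 (F : nat -> nat -> R) (m n : nat) :
  (forall r, (m <= r < m + n)%nat -> is_lim_seq (fun L => F L r) 1) ->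
  is_lim_seq (fun L => prodR (F L) m n) 1.
Proof.
  revert m. induction n as [|n IH]; intros m H; [apply is_lim_seq_const |].
  apply (is_lim_seq_ext (fun L => F L m * prodR (F L) (S m) n)); [reflexivity |].
  replace (Finite 1) with (Finite (1 * 1)) by (f_equal; ring).
  apply is_lim_seq_mult'; [apply H; lia |]. apply IH. intros r Hr. apply H. lia.
Qed.

Lemma TL_lim : is_lim_seq TL p_infty.
Proof.
  unfold TL. apply is_lim_seq_le_p_loc with INR; [| apply is_lim_seq_INR].
  exists O. intros n _. pose proof PI2_1. pose proof (pos_INR n). nra.
Qed.

Lemma hardyZ2_ratio (zeta : C -> C) (x y : R) : hardyZ2 zeta y <> 0 ->
  Cmod (zeta_half zeta x / zeta_half zeta y)%C ^ 2 = hardyZ2 zeta x / hardyZ2 zeta y.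
Proof.
  intros H. unfold hardyZ2 in *.
  assert (Hz : Cmod (zeta_half zeta y) <> 0) by (intros E; apply H; rewrite E; ring).
  assert (Hz' : zeta_half zeta y <> 0%C) by (intros E; apply Hz; rewrite E; apply Cmod_0).
  rewrite Cmod_div by auto. field. auto.
Qed.

Lemma ladder_preimages (w phi : R -> R) (T1 : R) (h : R -> R) (k : nat) (U : R) :
  mean_square_density w -> ladder_from w phi T1 ->
  inverse_at_infty (Nat.iter k (ladder1 phi)) h -> 0 <= U ->
  is_lim_seq (fun L => h (TL L + U)) p_infty /\
  eventually (fun L => Nat.iter k (ladder1 phi) (h (TL L + U)) = TL L + U).
Proof.
  intros Hw Hphi Hh HU. split.
  - apply is_lim_seq_spec. intros M.
    destruct (ladder_inverse_large w phi h T1 (M + 1) k Hw Hphi Hh) as [Y HY].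
    generalize (is_lim_seq_eventually_gt TL Y TL_lim). apply filter_imp. intros L HL.
    destruct (HY (TL L + U)) as [H1 _]; lra.
  - destruct (ladder_inverse_large w phi h T1 0 k Hw Hphi Hh) as [Y HY].
    generalize (is_lim_seq_eventually_gt TL Y TL_lim). apply filter_imp. intros L HL.
    destruct (HY (TL L + U)) as [_ H1]; [lra | exact H1].
Qed.

(* The factors [Z^2] of [phi1'] make up the zeta-quotients, the remaining
   factors [dladder] cancel in the limit. *)
Lemma mean_value_ratio (zeta : C -> C) (phi : R -> R) (T1 : R) (inv : nat -> R -> R) (U : R)
    (k0 k : nat) (d : nat -> nat -> (R -> R) -> R) (e : nat -> nat -> R) (f : R -> R) (I : R) :
  mean_square_density (hardyZ2 zeta) -> ladder_from (hardyZ2 zeta) phi T1 ->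
  inverse_at_infty (Nat.iter k (ladder1 phi)) (inv k) -> 0 < U -> (1 <= k <= k0)%nat ->
  is_choice_d (ladder1 phi) inv U k0 d -> is_choice_e (ladder1 phi) inv U k0 e ->
  (forall L, admissible (TL L) U f) -> (forall L, RInt f (TL L) (TL L + U) = I) ->
  is_lim_seq (fun L => f (alpha (ladder1 phi) d L k f 0)
                       * zeta_ratio_prod zeta (ladder1 phi) d e L k f) (I / U) /\
  eventually (fun L => TL L <= alpha (ladder1 phi) d L k f 0 <= TL L + U).
Proof.
  intros Hw Hphi Hinv HU Hk Hd He Hadm HI. unfold is_choice_d in Hd. unfold is_choice_e in He.
  set (w := hardyZ2 zeta) in *. set (psi := ladder1 phi) in *.
  set (a := fun L => inv k (TL L)). set (b := fun L => inv k (TL L + U)).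
  destruct (ladder_preimages w phi T1 (inv k) k 0 Hw Hphi Hinv ltac:(lra)) as [La0 Ea0].
  destruct (ladder_preimages w phi T1 (inv k) k U Hw Hphi Hinv ltac:(lra)) as [Lb Eb].
  assert (La : is_lim_seq a p_infty).
  { apply is_lim_seq_ext with (2 := La0). intros L. now rewrite Rplus_0_r. }
  assert (Ea : eventually (fun L => Nat.iter k psi (a L) = TL L)).
  { revert Ea0. apply filter_imp. intros L HL. now rewrite Rplus_0_r in HL. }
  clear La0 Ea0. fold b in Lb. fold psi in Eb.
  change (eventually (fun L => Nat.iter k psi (b L) = TL L + U)) in Eb.
  set (x := fun L => d L k f). set (z := fun L => e L k).
  assert (Hx : eventually (fun L => mean_value_point psi inv U L k f (x L))).
  { revert Hd. apply filter_imp. intros L HL. now apply HL. }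
  assert (Hz : eventually (fun L => mean_value_point psi inv U L k (fun _ => 1) (z L))).
  { revert He. apply filter_imp. intros L HL. now apply HL. }
  assert (Hxab : eventually (fun L => a L < x L < b L)).
  { revert Hx. apply filter_imp. intros L [HL _]. exact HL. }
  assert (Hzab : eventually (fun L => a L < z L < b L)).
  { revert Hz. apply filter_imp. intros L [HL _]. exact HL. }
  assert (Hgap : negligible_gap (fun L => Nat.iter k psi (a L)) (fun L => Nat.iter k psi (b L))).
  { intros m. pose proof (negligible_gap_const TL U ltac:(lra) TL_lim m) as G.
    apply is_lim_seq_ext_loc with (2 := G).
    generalize (filter_and _ _ Ea Eb). apply filter_imp. intros L [E1 E2]. now rewrite E1, E2. }
  assert (Lx : is_lim_seq x p_infty).
  { apply is_lim_seq_le_p_loc with a; auto. revert Hxab. apply filter_imp. intros; lra. }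
  assert (Lz : is_lim_seq z p_infty).
  { apply is_lim_seq_le_p_loc with a; auto. revert Hzab. apply filter_imp. intros; lra. }
  assert (Halpha : forall L, alpha psi d L k f 0 = Nat.iter k psi (x L)).
  { intros L. unfold alpha. now rewrite Nat.sub_0_r. }
  (* The index is [S r] because the derivative of the ladder at a point involves [dladder] at twice
     the image of that point. *)
  set (Dx := fun L r => dladder w (2 * Nat.iter (S r) psi (x L))).
  set (Dz := fun L r => dladder w (2 * Nat.iter (S r) psi (z L))).
  assert (Hratio : is_lim_seq (fun L => prodR (fun r => Dx L r / Dz L r) 0 k) 1).
  { apply (is_lim_seq_prodR_1 (fun L r => Dx L r / Dz L r)). intros r Hr.
    pose proof (dladder_iter_ratio w phi T1 a b x k (S r) Hw Hphi La Hxab ltac:(lia) Hgap) as R1.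
    pose proof (dladder_iter_ratio w phi T1 a b z k (S r) Hw Hphi La Hzab ltac:(lia) Hgap) as R2.
    fold psi in R1, R2.
    pose proof (iter_ladder_lim w phi T1 a (S r) Hw Hphi La) as Li. fold psi in Li.
    pose proof (iter_ladder_lim w phi T1 z (S r) Hw Hphi Lz) as Lj. fold psi in Lj.
    apply is_lim_seq_ext_loc with
      (fun L => (Dx L r / dladder w (2 * Nat.iter (S r) psi (a L)))
                / (Dz L r / dladder w (2 * Nat.iter (S r) psi (a L)))).
    - generalize (filter_and _ _ (is_lim_seq_eventually_gt _ 20000 Li)
        (is_lim_seq_eventually_gt _ 20000 Lj)). apply filter_imp. intros L [H1 H2].
      pose proof (dladder_pos w (2 * Nat.iter (S r) psi (a L)) Hw ltac:(lra)).
      pose proof (dladder_pos w (2 * Nat.iter (S r) psi (z L)) Hw ltac:(lra)).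
      unfold Dz. field. split; lra.
    - replace (Finite 1) with (Finite (1 / 1)) by (f_equal; field).
      apply is_lim_seq_div'; auto. }
  assert (Hbig : forall u, is_lim_seq u p_infty -> eventually (fun L => forall r, (r < k)%nat ->
     Derive psi (Nat.iter r psi (u L)) =
     w (Nat.iter r psi (u L)) / (2 * dladder w (2 * Nat.iter (S r) psi (u L))) /\
     0 < dladder w (2 * Nat.iter (S r) psi (u L)))).
  { intros u Lu. clear - Hw Hphi Lu. induction k as [|k IH].
    - exists O. intros; lia.
    - pose proof (iter_ladder_lim w phi T1 u k Hw Hphi Lu) as Li.
      pose proof (iter_ladder_lim w phi T1 u (S k) Hw Hphi Lu) as Lj.
      generalize (filter_and _ _ IH (filter_and _ _ (is_lim_seq_eventually_gt _ T1 Li)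
        (is_lim_seq_eventually_gt _ 20000 Lj))). apply filter_imp.
      intros L (H1 & H2 & H3) r Hr. destruct (Nat.eq_dec r k) as [-> | Hne].
      + split.
        * apply is_derive_unique. now apply (is_derive_ladder1 w phi T1).
        * apply dladder_pos; auto. fold psi in H3. lra.
      + apply H1. lia. }
  split.
  - apply is_lim_seq_ext_loc with (fun L => I / U * prodR (fun r => Dx L r / Dz L r) 0 k).
    2:{ replace (Finite (I / U)) with (Finite (I / U * 1)) by (f_equal; ring).
        now apply (is_lim_seq_scal_l _ (I / U) 1). }
    generalize (filter_and _ _ (filter_and _ _ (Hbig x Lx) (Hbig z Lz)) (filter_and _ _ Hx Hz)).
    apply filter_imp. intros L [[B1 B2] [[_ M1] [_ M2]]].
    rewrite HI in M1. rewrite RInt_Rconst in M2.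
    fold (a L) in M1, M2. fold (b L) in M1, M2. cbv zeta in M1, M2.
    rewrite Halpha.
    set (Wx := fun r => w (Nat.iter r psi (x L))). set (Wz := fun r => w (Nat.iter r psi (z L))).
    set (Px := prodR (fun r => Derive psi (Nat.iter r psi (x L))) 0 k) in *.
    set (Pz := prodR (fun r => Derive psi (Nat.iter r psi (z L))) 0 k) in *.
    (* The mean value formula for the constant [1] has the nonzero left-hand side [U]. Hence no
       factor of [Pz] vanishes, and zeta is nonzero at all the points [beta], so that the quotients
       are genuine. *)
    assert (HPz : Pz <> 0).
    { intros E. rewrite E in M2. lra. }
    assert (Hba : b L - a L <> 0).
    { intros E. rewrite E in M2. lra. }
    assert (HWz : forall r, (r < k)%nat -> Wz r <> 0).
    { intros r Hr E. pose proof (prodR_nonzero _ _ _ r HPz ltac:(lia)) as N. apply N.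
      rewrite (proj1 (B2 r Hr)). fold (Wz r). rewrite E. unfold Rdiv. ring. }
    assert (HP : zeta_ratio_prod zeta psi d e L k f = prodR (fun r => Wx r / Wz r) 0 k).
    { rewrite <- prodR_rev. unfold zeta_ratio_prod. apply prodR_ext. intros r Hr.
      unfold alpha, beta. fold (x L) (z L).
      rewrite hardyZ2_ratio; [reflexivity |]. apply (HWz (k - r)%nat). lia. }
    assert (HPP : prodR (fun r => Wx r / Wz r) 0 k * Pz = prodR (fun r => Dx L r / Dz L r) 0 k * Px).
    { unfold Px, Pz. rewrite <- !prodR_mult. apply prodR_ext. intros r Hr.
      destruct (B1 r ltac:(lia)) as [B3 B4]. destruct (B2 r ltac:(lia)) as [B5 B6].
      rewrite B3, B5. fold (Wx r) (Wz r). fold (Dx L r) (Dz L r).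
      change (dladder w (2 * Nat.iter (S r) psi (x L))) with (Dx L r) in *.
      change (dladder w (2 * Nat.iter (S r) psi (z L))) with (Dz L r) in *.
      pose proof (HWz r ltac:(lia)). field. repeat split; lra. }
    rewrite HP.
    replace (TL L + U - TL L) with U in M2 by ring.
    apply Rmult_eq_reg_r with Pz; auto. rewrite (Rmult_assoc (f (Nat.iter k psi (x L)))), HPP.
    rewrite M1. replace U with (Pz * (b L - a L)) by lra. field. auto.
  - assert (H1 : eventually (fun L => a L <= x L)) by (revert Hxab; apply filter_imp; intros; lra).
    assert (H2 : eventually (fun L => x L <= b L)) by (revert Hxab; apply filter_imp; intros; lra).
    generalize (filter_and _ _ (filter_and _ _ Ea Eb)
      (filter_and _ _ (iter_ladder_mono w phi T1 a x k Hw Hphi La H1)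
        (iter_ladder_mono w phi T1 x b k Hw Hphi Lx H2))).
    apply filter_imp. intros L [[E1 E2] [H3 H4]]. fold psi in H3, H4.
    rewrite Halpha. rewrite E1 in H3. rewrite E2 in H4. auto.
Qed.

(** * The trigonometric integrals and the conclusion *)

Lemma cos_TL (L : nat) (s : R) : cos (TL L + s) = cos s.
Proof.
  unfold TL. replace (2 * PI * INR L + s) with (s + 2 * INR L * PI) by ring. apply cos_period.
Qed.

Lemma sin_TL (L : nat) (s : R) : sin (TL L + s) = sin s.
Proof.
  unfold TL. replace (2 * PI * INR L + s) with (s + 2 * INR L * PI) by ring. apply sin_period.
Qed.

Lemma RInt_antiderivative (F f : R -> R) (a b : R) :
  (forall t, is_derive F t (f t)) -> (forall t, continuous f t) -> RInt f a b = F b - F a.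
Proof.
  intros HF Hf. apply is_RInt_unique. apply (is_RInt_derive F f); auto.
Qed.

Lemma continuous_trig (t : R) :
  continuous f1 t /\ continuous f2 t /\ continuous f3 t /\ continuous f4 t.
Proof.
  unfold f1, f2, f3, f4. repeat split; apply @ex_derive_continuous; auto_derive; auto.
Qed.

Lemma RInt_trig (L : nat) (U : R) :
  RInt f1 (TL L) (TL L + U) = sin U - sin U ^ 3 / 3 /\
  RInt f2 (TL L) (TL L + U) = sin U /\
  RInt f3 (TL L) (TL L + U) = (U + sin U * cos U) / 2 /\
  RInt f4 (TL L) (TL L + U) = (U - sin U * cos U) / 2.
Proof.
  assert (Hc0 : cos (TL L) = 1) by (rewrite <- (Rplus_0_r (TL L)), cos_TL; apply cos_0).
  assert (Hs0 : sin (TL L) = 0) by (rewrite <- (Rplus_0_r (TL L)), sin_TL; apply sin_0).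
  assert (Hsc : forall t, sin t * sin t = 1 - cos t * cos t).
  { intros t. pose proof (sin2_cos2 t) as H. unfold Rsqr in H. lra. }
  repeat split.
  - rewrite (RInt_antiderivative (fun t => sin t - sin t ^ 3 / 3)).
    + rewrite sin_TL, Hs0. real_eq. field.
    + intros t. unfold f1. auto_derive; auto.
      replace (cos t ^ 3) with (cos t * (1 - sin t * sin t)) by (rewrite Hsc; ring).
      simpl. field.
    + apply continuous_trig.
  - rewrite (RInt_antiderivative sin).
    + rewrite sin_TL, Hs0. real_eq. ring.
    + intros t. apply is_derive_sin.
    + apply continuous_trig.
  - rewrite (RInt_antiderivative (fun t => (t + sin t * cos t) / 2)).
    + rewrite sin_TL, cos_TL, Hs0. real_eq. field.
    + intros t. unfold f3. auto_derive; auto. pose proof (Hsc t). simpl. lra.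
    + apply continuous_trig.
  - rewrite (RInt_antiderivative (fun t => (t - sin t * cos t) / 2)).
    + rewrite sin_TL, cos_TL, Hs0. real_eq. field.
    + intros t. unfold f4. auto_derive; auto. pose proof (Hsc t). simpl. lra.
    + apply continuous_trig.
Qed.

Lemma admissible_trig (L : nat) (U : R) : 0 < U < PI / 2 ->
  admissible (TL L) U f1 /\ admissible (TL L) U f2 /\
  admissible (TL L) U f3 /\ admissible (TL L) U f4.
Proof.
  intros HU.
  assert (Hcont : forall f : R -> R, (forall t, continuous f t) ->
    continuous_on (fun t => TL L <= t <= TL L + U) f).
  { intros f Hf t _. apply filterlim_filter_le_1 with (2 := Hf t). apply filter_le_within. }
  assert (Hcos : forall t, TL L <= t <= TL L + U -> 0 <= cos t).
  { intros t Ht. replace t with (TL L + (t - TL L)) by ring. rewrite cos_TL.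
    apply cos_ge_0; lra. }
  assert (Hc0 : cos (TL L) = 1) by (rewrite <- (Rplus_0_r (TL L)), cos_TL; apply cos_0).
  assert (HsU : 0 < sin U) by (apply sin_gt_0; lra).
  repeat split; try (apply Hcont; apply continuous_trig).
  - intros t Ht. now apply pow_le, Hcos.
  - exists (TL L). unfold f1. rewrite Hc0. split; [lra |]. rewrite pow1. lra.
  - intros t Ht. now apply Hcos.
  - exists (TL L). unfold f2. rewrite Hc0. split; lra.
  - intros t Ht. apply pow2_ge_0.
  - exists (TL L). unfold f3. rewrite Hc0. split; [lra |]. rewrite pow1. lra.
  - intros t Ht. apply pow2_ge_0.
  (* Unlike the powers of the cosine, [f4] vanishes at the left end point, so the right one is the
     witness. *)
  - exists (TL L + U). unfold f4. rewrite sin_TL. split; [lra |]. apply pow_nonzero. lra.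
Qed.

Theorem mainTheorem1
  (zeta : C -> C) (Hzeta : is_riemann_zeta zeta)
  (phi : R -> R) (Hphi : is_jacob_ladder zeta phi)
  (inv : nat -> R -> R)
  (Hinv : forall k : nat,
     inverse_at_infty (Nat.iter k (ladder1 phi)) (inv k))
  (eps U : R) (Heps : 0 < eps < PI / 2) (HU : 0 < U <= PI / 2 - eps)
  (k0 k1 k2 k3 k4 : nat)
  (Hk1 : (1 <= k1 <= k0)%nat) (Hk2 : (1 <= k2 <= k0)%nat)
  (Hk3 : (1 <= k3 <= k0)%nat) (Hk4 : (1 <= k4 <= k0)%nat)
  (d : nat -> nat -> (R -> R) -> R)
  (Hd : is_choice_d (ladder1 phi) inv U k0 d)
  (e : nat -> nat -> R)
  (He : is_choice_e (ladder1 phi) inv U k0 e) :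
  let P L k f := zeta_ratio_prod zeta (ladder1 phi) d e L k f in
  let alpha0 L k f := alpha (ladder1 phi) d L k f 0 in
  asymp_equiv
    (fun L => P L k1 f1)
    (fun L =>
       cos (alpha0 L k2 f2) / cos (alpha0 L k1 f1) ^ 3 * P L k2 f2
       - U ^ 2 / 3 * (1 / (cos (alpha0 L k1 f1) ^ 3 * cos U ^ 3))
         * (cos (alpha0 L k3 f3) ^ 2 * P L k3 f3
            - sin (alpha0 L k4 f4) ^ 2 * P L k4 f4) ^ 3).
Proof.
  intros P alpha0.
  assert (HU2 : 0 < U < PI / 2) by lra.
  pose proof (hardyZ2_mean_square zeta Hzeta) as Hw.
  destruct (jacob_ladder_from zeta phi Hzeta Hphi) as [T1 HT1].
  pose proof (fun k f I Hk => mean_value_ratio zeta phi T1 inv U k0 k d e f I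
    Hw HT1 (Hinv k) (proj1 HU) Hk Hd He) as Hmain.
  destruct (Hmain k1 f1 (sin U - sin U ^ 3 / 3) Hk1) as [A1 R1];
    [intros L; apply (admissible_trig L U HU2) | intros L; apply RInt_trig |].
  destruct (Hmain k2 f2 (sin U) Hk2) as [A2 _];
    [intros L; apply (admissible_trig L U HU2) | intros L; apply RInt_trig |].
  destruct (Hmain k3 f3 ((U + sin U * cos U) / 2) Hk3) as [A3 _];
    [intros L; apply (admissible_trig L U HU2) | intros L; apply RInt_trig |].
  destruct (Hmain k4 f4 ((U - sin U * cos U) / 2) Hk4) as [A4 _];
    [intros L; apply (admissible_trig L U HU2) | intros L; apply RInt_trig |].
  set (a1 := fun L => f1 (alpha0 L k1 f1) * P L k1 f1).
  set (a2 := fun L => f2 (alpha0 L k2 f2) * P L k2 f2).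
  set (a3 := fun L => f3 (alpha0 L k3 f3) * P L k3 f3).
  set (a4 := fun L => f4 (alpha0 L k4 f4) * P L k4 f4).
  change (is_lim_seq a1 ((sin U - sin U ^ 3 / 3) / U)) in A1.
  change (is_lim_seq a2 (sin U / U)) in A2.
  change (is_lim_seq a3 ((U + sin U * cos U) / 2 / U)) in A3.
  change (is_lim_seq a4 ((U - sin U * cos U) / 2 / U)) in A4.
  assert (HsU : 0 < sin U) by (apply sin_gt_0; lra).
  assert (HcU : 0 < cos U) by (apply cos_gt_0; lra).
  pose proof (SIN_bound U) as HsU1.
  (* The common limit of [a1] and [B] must be nonzero for their quotient to tend to [1]. *)
  assert (Hs3 : 0 < sin U - sin U ^ 3 / 3).
  { assert (sin U ^ 3 <= sin U) by (simpl; nra). lra. }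
  (* The limit of [a3 - a4] is [sin U * cos U / U]; with this [c] its cube contributes exactly
     [sin U ^ 3 / (3 * U)]. *)
  set (c := U ^ 2 / (3 * cos U ^ 3)).
  set (B := fun L => a2 L - c * ((a3 L - a4 L) * ((a3 L - a4 L) * (a3 L - a4 L)))).
  assert (HB : is_lim_seq B ((sin U - sin U ^ 3 / 3) / U)).
  { set (g := (U + sin U * cos U) / 2 / U - (U - sin U * cos U) / 2 / U).
    replace ((sin U - sin U ^ 3 / 3) / U) with (sin U / U - c * (g * (g * g)))
      by (unfold c, g; field; lra).
    assert (Hg : is_lim_seq (fun L => a3 L - a4 L) g) by now apply is_lim_seq_minus'.
    apply is_lim_seq_minus'; [exact A2 |].
    apply (is_lim_seq_scal_l _ c (g * (g * g))).
    apply is_lim_seq_mult'; [| apply is_lim_seq_mult']; exact Hg. }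
  assert (Hlim : is_lim_seq (fun L => a1 L / B L) 1).
  { replace (Finite 1) with (Finite ((sin U - sin U ^ 3 / 3) / U / ((sin U - sin U ^ 3 / 3) / U))).
    - apply is_lim_seq_div'; auto. apply Rgt_not_eq. apply Rmult_lt_0_compat; auto.
      now apply Rinv_0_lt_compat.
    - f_equal. field. lra. }
  assert (HB0 : eventually (fun L => B L <> 0)).
  { apply is_lim_seq_spec in HB.
    assert (Hpos : 0 < (sin U - sin U ^ 3 / 3) / U)
      by (apply Rmult_lt_0_compat; auto; now apply Rinv_0_lt_compat).
    specialize (HB (mkposreal _ Hpos)). revert HB. apply filter_imp. intros L HL E.
    simpl in HL. rewrite E in HL. apply Rabs_lt_between in HL. lra. }
  apply is_lim_seq_ext_loc with (2 := Hlim).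
  generalize (filter_and _ _ R1 HB0). apply filter_imp. intros L [HL HBL].
  change (TL L <= alpha0 L k1 f1 <= TL L + U) in HL.
  (* Up to a multiple of [2 * PI] the argument lies in [[0, U]], and [U < PI / 2]. *)
  assert (Hc : cos (alpha0 L k1 f1) <> 0).
  { apply Rgt_not_eq. set (t := alpha0 L k1 f1) in *.
    replace t with (TL L + (t - TL L)) by ring. rewrite cos_TL. apply cos_gt_0; lra. }
  assert (E1 : a1 L = cos (alpha0 L k1 f1) ^ 3 * P L k1 f1) by reflexivity.
  assert (EB : cos (alpha0 L k2 f2) / cos (alpha0 L k1 f1) ^ 3 * P L k2 f2
       - U ^ 2 / 3 * (1 / (cos (alpha0 L k1 f1) ^ 3 * cos U ^ 3))
         * (cos (alpha0 L k3 f3) ^ 2 * P L k3 f3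
            - sin (alpha0 L k4 f4) ^ 2 * P L k4 f4) ^ 3
     = B L / cos (alpha0 L k1 f1) ^ 3).
  { unfold B, a2, a3, a4, f2, f3, f4, c. field. split; lra. }
  rewrite EB, E1. field. split; auto.
Qed.
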